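(* Assume that there exists a sequence of positive integers $n_k$, $k=1,2,\dots$, such that $$\lim_{k\to\infty}\frac{n_k}{k}=\sigma,\qquad \lim_{k\to\infty}\frac1k\log\left|\{\log S_{n_k}\}-\frac ab\right|=-\tau,$$ for some integers $a,b$ (with $b\neq 0$) and positive real numbers $\sigma,\tau$, with $\tau\ne 2\sigma\log(4/e)$. Then $\gamma$ has irrationality exponent $\mu(\gamma)\le\mu_{\sigma,\tau}$, where $$\mu_{\sigma,\tau}=\begin{cases}1+\dfrac{2\sigma}{\tau}\log(2e) & \text{if } \tau<2\sigma\log(4/e),\\[2mm] \dfrac{\log 8}{\log 4-1} & \text{if } \tau>2\sigma\log(4/e),\end{cases}$$ that is, for any $\varepsilon>0$ there exists $q(\varepsilon)>0$ such that $$\left|\gamma-\frac pq\right|>\frac{1}{q^{\mu_{\sigma,\tau}+\varepsilon}}\quad\text{for all integers } p,q \text{ with } q\ge q(\varepsilon).$$ In particular, the hypothesis implies that $\gamma$ is irrational, but is not a Liouville number. The same result holds with $\{\log S_{n_k}\}$ replaced by $\|\log S_{n_k}\|$ in the hypothesis.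
   Context: $\gamma=\lim_{N\to\infty}\left(1+\frac12+\cdots+\frac1N-\log N\right)$ is Euler's constant. $\log$ is the natural logarithm. For real $t>0$, $\{t\}$ denotes the fractional part of $t$ and $\|t\|$ denotes the distance from $t$ to the nearest integer. For a positive integer $n$, $d_n$ denotes the least common multiple of $1,2,\dots,n$, and $S_n$ is the positive integer $$S_n=\prod_{m=1}^{n}\ \prod_{k=0}^{\min(m-1,\,n-m)}\ \prod_{j=k+1}^{n-k}(n+m)^{\binom{n}{k}^2\frac{2d_{2n}}{j}} .$$ Irrationality exponent: let $\alpha$ be an irrational real number. If there exists $\mu>0$ with the property that for any $\varepsilon>0$ there is a positive integer $q(\varepsilon)$ such that $\left|\alpha-\frac pq\right|>\frac{1}{q^{\mu+\varepsilon}}$ for all integers $p,q$ with $q\ge q(\varepsilon)$, then the least such $\mu$ is denoted $\mu(\alpha)$ and called the irrationality exponent of $\alpha$. If no such $\mu$ exists, one writes $\mu(\alpha)=\infty$ and calls $\alpha$ a Liouville number. The assertion $\mu(\gamma)\le M$ includes the assertion that $\gamma$ is irrational. *)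

(* Defs.v *)
From mathcomp Require Import all_boot all_order all_algebra.
From mathcomp Require Import all_classical all_reals all_analysis.
From mathcomp Require Import lra.

Set Implicit Arguments.
Unset Strict Implicit.
Unset Printing Implicit Defensive.

Import Order.TTheory GRing.Theory Num.Theory.
Import numFieldNormedType.Exports.

Local Open Scope classical_set_scope.
Local Open Scope ring_scope.

Definition lcm_upto (n : nat) : nat := \big[lcmn/1%N]_(1 <= i < n.+1) i.

(* The exponent is a natural number: the division is exact since j <= n, see
   [dvdn_lcm_upto]. For m >= 1 the bound k <= min(m - 1, n - m) reads
   k < (minn m.-1 (n - m)).+1. *)
Definition S_prod (n : nat) : nat :=
  (\prod_(1 <= m < n.+1)
    \prod_(0 <= k < (minn m.-1 (n - m)).+1)
      \prod_(k.+1 <= j < (n - k).+1)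
        (n + m) ^ ('C(n, k) ^ 2 * (2 * lcm_upto (2 * n) %/ j)))%N.

Lemma dvdn_lcm_upto (n j : nat) :
  (0 < j <= n)%N -> (j %| lcm_upto n)%N.
Proof.
move=> /andP[j0 jn]; rewrite /lcm_upto.
have jin : j \in index_iota 1 n.+1 by rewrite mem_index_iota j0 ltnS.
by rewrite (big_rem j) //= dvdn_lcml.
Qed.

Section RealDefs.
Variable R : realType.
Implicit Types (x alpha mu sigma tau : R).

Definition euler_gamma : R :=
  lim ((series harmonic N - ln N%:R : R) @[N --> \oo]).

Definition frac_part x : R := x - (Num.floor x)%:~R.

Definition dist_int x : R := inf [set `|x - m%:~R| | m in [set: int]].

Definition approx_exponent alpha mu : Prop :=
  forall eps : R, 0 < eps -> exists q0 : int, 0 < q0 /\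
    forall p q : int, q0 <= q ->
      `|alpha - p%:~R / q%:~R| > 1 / q%:~R `^ (mu + eps).

(* The value is +oo exactly when no mu is admissible; otherwise the infimum is
   a minimum, see [irrationality_exponent_min]. In particular it is +oo at
   every rational alpha, so irrationality is to be required separately. *)
Definition irrationality_exponent alpha : \bar R :=
  ereal_inf [set mu%:E | mu in [set mu | 0 < mu /\ approx_exponent alpha mu]].

Definition liouville alpha : Prop :=
  irrational alpha /\ irrationality_exponent alpha = +oo%E.

Definition mu_bound sigma tau : R :=
  if tau < 2 * sigma * ln (4 / expR 1)
  then 1 + 2 * sigma / tau * ln (2 * expR 1)
  else ln 8 / (ln 4 - 1).

Lemma approx_exponent_ge1 alpha mu : approx_exponent alpha mu -> 1 <= mu.
Proof.
move=> h; rewrite leNgt; apply/negP => mu1.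
have [q0 [q00 hq]] := h (1 - mu) ltac:(by rewrite subr_gt0).
have q0R : 0 < q0%:~R :> R by rewrite ltr0z.
have := hq (Num.floor (alpha * q0%:~R)) q0 (lexx _).
rewrite addrC subrK powRr1 ?ltW// ltNge => /negP; apply.
have [f1 f2] := (floor_le (alpha * q0%:~R), floorD1_gt (alpha * q0%:~R)).
set f := Num.floor _ in f1 f2 *.
have -> : alpha - f%:~R / q0%:~R = (alpha * q0%:~R - f%:~R) / q0%:~R.
  by rewrite mulrBl mulfK ?gt_eqF.
rewrite normrM normfV (gtr0_norm q0R) ler_pM2r ?invr_gt0//.
move: f2; rewrite intrD => f2.
by rewrite ger0_norm; lra.
Qed.

Lemma irrationality_exponent_min alpha mu : 0 < mu -> approx_exponent alpha mu ->
  exists m : R, [/\ irrationality_exponent alpha = m%:E, 0 < m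
                  & approx_exponent alpha m].
Proof.
move=> mu0 hmu; set E := [set mu | 0 < mu /\ approx_exponent alpha mu].
have E0 : E !=set0 by exists mu.
have lbE : lbound E 1 by move=> y [_ /approx_exponent_ge1].
have hE : has_inf E by split=> //; exists 1.
exists (inf E); split.
- by rewrite /irrationality_exponent ereal_inf_EFin//; exists 1.
- by apply: (lt_le_trans ltr01); apply: lb_le_inf.
- move=> eps eps0.
  have e2 : 0 < eps / 2 by rewrite divr_gt0.
  have [nu [_ hnu] nulow] := inf_adherent e2 hE.
  have [q0 [q00 hq]] := hnu _ e2.
  exists q0; split=> // p q q0q; apply: le_lt_trans (hq p q q0q).
  have q1 : 1 <= q%:~R :> R.
    by rewrite ler1z -gtz0_ge1 (lt_le_trans q00).
  rewrite !div1r lef_pV2 ?posrE ?powR_gt0 ?(lt_le_trans ltr01)//.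
  by apply: ler_powR => //; lra.
Qed.

End RealDefs.

Arguments euler_gamma {R}.

(* Main.v *)
(* Let R_n(x) = n! / (x (x + 1) ... (x + n)).  Expanding R_n^2 in partial fractions,
   integrating over [v, +oo[ and summing over v > n gives a positive linear form
   I_n = q_n gamma - A_n + L_n with q_n = sum_k C(n, k)^2 <= 4^n, d_{2n} A_n an integer
   and d_{2n} L_n = log S_n.  The integrand makes I_n equal to 16^{-n} up to a
   polynomial factor, so with the prime number theorem d_{2n} I_n has exponential rate
   2 (log 4 - 1) in n.

   The hypothesis says that b log S_{n_k} = M_k + b t_k with M_k an integer and |t_k| of
   exponential rate tau in k.  Then b (d_{2n} I_n - t_k), with n = n_k, is an integer
   linear form in 1 and gamma whose exact rate is the smaller of tau and
   2 sigma (log 4 - 1) because the two differ, while the coefficient of gamma grows at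
   rate at most 2 sigma log (2 e).  Two-sided control of a sequence of forms bounds the
   irrationality exponent, with no determinant condition: if p/q makes a form vanish,
   then |gamma - p/q| is the size of that form divided by the coefficient of gamma.

   The prime number theorem is obtained without complex analysis.  The function
   - z zeta(1 - z) is handled through its truncations Dsum on Re z <= 0; they are
   uniformly Lipschitz, and the 3-4-1 inequality, integrated along a horizontal
   segment, bounds them away from 0.  Hence zeta'/zeta minus its pole is uniformly
   Lipschitz on vertical segments, and integrating it against the Fejer kernel yields the
   asymptotics of the von Mangoldt weights in short windows. *)
Require Import Defs.
From mathcomp Require Import all_boot all_order all_algebra.
From mathcomp Require Import all_classical all_reals all_analysis.
From mathcomp Require Import complex ring lra zify.
Import Order.TTheory GRing.Theory Num.Theory.
Import numFieldNormedType.Exports.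
Local Open Scope classical_set_scope.
Local Open Scope ring_scope.
Set Implicit Arguments.
Unset Strict Implicit.
Unset Printing Implicit Defensive.

(** * Integrals of continuous functions *)

Section Integral.
Variable R : realType.
Implicit Types (a b c M : R) (f g F : R -> R).

(** The variable z = 1 - s puts the region of convergence at Re z < 0 and the pole of zeta at 0.
    Only finite sums occur. The identity expressing the derivative of zeta as a Dirichlet product
    fails for truncations at N by N^(Re z), up to logarithms. So N tends to infinity first, with
    bounds that do not depend on Re z, and the boundary line is approached afterwards; this replaces
    analytic continuation.

    Non-vanishing is quantitative. At Re z = x < 0, away from the pole, the 3-4-1 product bounds the
    eighth power of |Dsum| below by a multiple of |x|^6. Hence |Dsum| is at least of order
    |x|^(3/4), which for small |x| exceeds the Lipschitz loss, of order |x|, on the way to the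
    boundary.

    The prime number theorem enters through d_{2n} alone. The argument compares two rates and
    concludes from two-sided bounds, so it needs the exact rate of d_{2n}; Chebyshev bounds would
    leave a gap between the lower and the upper estimate of the forms. *)

Definition intg a b f : R := \int[lebesgue_measure]_(x in `[a, b]) f x.

Lemma intg_integrable a b f : continuous f ->
  (@lebesgue_measure R).-integrable `[a, b] (EFin \o f).
Proof.
move=> cf; apply: continuous_compact_integrable; first exact: segment_compact.
exact: continuous_subspaceT.
Qed.

Lemma eq_intg a b f g : {in `[a, b], f =1 g} -> intg a b f = intg a b g.
Proof. by move=> fg; apply: eq_Rintegral => x; rewrite inE => /fg. Qed.

Lemma intgZ a b f r : continuous f -> intg a b (fun x => r * f x) = r * intg a b f.
Proof. by move=> cf; apply: RintegralZl => //; exact: intg_integrable. Qed.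

Lemma intgD a b f g : continuous f -> continuous g ->
  intg a b (fun x => f x + g x) = intg a b f + intg a b g.
Proof. by move=> cf cg; apply: RintegralD => //; exact: intg_integrable. Qed.

Lemma intgB a b f g : continuous f -> continuous g ->
  intg a b (fun x => f x - g x) = intg a b f - intg a b g.
Proof. by move=> cf cg; apply: RintegralB => //; exact: intg_integrable. Qed.

Lemma continuous_sum (I : Type) (s : seq I) (P : pred I) (f : I -> R -> R) :
  (forall i, continuous (f i)) -> continuous (fun x => \sum_(i <- s | P i) f i x).
Proof.
move=> cf; elim: s => [|i s IH] x.
  by under eq_fun do rewrite big_nil; exact: cvg_cst.
under eq_fun do rewrite big_cons; case: ifP => _; last exact: IH.
by apply: (@continuousD _ R^o _ (f i)); [exact: cf|exact: IH].
Qed.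

Lemma is_derive_bigsum (I : Type) (s : seq I) (f : I -> R -> R) (d : I -> R) x :
  (forall i, is_derive x (1 : R) (f i) (d i)) ->
  is_derive x (1 : R) (fun y => \sum_(i <- s) f i y) (\sum_(i <- s) d i).
Proof.
move=> df; elim: s => [|i s IH].
  by rewrite big_nil; under eq_fun do rewrite big_nil; exact: is_derive_cst.
rewrite big_cons; under eq_fun do rewrite big_cons.
exact: is_deriveD.
Qed.

Lemma intg_cst a b M : a <= b -> intg a b (fun=> M) = M * (b - a).
Proof.
move=> ab; rewrite /intg Rintegral_cst//= lebesgue_measure_itv/= lte_fin.
by move: ab; rewrite le_eqVlt => /predU1P[->|->//]; rewrite ltxx subrr.
Qed.

Lemma intg_sum a b (I : Type) (s : seq I) (P : pred I) (f : I -> R -> R) :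
  a <= b -> (forall i, continuous (f i)) ->
  intg a b (fun x => \sum_(i <- s | P i) f i x) = \sum_(i <- s | P i) intg a b (f i).
Proof.
move=> ab cf; elim: s => [|i s IH].
  rewrite big_nil -[RHS](mul0r (b - a)) -intg_cst//.
  by apply: eq_intg => x _; rewrite big_nil.
rewrite big_cons -IH; case: ifP => Pi.
  rewrite -intgD//; last exact: continuous_sum.
  by apply: eq_intg => x _; rewrite big_cons Pi.
by apply: eq_intg => x _; rewrite big_cons Pi.
Qed.

Lemma intg_le a b f g : continuous f -> continuous g ->
  {in `[a, b], forall x, f x <= g x} -> intg a b f <= intg a b g.
Proof.
move=> cf cg fg; apply: le_Rintegral => //; try exact: intg_integrable.
Qed.

Lemma intg_norm_le a b f M : a <= b -> continuous f ->
  {in `[a, b], forall x, `|f x| <= M} -> `|intg a b f| <= M * (b - a).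
Proof.
move=> ab cf fM; apply: le_trans (le_normr_Rintegral _ _) _ => //.
  exact: intg_integrable.
rewrite -intg_cst//; apply: intg_le => //.
  by move=> x; apply: (continuous_comp (cf x)); exact: (@norm_continuous _ R^o).
by move=> x; exact: cvg_cst.
Qed.

Lemma intg_FTC a b f F : a <= b -> continuous f ->
  (forall x, is_derive x (1 : R) F (f x)) -> intg a b f = F b - F a.
Proof.
move=> + cf dF; rewrite le_eqVlt => /predU1P[->|ab].
  by rewrite /intg set_itv1 Rintegral_set1 subrr.
rewrite /intg /Rintegral (@continuous_FTC2 _ f F)//.
- exact: continuous_subspaceT.
- have cF : continuous F by move=> x; apply/differentiable_continuous/derivable1_diffP; exact: ex_derive.
  by split=> [x _||]; [exact: ex_derive|apply: cvg_at_right_filter; exact: cF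
    |apply: cvg_at_left_filter; exact: cF].
- by move=> x _; rewrite derive1E derive_val.
Qed.

Lemma intg_cat a b c f : a <= b -> b <= c -> continuous f ->
  intg a c f = intg a b f + intg b c f.
Proof.
move=> ab bc cf.
have := @Rintegral_itvB R f (BLeft a) (BRight c) b (@intg_integrable a c f cf).
rewrite !bnd_simp => /(_ ab bc) h; rewrite addrC; apply/eqP; rewrite -subr_eq.
rewrite /intg h; apply/eqP; apply: Rintegral_itv_obnd_cbnd.
apply: integrableS (@intg_integrable b c f cf) => //.
exact: subset_itv_oc_cc.
Qed.

End Integral.

(** * Lipschitz bounds for the complex exponential on Re z <= 0 *)

Section ComplexExp.
Variable R : realType.
Local Notation C := (Rcomplex R).
Local Notation cabs z := (@Num.norm R (complex_Rcomplex__canonical__Num_SemiNormedZmodule R) z).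
Local Notation Re := (@complex.Re R).
Local Notation Im := (@complex.Im R).
Implicit Types (z w : C) (x y l : R).

Lemma cnormE z : cabs z = Num.sqrt (Re z ^+ 2 + Im z ^+ 2) :> R.
Proof. by case: z. Qed.

Lemma cnorm_sqr z : cabs z ^+ 2 = Re z ^+ 2 + Im z ^+ 2.
Proof. by rewrite cnormE sqr_sqrtr// addr_ge0 ?sqr_ge0. Qed.

Lemma cnormM z w : cabs (z * w) = cabs z * cabs w.
Proof. exact: Normc.normcM. Qed.

Lemma cnorm1 : cabs 1 = 1.
Proof. exact: Normc.normc1. Qed.

Lemma cnormV z : cabs z^-1 = (cabs z)^-1.
Proof. exact: Normc.normcV. Qed.

Lemma Re_le_cnorm z : `|Re z| <= cabs z.
Proof.
rewrite -ler_sqr ?nnegrE// cnorm_sqr -normrX ger0_norm ?sqr_ge0//.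
by rewrite lerDl sqr_ge0.
Qed.

Lemma Im_le_cnorm z : `|Im z| <= cabs z.
Proof.
rewrite -ler_sqr ?nnegrE// cnorm_sqr -normrX ger0_norm ?sqr_ge0//.
by rewrite lerDr sqr_ge0.
Qed.

Lemma cnorm_le z : cabs z <= `|Re z| + `|Im z|.
Proof.
rewrite -ler_sqr ?nnegrE ?addr_ge0// cnorm_sqr -(real_normK (num_real (Re z))).
rewrite -(real_normK (num_real (Im z))) sqrrD.
have := normr_ge0 (Re z); have := normr_ge0 (Im z); set u := `|_|; set v := `|_|.
by move=> u0 v0; have := mulr_ge0 u0 v0; rewrite mulr2n; nra.
Qed.

Lemma cReD z w : Re (z + w) = Re z + Re w. Proof. by case: z; case: w. Qed.
Lemma cImD z w : Im (z + w) = Im z + Im w. Proof. by case: z; case: w. Qed.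
Lemma cReN z : Re (- z) = - Re z. Proof. by case: z. Qed.
Lemma cImN z : Im (- z) = - Im z. Proof. by case: z. Qed.
Lemma cReM z w : Re (z * w) = Re z * Re w - Im z * Im w.
Proof. by case: z; case: w. Qed.
Lemma cImM z w : Im (z * w) = Re z * Im w + Im z * Re w.
Proof. by case: z => a b; case: w => c d. Qed.

Definition cexp z : C := Complex (expR (Re z) * cos (Im z)) (expR (Re z) * sin (Im z)).

Lemma cexp0 : cexp 0 = 1.
Proof. by rewrite /cexp/= expR0 cos0 sin0 !mul1r. Qed.

Lemma cexpD z w : cexp (z + w) = cexp z * cexp w.
Proof.
apply/eqP; rewrite eq_complex cReM cImM /= cReD cImD expRD cosD sinD.
by apply/andP; split; apply/eqP; ring.
Qed.

Lemma cnorm_cexp z : cabs (cexp z) = expR (Re z).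
Proof.
rewrite cnormE/= !exprMn -mulrDr cos2Dsin2 mulr1 sqrtr_sqr ger0_norm ?expR_ge0//.
Qed.

Lemma one_sub_cos_le x : 1 - cos x <= x ^+ 2 / 2.
Proof.
wlog x0 : x / 0 <= x => [h|].
  have [/h//|/ltW x0] := leP 0 x.
  by rewrite -cosN -sqrrN; apply: h; rewrite oppr_ge0.
have sin_le y : 0 <= y -> sin y <= y.
  rewrite le_eqVlt => /predU1P[<-|y0]; first by rewrite sin0.
  have [c _ ] := @MVT R sin cos 0 y y0 (fun x _ => is_derive_sin x)
    (continuous_subspaceT (@continuous_sin R)).
  by rewrite sin0 !subr0 => ->; rewrite -[leRHS]mul1r ler_pM2r// cos_le1.
move: x0; rewrite le_eqVlt => /predU1P[<-|x0]; first by rewrite cos0 subrr expr0n mul0r.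
pose f (y : R) := y ^+ 2 / 2 + cos y.
have df (y : R) : is_derive y 1 f (y - sin y).
  by apply: is_derive_eq; rewrite /GRing.scale/=; field.
have cf : {within `[0, x], continuous f}.
  by apply: derivable_within_continuous => y _; exact: ex_derive.
have [c] := MVT x0 (fun y _ => df y) cf; rewrite /f.
rewrite in_itv/= cos0 => /andP[c0 cx] h.
have : 0 <= (c - sin c) * (x - 0) by rewrite mulr_ge0 ?subr_ge0 ?sin_le ?ltW.
by rewrite -h; lra.
Qed.

Lemma sub_sin_le x : `|sin x - x| <= x ^+ 2.
Proof.
wlog x0 : x / 0 <= x => [h|].
  have [/h//|/ltW x0] := leP 0 x.
  rewrite -sqrrN -normrN opprB -[in X in `|X|](opprK x) sinN opprK addrC.
  by rewrite addrC; have := h (- x); rewrite oppr_ge0 => /(_ x0); rewrite opprK addrC opprK.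
move: x0; rewrite le_eqVlt => /predU1P[<-|x0].
  by rewrite sin0 subr0 normr0 sqr_ge0.
pose f (y : R) := sin y - y.
have df (y : R) : is_derive y 1 f (cos y - 1) by apply: is_derive_eq.
have cf : {within `[0, x], continuous f}.
  by apply: derivable_within_continuous => y _; exact: ex_derive.
have [c] := MVT x0 (fun y _ => df y) cf; rewrite /f.
rewrite in_itv/= sin0 !subr0 => /andP[c0 cx] ->.
rewrite normrM (gtr0_norm x0) expr2 ler_pM2r// ler0_norm ?subr_le0 ?cos_le1//.
rewrite opprB; have [x1|x1] := leP x 2; last first.
  have := cos_geN1 c; lra.
apply: le_trans (one_sub_cos_le c) _; nra.
Qed.

Lemma expR_sub1_norm x : x <= 0 -> `|expR x - 1| <= `|x|.
Proof.
move=> x0; rewrite !ler0_norm// ?subr_le0 ?expR_le1//.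
by have := expR_ge1Dx x; lra.
Qed.

Lemma expR_sub1x_norm x : x <= 0 -> `|expR x - 1 - x| <= x ^+ 2.
Proof.
move=> x0; rewrite ger0_norm; last by have := expR_ge1Dx x; lra.
have := expR_ge1Dx (- x); rewrite expRN => h.
have e0 := expR_gt0 x.
have h1 : expR x * (1 - x) <= 1 by rewrite -ler_pdivlMl// mulr1.
have := expR_ge1Dx x => h2.
have : 0 <= (- x) * (expR x - 1 - x) by rewrite mulr_ge0// ?oppr_ge0//; lra.
nra.
Qed.

(** Squaring separates modulus and argument: with z = a + ib the square is [(expR a - 1) ^+ 2 + 2 *
    expR a * (1 - cos b)], and for a <= 0 its two terms are at most a^2 and b^2. *)
Lemma cexp_sub1_le z : Re z <= 0 -> cabs (cexp z - 1) <= cabs z.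
Proof.
move=> z0; rewrite -ler_sqr ?nnegrE// !cnorm_sqr cReD cImD cReN cImN/= oppr0 addr0.
set a := Re z in z0 *; set b := Im z.
have -> : (expR a * cos b - 1) ^+ 2 + (expR a * sin b) ^+ 2 =
  (expR a - 1) ^+ 2 + 2 * expR a * (1 - cos b).
  rewrite exprMn sin2cos2; ring.
apply: lerD; first by rewrite -ler_sqrt ?sqr_ge0// !sqrtr_sqr expR_sub1_norm.
have e1 : expR a <= 1 by rewrite expR_le1.
have := one_sub_cos_le b; have := cos_le1 b; have := expR_gt0 a.
nra.
Qed.

(** The quadratic Taylor remainder. Evaluated at [ell n * z] it is of order n^-2, which makes the
    increments of [Dsum] summable. *)
Definition crho z : C := cexp z - 1 - z.

Lemma crho_le z : Re z <= 0 -> cabs (crho z) <= 3 * cabs z ^+ 2.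
Proof.
move=> z0; apply: le_trans (cnorm_le _) _; rewrite cnorm_sqr.
rewrite /crho !cReD !cImD !cReN !cImN/= oppr0 addr0.
set a := Re z in z0 *; set b := Im z.
have e1 : expR a <= 1 by rewrite expR_le1.
have e0 := expR_gt0 a.
have h1 : `|expR a * cos b - 1 - a| <= a ^+ 2 + b ^+ 2 / 2.
  have -> : expR a * cos b - 1 - a = (expR a - 1 - a) - expR a * (1 - cos b) by ring.
  apply: le_trans (ler_normB _ _) _; apply: lerD (expR_sub1x_norm z0) _.
  rewrite normrM (ger0_norm (ltW e0)) ger0_norm ?subr_ge0 ?cos_le1//.
  by apply: le_trans (one_sub_cos_le b); rewrite ler_piMl// subr_ge0 cos_le1.
have h2 : `|expR a * sin b - b| <= b ^+ 2 + `|a| * `|b|.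
  have -> : expR a * sin b - b = expR a * (sin b - b) + (expR a - 1) * b by ring.
  apply: le_trans (ler_normD _ _) _; rewrite !normrM; apply: lerD.
    rewrite (ger0_norm (ltW e0)); apply: le_trans (sub_sin_le b).
    by rewrite ler_piMl.
  by apply: ler_wpM2r => //; exact: expR_sub1_norm.
apply: le_trans (lerD h1 h2) _.
rewrite -(real_normK (num_real a)) -(real_normK (num_real b)).
have := normr_ge0 a; have := normr_ge0 b; set u := `|_|; set v := `|_| => u0 v0.
have := sqr_ge0 (u - v); nra.
Qed.

Lemma cexp_lip z w : Re z <= 0 -> Re w <= 0 -> cabs (cexp z - cexp w) <= cabs (z - w).
Proof.
(* The exponential of larger modulus is factored out, so that [z - w] stays in the half-plane of
   [cexp_sub1_le]. *)
wlog h : z w / Re z <= Re w => [H z0 w0|z0 w0].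
  by have [h|/ltW h] := leP (Re z) (Re w); [|rewrite distrC (distrC z)]; exact: H.
have -> : cexp z - cexp w = cexp w * (cexp (z - w) - 1).
  by rewrite mulrBr -cexpD mulr1; congr (cexp _ - _); rewrite addrC subrK.
rewrite cnormM cnorm_cexp.
have e1 : expR (Re w) <= 1 by rewrite expR_le1.
have := @cexp_sub1_le (z - w); rewrite cReD cReN subr_le0 => /(_ h).
have := normr_ge0 (cexp (z - w) - 1 : C); have := expR_gt0 (Re w); nra.
Qed.

Lemma crho_lip z w : Re z <= 0 -> Re w <= 0 ->
  cabs (crho z - crho w) <= 4 * cabs (z - w) * (cabs z + cabs w).
Proof.
wlog h : z w / Re z <= Re w => [H z0 w0|z0 w0].
  have [h|/ltW h] := leP (Re z) (Re w); first exact: H.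
  by rewrite distrC (distrC z) (addrC (cabs z)); exact: H.
have -> : crho z - crho w = cexp w * crho (z - w) + (cexp w - 1) * (z - w).
  have e : cexp z = cexp w * cexp (z - w) by rewrite -cexpD addrC subrK.
  by rewrite /crho e; ring.
apply: le_trans (ler_normD _ _) _; rewrite !cnormM cnorm_cexp.
have e1 : expR (Re w) <= 1 by rewrite expR_le1.
have := @crho_le (z - w); rewrite cReD cReN subr_le0 => /(_ h) h1.
have h2 := cexp_sub1_le w0.
have h3 : cabs (z - w) <= cabs z + cabs w by exact: ler_normB.
have := expR_gt0 (Re w).
move: h1 h2 h3; have := normr_ge0 (crho (z - w) : C); have := normr_ge0 (cexp w - 1 : C).
have := normr_ge0 (z - w : C); have := normr_ge0 z; have := normr_ge0 w.
set A := cabs (z - w); set E := expR _; set r := cabs (crho _); set q := cabs (cexp w - 1).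
set u := cabs w; set v := cabs z => u0 v0 A0 q0 r0 hr hq hA E0.
have t1 : E * r <= 3 * A ^+ 2 by apply: le_trans hr; rewrite ler_piMl.
have t2 : q * A <= u * A by rewrite ler_wpM2r.
have t3 : A * A <= A * (v + u) by rewrite ler_wpM2l.
have t4 : 0 <= A * v by rewrite mulr_ge0.
by rewrite expr2 in t1; lra.
Qed.

End ComplexExp.

(** * Truncated zeta sums to the left of the line Re z = 0 *)

Section DirichletTerms.
Variable R : realType.
Local Notation C := (Rcomplex R).
Local Notation cabs z := (@Num.norm R (complex_Rcomplex__canonical__Num_SemiNormedZmodule R) z).
Local Notation Re := (@complex.Re R).
Local Notation Im := (@complex.Im R).
Implicit Types (z w : C) (x y l B : R) (n N M : nat).

Definition rc l : C := Complex l 0.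

Lemma rcD x y : rc (x + y) = rc x + rc y.
Proof. by apply/eqP; rewrite eq_complex/= addr0 !eqxx. Qed.

Lemma rcN x : rc (- x) = - rc x.
Proof. by apply/eqP; rewrite eq_complex/= oppr0 !eqxx. Qed.

Lemma rcB x y : rc (x - y) = rc x - rc y.
Proof. by rewrite rcD rcN. Qed.

Lemma rcM x y : rc (x * y) = rc x * rc y.
Proof. by apply/eqP; rewrite eq_complex cReM cImM/= !(mul0r, mulr0, addr0, subr0) !eqxx. Qed.

Lemma rc0 : rc 0 = 0. Proof. by []. Qed.
Lemma rc1 : rc 1 = 1. Proof. by []. Qed.

Lemma cabs_rc x : cabs (rc x) = `|x|.
Proof. by rewrite cnormE/= expr0n addr0 sqrtr_sqr. Qed.

Lemma Re_rcM l z : Re (rc l * z) = l * Re z.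
Proof. by rewrite cReM/= mul0r subr0. Qed.

Lemma Im_rcM l z : Im (rc l * z) = l * Im z.
Proof. by rewrite cImM/= mul0r addr0. Qed.

Lemma cabs_rcM l z : cabs (rc l * z) = `|l| * cabs z.
Proof. by rewrite cnormM cabs_rc. Qed.

Lemma Re_sum (I : Type) (s : seq I) (f : I -> C) : Re (\sum_(i <- s) f i) = \sum_(i <- s) Re (f i).
Proof. by elim/big_rec2: _ => // n ? ? _ <-; rewrite cReD. Qed.

Lemma Im_sum (I : Type) (s : seq I) (f : I -> C) : Im (\sum_(i <- s) f i) = \sum_(i <- s) Im (f i).
Proof. by elim/big_rec2: _ => // n ? ? _ <-; rewrite cImD. Qed.

Definition npow n z : C := cexp (rc (ln n%:R) * z).

Definition Zsum N z : C := \sum_(1 <= n < N) rc n%:R^-1 * npow n z.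
Definition Zlog N z : C := \sum_(1 <= n < N) rc (ln n%:R / n%:R) * npow n z.

(* Here npow n z = n^z, and for Re z < 0 the sum Zsum N z is zeta(1 - z) + N^z / z
   up to o(1).  Hence Dsum N z tends to - z * zeta(1 - z), without pole at 0, and
   Dder N z is its derivative in z. *)
Definition Dsum N z : C := npow N z - z * Zsum N z.
Definition Dder N z : C := rc (ln N%:R) * npow N z - Zsum N z - z * Zlog N z.

Definition ell n : R := ln (1 + n%:R^-1).

Lemma ln_ge0_nat n : 0 <= ln n%:R :> R.
Proof. by case: n => [|n]; [rewrite ln0|rewrite ln_ge0// ler1n]. Qed.

Lemma ell_bounds n : (0 < n)%N ->
  [/\ 0 <= ell n, ell n <= n%:R^-1 & `|ell n - n%:R^-1| <= n%:R^-1 ^+ 2].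
Proof.
move=> n0; have m0 : 0 < n%:R^-1 :> R by rewrite invr_gt0 ltr0n.
rewrite /ell; set m := n%:R^-1 in m0 *.
have h1 : ln (1 + m) <= m by apply: le_ln1Dx; lra.
have h2 : 0 <= ln (1 + m) by rewrite ln_ge0//; lra.
split=> //; rewrite ler0_norm ?subr_le0// opprB.
have h3 : - ln (1 + m) <= - m / (1 + m).
  rewrite -lnV ?posrE; last by lra.
  have e : (1 + m)^-1 = 1 + (- m / (1 + m)) by field; lra.
  rewrite [X in ln X]e; apply: le_ln1Dx; rewrite mulNr ltrN2 ltr_pdivrMr; lra.
have : - m / (1 + m) <= - m + m ^+ 2.
  rewrite ler_pdivrMr; last by lra.
  have : 0 <= m ^+ 3 by rewrite exprn_ge0// ltW.
  by rewrite exprS expr2; nra.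
by lra.
Qed.

Lemma lnS_ell n : (0 < n)%N -> ln n.+1%:R = ln n%:R + ell n.
Proof.
move=> n0; have n0R : 0 < n%:R :> R by rewrite ltr0n.
rewrite /ell -lnM ?posrE ?addr_gt0 ?invr_gt0//.
by rewrite mulrDr mulr1 divff ?gt_eqF// natr1.
Qed.

Lemma npowS n z : (0 < n)%N -> npow n.+1 z = npow n z * cexp (rc (ell n) * z).
Proof. by move=> n0; rewrite /npow lnS_ell// rcD mulrDl cexpD. Qed.

Lemma cabs_npow n z : cabs (npow n z) = expR (ln n%:R * Re z).
Proof. by rewrite cnorm_cexp Re_rcM. Qed.

Lemma cabs_npow_le1 n z : Re z <= 0 -> cabs (npow n z) <= 1.
Proof.
by move=> z0; rewrite cabs_npow expR_le1 mulr_ge0_le0// ln_ge0_nat.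
Qed.

Lemma npow_lip n z w : Re z <= 0 -> Re w <= 0 ->
  cabs (npow n z - npow n w) <= ln n%:R * cabs (z - w).
Proof.
move=> z0 w0; apply: le_trans (cexp_lip _ _) _; rewrite ?Re_rcM.
- by rewrite mulr_ge0_le0// ln_ge0_nat.
- by rewrite mulr_ge0_le0// ln_ge0_nat.
- by rewrite -mulrBr cabs_rcM ger0_norm// ln_ge0_nat.
Qed.

(** The increment of [Dsum] divided by n^z, that is e^(ell z) - 1 - z/n, written as two pieces that
    are each O(n^-2). *)
Definition dcore n z : C := crho (rc (ell n) * z) + rc (ell n - n%:R^-1) * z.
Definition dcore' n z : C :=
  rc (ell n) * (cexp (rc (ell n) * z) - 1) + rc (ell n - n%:R^-1).
(* dterm n z = Dsum n.+1 z - Dsum n z, and dterm' is its derivative in z. *)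
Definition dterm n z : C := npow n z * dcore n z.
Definition dterm' n z : C := rc (ln n%:R) * dterm n z + npow n z * dcore' n z.

Lemma Dsum_sum N z : (0 < N)%N -> Dsum N z = 1 + \sum_(1 <= n < N) dterm n z.
Proof.
elim: N => // -[_ _|N IH _].
  rewrite /Dsum /Zsum !big_geq// mulr0 subr0 addr0 /npow ln1 rc0 mul0r.
  exact: cexp0.
rewrite big_nat_recr//= addrA -(IH isT) /Dsum /Zsum [in LHS]big_nat_recr//=.
rewrite npowS// /dterm /dcore /crho rcB; ring.
Qed.

Lemma Dder_sum N z : (0 < N)%N -> Dder N z = \sum_(1 <= n < N) dterm' n z.
Proof.
elim: N => // -[_ _|N IH _].
  by rewrite /Dder /Zsum /Zlog !big_geq// ln1 rc0 mul0r mulr0 !subr0.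
rewrite big_nat_recr//= -(IH isT) /Dder /Zsum /Zlog [in LHS]big_nat_recr//=.
rewrite [in X in _ - z * X]big_nat_recr//= lnS_ell// rcD rcM.
rewrite npowS// /dterm' /dterm /dcore /dcore' /crho rcB; ring.
Qed.

(** A common majorant for the increments, their derivatives and the Lipschitz constants of both. Up
    to two logarithms occur: one from differentiating n^z, one from its Lipschitz constant. *)
Definition omega n : R := ((1 + ln n%:R) / n%:R) ^+ 2.

Section Bounds.
Variables (B : R) (n : nat).
Hypotheses (B1 : 1 <= B) (n0 : (0 < n)%N).

Let B0 : 0 <= B. Proof. exact: le_trans ler01 B1. Qed.
Let BB : B <= B ^+ 2. Proof. by rewrite expr2 ler_peMl. Qed.
Let m : R := n%:R^-1.
Let m0 : 0 <= m. Proof. by rewrite invr_ge0. Qed.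
Let l0 : 0 <= ell n. Proof. by have [] := ell_bounds n0. Qed.
Let lm : ell n <= m. Proof. by have [] := ell_bounds n0. Qed.
Let lm2 : `|ell n - m| <= m ^+ 2. Proof. by have [] := ell_bounds n0. Qed.
Let u : R := ln n%:R.
Let u0 : 0 <= u. Proof. exact: ln_ge0_nat. Qed.

Let ReL z : Re z <= 0 -> Re (rc (ell n) * z) <= 0.
Proof. by move=> z0; rewrite Re_rcM mulr_ge0_le0. Qed.

Let omegaE : omega n = (1 + u) ^+ 2 * m ^+ 2.
Proof. by rewrite /omega exprMn. Qed.

Let dcore_le z : Re z <= 0 -> cabs z <= B -> cabs (dcore n z) <= 4 * B ^+ 2 * m ^+ 2.
Proof.
move=> z0 zB; apply: le_trans (ler_normD _ _) _.
have h1 := crho_le (ReL z0); rewrite cabs_rcM (ger0_norm l0) in h1.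
rewrite cabs_rcM.
have h2 : ell n * cabs z <= m * B by apply: ler_pM.
have h3 : (ell n * cabs z) ^+ 2 <= (m * B) ^+ 2 by rewrite lerXn2r ?nnegrE ?mulr_ge0.
have h4 : `|ell n - n%:R^-1| * cabs z <= m ^+ 2 * B by apply: ler_pM.
have h5 : m ^+ 2 * B <= m ^+ 2 * B ^+ 2.
  by rewrite ler_wpM2l ?sqr_ge0.
by rewrite exprMn in h3; lra.
Qed.

Let dcore'_le z : Re z <= 0 -> cabs z <= B -> cabs (dcore' n z) <= 2 * B * m ^+ 2.
Proof.
move=> z0 zB; apply: le_trans (ler_normD _ _) _.
rewrite cabs_rcM (ger0_norm l0) cabs_rc.
have h1 := cexp_sub1_le (ReL z0); rewrite cabs_rcM (ger0_norm l0) in h1.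
have h2 : ell n * cabs z <= m * B by apply: ler_pM.
have h3 : ell n * cabs (cexp (rc (ell n) * z) - 1) <= m * (m * B).
  by apply: ler_pM => //; exact: le_trans h1 h2.
have h4 : m ^+ 2 <= m ^+ 2 * B by rewrite ler_peMr ?sqr_ge0.
by move: lm2 h3; rewrite mulrA -expr2 -/m; lra.
Qed.

Let dcore_lip z w : Re z <= 0 -> Re w <= 0 -> cabs z <= B -> cabs w <= B ->
  cabs (dcore n z - dcore n w) <= 9 * B * m ^+ 2 * cabs (z - w).
Proof.
move=> z0 w0 zB wB; rewrite /dcore opprD addrACA -mulrBr.
apply: le_trans (ler_normD _ _) _.
have h1 := crho_lip (ReL z0) (ReL w0).
rewrite -mulrBr !cabs_rcM (ger0_norm l0) in h1; rewrite cabs_rcM.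
have A0 := normr_ge0 (z - w : C); set A := cabs (z - w) in A0 h1 *.
have h2 : ell n * A * (ell n * cabs z + ell n * cabs w) <= m * A * (m * B + m * B).
  apply: ler_pM; rewrite ?mulr_ge0 ?addr_ge0 ?mulr_ge0//.
    by rewrite ler_wpM2r.
  by apply: lerD; apply: ler_pM.
have h3 : `|ell n - n%:R^-1| * A <= m ^+ 2 * A by rewrite ler_wpM2r.
have h4 : m ^+ 2 * A <= B * m ^+ 2 * A.
  by rewrite -mulrA ler_peMl// mulr_ge0 ?sqr_ge0.
have -> : 9 * B * m ^+ 2 * A = 4 * (m * A * (m * B + m * B)) + B * m ^+ 2 * A by ring.
lra.
Qed.

Let dcore'_lip z w : Re z <= 0 -> Re w <= 0 ->
  cabs (dcore' n z - dcore' n w) <= m ^+ 2 * cabs (z - w).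
Proof.
move=> z0 w0.
have -> : dcore' n z - dcore' n w =
    rc (ell n) * (cexp (rc (ell n) * z) - cexp (rc (ell n) * w)) by rewrite /dcore'; ring.
have h1 := cexp_lip (ReL z0) (ReL w0).
rewrite -mulrBr !cabs_rcM (ger0_norm l0) in h1; rewrite cabs_rcM (ger0_norm l0).
apply: le_trans (ler_wpM2l l0 h1) _; rewrite mulrA -expr2.
by rewrite ler_wpM2r// lerXn2r.
Qed.

Lemma dterm_le z : Re z <= 0 -> cabs z <= B -> cabs (dterm n z) <= 12 * B ^+ 2 * omega n.
Proof.
move=> z0 zB; rewrite /dterm cnormM omegaE.
have h1 := cabs_npow_le1 n z0; have h2 := dcore_le z0 zB.
apply: (@le_trans _ _ (1 * (4 * B ^+ 2 * m ^+ 2))); first exact: ler_pM.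
have : m ^+ 2 * B ^+ 2 <= (1 + u) ^+ 2 * (m ^+ 2 * B ^+ 2).
  by rewrite ler_peMl ?mulr_ge0 ?sqr_ge0// exprn_ege1// lerDl.
have : 0 <= m ^+ 2 * B ^+ 2 by rewrite mulr_ge0 ?sqr_ge0.
by move=> X1 X2; nra.
Qed.

(** Sharper than [dterm_lip]: only one factor [1 + u] is spent, because [dterm'_lip] multiplies this
    bound by a further logarithm. *)
Let dterm_lip' z w : Re z <= 0 -> Re w <= 0 -> cabs z <= B -> cabs w <= B ->
  cabs (dterm n z - dterm n w) <= 9 * B ^+ 2 * (1 + u) * m ^+ 2 * cabs (z - w).
Proof.
move=> z0 w0 zB wB.
have -> : dterm n z - dterm n w =
   npow n z * (dcore n z - dcore n w) + (npow n z - npow n w) * dcore n w.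
  by rewrite /dterm; ring.
apply: le_trans (ler_normD _ _) _; rewrite !cnormM.
have h1 : cabs (npow n z) * cabs (dcore n z - dcore n w) <= 1 * (9 * B * m ^+ 2 * cabs (z - w)).
  by apply: ler_pM => //; [exact: cabs_npow_le1|exact: dcore_lip].
have h2 : cabs (npow n z - npow n w) * cabs (dcore n w) <= (u * cabs (z - w)) * (4 * B ^+ 2 * m ^+ 2).
  by apply: ler_pM => //; [exact: npow_lip|exact: dcore_le].
apply: le_trans (lerD h1 h2) _.
have A0 : 0 <= m ^+ 2 * cabs (z - w) by rewrite mulr_ge0 ?sqr_ge0.
set A := m ^+ 2 * cabs (z - w) in A0.
have -> : 9 * B ^+ 2 * (1 + u) * m ^+ 2 * cabs (z - w) = 9 * B ^+ 2 * (1 + u) * A by rewrite /A; ring.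
have -> : 1 * (9 * B * m ^+ 2 * cabs (z - w)) + (u * cabs (z - w)) * (4 * B ^+ 2 * m ^+ 2)
  = (9 * B + 4 * B ^+ 2 * u) * A by rewrite /A; ring.
rewrite ler_wpM2r//.
have := BB.
have : 0 <= B ^+ 2 * u by rewrite mulr_ge0 ?sqr_ge0.
by rewrite mulrDr; lra.
Qed.

Lemma dterm_lip z w : Re z <= 0 -> Re w <= 0 -> cabs z <= B -> cabs w <= B ->
  cabs (dterm n z - dterm n w) <= 12 * B ^+ 2 * omega n * cabs (z - w).
Proof.
move=> z0 w0 zB wB; apply: le_trans (dterm_lip' z0 w0 zB wB) _.
rewrite ler_wpM2r// omegaE.
have A0 : 0 <= B ^+ 2 * m ^+ 2 by rewrite mulr_ge0 ?sqr_ge0.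
set A := B ^+ 2 * m ^+ 2 in A0.
have -> : 9 * B ^+ 2 * (1 + u) * m ^+ 2 = 9 * (1 + u) * A by rewrite /A; ring.
have -> : 12 * B ^+ 2 * ((1 + u) ^+ 2 * m ^+ 2) = 12 * (1 + u) ^+ 2 * A by rewrite /A; ring.
rewrite ler_wpM2r//; have := u0; nra.
Qed.

Lemma dterm'_le z : Re z <= 0 -> cabs z <= B -> cabs (dterm' n z) <= 12 * B ^+ 2 * omega n.
Proof.
move=> z0 zB; rewrite /dterm'; apply: le_trans (ler_normD _ _) _.
rewrite /dterm !cnormM cabs_rc (ger0_norm u0) omegaE.
have h1 := cabs_npow_le1 n z0; have h2 := dcore_le z0 zB.
have h3 : u * (cabs (npow n z) * cabs (dcore n z)) <= u * (1 * (4 * B ^+ 2 * m ^+ 2)).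
  by rewrite ler_wpM2l//; exact: ler_pM.
have h4 : cabs (npow n z) * cabs (dcore' n z) <= 1 * (2 * B * m ^+ 2).
  by apply: ler_pM => //; exact: dcore'_le.
apply: le_trans (lerD h3 h4) _.
have h5 : B * m ^+ 2 <= B ^+ 2 * m ^+ 2 by rewrite ler_wpM2r ?sqr_ge0.
have A0 : 0 <= B ^+ 2 * m ^+ 2 by rewrite mulr_ge0 ?sqr_ge0.
set A := B ^+ 2 * m ^+ 2 in A0 h5.
have -> : u * (1 * (4 * B ^+ 2 * m ^+ 2)) + 1 * (2 * B * m ^+ 2) = 4 * u * A + 2 * (B * m ^+ 2) by rewrite /A; ring.
have -> : 12 * B ^+ 2 * ((1 + u) ^+ 2 * m ^+ 2) = 12 * (1 + u) ^+ 2 * A by rewrite /A; ring.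
have : (4 * u + 2) * A <= 12 * (1 + u) ^+ 2 * A by rewrite ler_wpM2r//; have := u0; nra.
by lra.
Qed.

Lemma dterm'_lip z w : Re z <= 0 -> Re w <= 0 -> cabs z <= B -> cabs w <= B ->
  cabs (dterm' n z - dterm' n w) <= 12 * B ^+ 2 * omega n * cabs (z - w).
Proof.
move=> z0 w0 zB wB.
have -> : dterm' n z - dterm' n w = rc (ln n%:R) * (dterm n z - dterm n w) +
   (npow n z * (dcore' n z - dcore' n w) + (npow n z - npow n w) * dcore' n w).
  by rewrite /dterm'; ring.
apply: le_trans (ler_normD _ _) _; apply: le_trans (lerD (lexx _) (ler_normD _ _)) _.
rewrite cabs_rcM (ger0_norm u0) !cnormM omegaE.
have h1 := ler_wpM2l u0 (dterm_lip' z0 w0 zB wB).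
have h2 : cabs (npow n z) * cabs (dcore' n z - dcore' n w) <= 1 * (m ^+ 2 * cabs (z - w)).
  by apply: ler_pM => //; [exact: cabs_npow_le1|exact: dcore'_lip].
have h3 : cabs (npow n z - npow n w) * cabs (dcore' n w) <= (u * cabs (z - w)) * (2 * B * m ^+ 2).
  by apply: ler_pM => //; [exact: npow_lip|exact: dcore'_le].
apply: le_trans (lerD h1 (lerD h2 h3)) _.
have A0 : 0 <= m ^+ 2 * cabs (z - w) by rewrite mulr_ge0 ?sqr_ge0.
set A := m ^+ 2 * cabs (z - w) in A0.
rewrite [leLHS](_ : _ = (u * (9 * B ^+ 2 * (1 + u)) + 1 + u * 2 * B) * A); last by rewrite /A; ring.
have -> : 12 * B ^+ 2 * ((1 + u) ^+ 2 * m ^+ 2) * cabs (z - w) = 12 * B ^+ 2 * (1 + u) ^+ 2 * A by rewrite /A; ring.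
rewrite ler_wpM2r//.
have b2 := BB.
have b3 : u * B <= u * B ^+ 2 by rewrite ler_wpM2l.
have b4 : 0 <= u ^+ 2 * B ^+ 2 by rewrite mulr_ge0 ?sqr_ge0.
have b5 : 0 <= u * B ^+ 2 by rewrite mulr_ge0 ?sqr_ge0.
have := B1; lra.
Qed.

End Bounds.

(** A telescoping majorant in place of a convergent series. With q the fourth root of n, ln n = 4 ln
    q <= 4 (q - 1), so (1 + ln n)^2 <= 16 sqrt n, and n^(-3/2) is comparable with a difference of
    consecutive inverse square roots. *)
Lemma omega_le n : (0 < n)%N ->
  omega n <= 64 * ((Num.sqrt n%:R)^-1 - (Num.sqrt n.+1%:R)^-1).
Proof.
move=> n0; have n0R : 1 <= n%:R :> R by rewrite ler1n.
set r := Num.sqrt (n%:R : R); set r' := Num.sqrt (n.+1%:R : R).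
have r1 : 1 <= r by rewrite -(sqrtr1 R) ler_wsqrtr.
have r2 : r ^+ 2 = n%:R by rewrite sqr_sqrtr// ler0n.
have r'2 : r' ^+ 2 = n%:R + 1 by rewrite sqr_sqrtr ?ler0n// natr1.
have rr' : r <= r' by rewrite ler_wsqrtr// ler_nat.
have rr'' : r' <= 3 / 2 * r.
  by rewrite -ler_sqr ?nnegrE; [rewrite exprMn r2 r'2; lra|lra|lra].
set q := Num.sqrt r.
have q1 : 1 <= q by rewrite -(sqrtr1 R) ler_wsqrtr.
have q2 : q ^+ 2 = r by rewrite sqr_sqrtr//; lra.
have lnq : ln n%:R <= 4 * (q - 1).
  rewrite -r2 -q2 -exprM lnXn; last by lra.
  rewrite -[leLHS]mulr_natl ler_wpM2l//.
  by have := @le_ln1Dx R (q - 1); rewrite (_ : 1 + (q - 1) = q); [apply; lra|ring].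
have l0 : 0 <= ln n%:R :> R by exact: ln_ge0_nat.
have h1 : (1 + ln n%:R) ^+ 2 <= 16 * r.
  by rewrite -q2; nra.
have r'0 : r' != 0 by rewrite gt_eqF//; lra.
have r0 : r != 0 by rewrite gt_eqF//; lra.
have e : r^-1 - r'^-1 = (r * r' * (r + r'))^-1.
  apply/eqP; rewrite -subr_eq0; apply/eqP.
  have h : (r' - r) * (r' + r) = 1 by rewrite -subr_sqr r'2 r2; ring.
  have s0 : r + r' != 0 by rewrite gt_eqF//; lra.
  have -> : r^-1 - r'^-1 - (r * r' * (r + r'))^-1 =
    ((r' - r) * (r' + r) - 1) / (r * r' * (r + r')) by field; rewrite r'0 r0 s0.
  by rewrite h subrr mul0r.
have en : (n%:R : R) ^+ 2 = r ^+ (2 * 2) by rewrite exprM r2.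
rewrite e /omega expr_div_n en ler_pdivrMr ?exprn_gt0//; last by lra.
apply: le_trans h1 _.
have -> : 64 / (r * r' * (r + r')) * r ^+ (2 * 2) = 64 * r ^+ 3 / (r' * (r + r')).
  by field; rewrite r'0 r0 /= gt_eqF//; lra.
rewrite ler_pdivlMr; last by rewrite mulr_gt0//; lra.
have : r' * (r + r') <= (3 / 2 * r) * (r + 3 / 2 * r) by apply: ler_pM; lra.
have rp : 0 <= r by lra.
move=> /(ler_wpM2l rp); rewrite !exprS expr0; nra.
Qed.

End DirichletTerms.

(** * The von Mangoldt function through least common multiples *)

Section VonMangoldtNat.
Implicit Types (n m k p : nat).

Lemma lcm_upto0 : lcm_upto 0 = 1%N. Proof. by rewrite /lcm_upto big_geq. Qed.

Lemma lcm_uptoS n : lcm_upto n.+1 = lcmn (lcm_upto n) n.+1.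
Proof. by rewrite /lcm_upto big_nat_recr. Qed.

Lemma lcm_upto_gt0 n : (0 < lcm_upto n)%N.
Proof.
by elim: n => [|n IH]; [rewrite lcm_upto0|rewrite lcm_uptoS lcmn_gt0 IH].
Qed.

Lemma logn_lcm_upto_le p k n : (forall i, (0 < i <= n)%N -> (logn p i <= k)%N) ->
  (logn p (lcm_upto n) <= k)%N.
Proof.
elim: n => [|n IH] h; first by rewrite lcm_upto0 logn1.
rewrite lcm_uptoS logn_lcm ?lcm_upto_gt0// geq_max IH ?h ?ltnS ?leqnn// => i /andP[i0 ii].
by apply: h; rewrite i0 ltnW.
Qed.

Lemma logn_lcm_upto_pfactor p k : prime p -> logn p (lcm_upto (p ^ k.+1).-1) = k.
Proof.
move=> pp; have p1 := prime_gt1 pp.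
have pk0 j : (0 < p ^ j)%N by rewrite expn_gt0 prime_gt0.
apply/eqP; rewrite eqn_leq; apply/andP; split.
  apply: logn_lcm_upto_le => i /andP[i0 ii]; rewrite leqNgt; apply/negP => h.
  have := dvdn_leq i0 (pfactor_dvdnn p i).
  rewrite leqNgt => /negP; apply; apply: (@leq_ltn_trans (p ^ k.+1).-1) => //.
  by rewrite prednK// leq_exp2l.
rewrite -pfactor_dvdn ?lcm_upto_gt0//; apply: dvdn_lcm_upto.
by rewrite pk0/= -ltnS prednK// ltn_exp2l.
Qed.

(** Just below p^(k+1) the p-adic valuation of the least common multiple is exactly k, so the new
    term contributes a single factor p. *)
Lemma lcm_upto_pfactor p k : prime p ->
  lcm_upto (p ^ k.+1) = (lcm_upto (p ^ k.+1).-1 * p)%N.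
Proof.
move=> pp; have pk0 : (0 < p ^ k.+1)%N by rewrite expn_gt0 prime_gt0.
have [a pa aE] := pfactor_coprime pp (lcm_upto_gt0 (p ^ k.+1).-1).
rewrite logn_lcm_upto_pfactor// in aE.
rewrite -[in LHS](prednK pk0) lcm_uptoS prednK// aE expnSr [(a * _)%N]mulnC -muln_lcmr.
have := muln_lcm_gcd a p; rewrite gcdnC (eqP pa) muln1 => ->.
by rewrite mulnA.
Qed.

(** For n > 1 the full power of the least prime factor and its cofactor are coprime and both smaller
    than n, so n divides the previous value already. *)
Lemma lcm_upto_not_pfactor n : (0 < n)%N ->
  (forall p k, prime p -> n <> (p ^ k.+1)%N) -> lcm_upto n = lcm_upto n.-1.
Proof.
case: n => // -[_ _|n _ h]; first by rewrite lcm_uptoS lcm_upto0.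
rewrite lcm_uptoS; apply/lcmn_idPl.
have pp : prime (pdiv n.+2) by rewrite pdiv_prime.
have [m pm nE] := pfactor_coprime pp (ltn0Sn n.+1).
set p := pdiv _ in pp pm nE *; set k := logn p n.+2 in nE.
have k0 : (0 < k)%N by rewrite logn_gt0 mem_primes pp/= pdiv_dvd.
have p1 : (1 < p ^ k)%N by rewrite -(exp1n k) ltn_exp2r ?prime_gt1.
have m1 : (1 < m)%N.
  case: m nE {pm} => [//|[|//]]; rewrite mul1n -(prednK k0) => nE.
  by case: (h p k.-1).
rewrite nE Gauss_dvd ?coprimeXr 1?coprime_sym//.
by apply/andP; split; apply: dvdn_lcm_upto; nia.
Qed.

End VonMangoldtNat.

Section VonMangoldt.
Variable R : realType.
Local Notation C := (Rcomplex R).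
Local Notation cabs z := (@Num.norm R (complex_Rcomplex__canonical__Num_SemiNormedZmodule R) z).
Local Notation Re := (@complex.Re R).
Local Notation Im := (@complex.Im R).
Implicit Types (z w : C) (x y l B : R) (n N M m d p k : nat).

(** Taken as the increment of log d_n, so that Chebyshev's psi is log d_n by telescoping; the usual
    values log p at prime powers and 0 elsewhere become lemmas. *)
Definition vonMangoldt n : R := ln (lcm_upto n)%:R - ln (lcm_upto n.-1)%:R.

Lemma sum_vonMangoldt N : \sum_(1 <= n < N.+1) vonMangoldt n = ln (lcm_upto N)%:R.
Proof.
elim: N => [|N IH]; first by rewrite big_geq// lcm_upto0 ln1.
by rewrite big_nat_recr//= IH /vonMangoldt addrC subrK.
Qed.

Lemma vonMangoldt_pfactor p k : prime p -> vonMangoldt (p ^ k.+1) = ln p%:R.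
Proof.
move=> pp; rewrite /vonMangoldt lcm_upto_pfactor// natrM lnM ?posrE ?ltr0n ?lcm_upto_gt0 ?prime_gt0//.
by rewrite addrAC subrr add0r.
Qed.

Lemma vonMangoldt_not_pfactor n : (0 < n)%N ->
  (forall p k, prime p -> n <> (p ^ k.+1)%N) -> vonMangoldt n = 0.
Proof. by move=> n0 h; rewrite /vonMangoldt lcm_upto_not_pfactor// subrr. Qed.

Lemma vonMangoldt_neq0 n : (0 < n)%N -> vonMangoldt n != 0 ->
  exists p k, prime p /\ n = (p ^ k.+1)%N.
Proof.
move=> n0; apply: contra_neqP => h; apply: vonMangoldt_not_pfactor => // p k pp nE.
by apply: h; exists p, k.
Qed.

Lemma vonMangoldt_bounds n : (0 < n)%N -> 0 <= vonMangoldt n <= ln n%:R.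
Proof.
move=> n0; have [->|/(vonMangoldt_neq0 n0)[p [k [pp ->]]]] := eqVneq (vonMangoldt n) 0.
  by rewrite lexx ln_ge0_nat.
rewrite vonMangoldt_pfactor// ln_ge0_nat ler_ln ?posrE ?ltr0n ?expn_gt0 ?prime_gt0//.
by rewrite ler_nat -{1}(expn1 p) leq_exp2l// prime_gt1.
Qed.

(** Strong induction on n = m p with p the least prime factor. Among the divisors of n that do not
    divide m, the only prime power is p^(k+1), where k is the valuation of m at p, and it
    contributes log p. *)
Lemma sum_vonMangoldt_dvd n N : (0 < n)%N -> (n < N)%N ->
  \sum_(1 <= d < N | (d %| n)%N) vonMangoldt d = ln n%:R.
Proof.
elim/ltn_ind: n => -[//|[_ _ N1|n IH _ nN]].
  rewrite ln1 big_nat_cond big1// => d /andP[_]; rewrite dvdn1 => /eqP->.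
  rewrite vonMangoldt_not_pfactor// => p k pp e.
  have : (p ^ 0 < p ^ k.+1)%N by rewrite ltn_exp2l ?prime_gt1.
  by rewrite -e.
set n2 := n.+2 in IH nN *.
have pp : prime (pdiv n2) by rewrite pdiv_prime.
set p := pdiv _ in pp *; have pn : (p %| n2)%N := pdiv_dvd n2.
have [m nE] := dvdnP pn.
have p1 := prime_gt1 pp; have p0 := prime_gt0 pp.
have m0 : (0 < m)%N by move: nE; case: m => //; rewrite mul0n.
have mn : (m < n2)%N by rewrite nE ltn_Pmulr.
have n2E : ln n2%:R = ln m%:R + ln p%:R :> R.
  by rewrite nE natrM lnM ?posrE ?ltr0n// prime_gt0.
rewrite n2E -(IH m mn m0 (ltn_trans mn nN)).
rewrite (bigID (fun d => (d %| m)%N))/=; congr (_ + _).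
  by apply: eq_bigl => d; apply/andb_idl => /dvdn_trans; apply; rewrite nE dvdn_mulr.
set k := logn p m; have kE : logn p n2 = k.+1.
  by rewrite nE lognM// (logn_prime p pp) eqxx addn1.
have pkn : (p ^ k.+1 %| n2)%N by rewrite -kE pfactor_dvdnn.
rewrite -(vonMangoldt_pfactor k pp) -big_filter.
rewrite (bigD1_seq (p ^ k.+1)%N) ?filter_uniq ?iota_uniq//=; last first.
  rewrite mem_filter pkn/= pfactor_dvdn// ltnn/= mem_index_iota expn_gt0 p0/=.
  by rewrite (leq_ltn_trans _ nN)// dvdn_leq.
rewrite big1_seq ?addr0// => d /andP[dk].
rewrite mem_filter mem_index_iota => /andP[/andP[dn dm] /andP[d0 dN]].
apply: contraTeq dk => /(vonMangoldt_neq0 d0)[q [j [qq dE]]].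
rewrite negbK; move: dn dm; rewrite dE !pfactor_dvdn// nE lognM//.
rewrite (logn_prime q pp); case: eqP => [e|]; last by rewrite addn0 => _ ->.
rewrite e addn1 -/k => jk kj; apply/eqP; congr (_ ^ _)%N; lia.
Qed.

Lemma sum_dvd_multiples (V : nmodType) (g : nat -> V) d N : (0 < d)%N ->
  \sum_(1 <= n < N | (d %| n)%N) g n = \sum_(1 <= m < N | (d * m < N)%N) g (d * m)%N.
Proof.
move=> d0; transitivity (\sum_(1 <= n < N) \sum_(1 <= m < N | (m == n %/ d)%N && (d %| n)%N) g n).
  rewrite big_mkcond; apply: eq_big_nat => n /andP[n0 nN].
  case: ifP => dn; last by rewrite big1// => m; rewrite andbF.
  under eq_bigl do rewrite andbT; rewrite big_nat1_eq divn_gt0// dvdn_leq//=.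
  by rewrite (leq_ltn_trans (leq_div n d) nN).
rewrite (exchange_big_dep_nat predT)//= big_mkcond [RHS]big_mkcond.
rewrite [LHS]big_nat_cond [RHS]big_nat_cond; apply: eq_bigr => m /andP[/andP[m0 mN] _].
under eq_bigl => n.
  rewrite (_ : (_ && _) = (n == d * m)%N); last first.
    by apply/idP/idP => [/andP[/eqP-> dn]|/eqP->]; rewrite ?dvdn_mulr// ?mulKn ?eqxx// mulnC divnK.
  over.
by rewrite big_nat1_eq muln_gt0 d0 m0.
Qed.

(* Truncation of - (zeta' / zeta)(1 - z). *)
Definition Lsum N z : C := \sum_(1 <= n < N) rc (vonMangoldt n / n%:R) * npow n z.

Lemma npowM m n z : (0 < m)%N -> (0 < n)%N -> npow (m * n) z = npow m z * npow n z.
Proof.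
by move=> m0 n0; rewrite /npow natrM lnM ?posrE ?ltr0n// rcD mulrDl cexpD.
Qed.

Lemma rc_sum (I : Type) (s : seq I) (P : pred I) (f : I -> R) :
  rc (\sum_(i <- s | P i) f i) = \sum_(i <- s | P i) rc (f i).
Proof.
elim: s => [|i s IH]; first by rewrite !big_nil.
by rewrite !big_cons; case: ifP => // _; rewrite rcD IH.
Qed.

Lemma Zlog_conv N z : Zlog N z = \sum_(1 <= d < N) \sum_(1 <= m < N | (d * m < N)%N)
  rc (vonMangoldt d / d%:R) * npow d z * (rc m%:R^-1 * npow m z).
Proof.
transitivity (\sum_(1 <= n < N) \sum_(1 <= d < N | (d %| n)%N)
    rc (vonMangoldt d / n%:R) * npow n z).
  rewrite /Zlog; apply: eq_big_nat => n /andP[n0 nN].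
  by rewrite -mulr_suml -rc_sum -mulr_suml sum_vonMangoldt_dvd.
rewrite (exchange_big_dep_nat predT)//=; apply: eq_big_nat => d /andP[d0 dN].
rewrite sum_dvd_multiples// big_mkcond [RHS]big_mkcond.
apply: eq_big_nat => m /andP[m0 mN]; case: ifP => // _.
by rewrite npowM// natrM invfM !rcM; ring.
Qed.

Definition conv_err N x : R := expR (ln N%:R * x) * (1 + ln N%:R) ^+ 3.

Lemma harmonic_sum_le N : (0 < N)%N -> \sum_(1 <= n < N) n%:R^-1 <= 1 + ln N%:R :> R.
Proof.
move=> N0; apply: (@le_trans _ _ (\sum_(1 <= n < N.+1) n%:R^-1)).
  by rewrite big_nat_recr//= lerDl.
elim: N N0 => // -[_ _|N IH _].
  by rewrite big_nat1 ln1 addr0 invr1.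
rewrite big_nat_recr//= [in leRHS]lnS_ell// addrA lerD ?IH//.
have h : 0 < 1 - N.+2%:R^-1 :> R by rewrite subr_gt0 invf_lt1 ?ltr1n// ltr0n.
have e : 1 + N.+1%:R^-1 = (1 - N.+2%:R^-1)^-1 :> R.
  have aux (t : R) : t != 0 -> t + 1 != 0 -> 1 + t^-1 = (1 - (t + 1)^-1)^-1.
    move=> t0 t1; have -> : 1 - (t + 1)^-1 = t / (t + 1) by field.
    by rewrite invf_div; field.
  by rewrite aux ?natr1 ?pnatr_eq0.
rewrite /ell e lnV ?posrE// lerNr; apply: le_ln1Dx.
by rewrite ltrN2 invf_lt1 ?ltr1n// ltr0n.
Qed.

(** Only the pairs with d m >= N survive in the difference. There |(d m)^z| <= N^(Re z), so the
    crude bound by two harmonic sums and one logarithm still tends to 0 for fixed Re z < 0. *)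
Lemma conv_err_le N z : (0 < N)%N -> Re z <= 0 ->
  cabs (Lsum N z * Zsum N z - Zlog N z) <= conv_err N (Re z).
Proof.
move=> N0 z0.
have -> : Lsum N z * Zsum N z - Zlog N z =
  \sum_(1 <= d < N) \sum_(1 <= m < N | ~~ (d * m < N)%N)
    rc (vonMangoldt d / d%:R) * npow d z * (rc m%:R^-1 * npow m z).
  rewrite Zlog_conv /Lsum /Zsum mulr_suml -sumrB; apply: eq_bigr => d _.
  by rewrite mulr_sumr (bigID (fun m => (d * m < N)%N))/= addrAC subrr add0r.
set E := expR (ln N%:R * Re z).
have E0 : 0 <= E by exact: expR_ge0.
apply: (@le_trans _ _ (\sum_(1 <= d < N) \sum_(1 <= m < N) E * ln N%:R * (d%:R^-1 * m%:R^-1))).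
  apply: le_trans (ler_norm_sum _ _ _) _.
  apply: ler_sum_nat => d /andP[d0 dN].
  apply: le_trans (ler_norm_sum _ _ _) _.
  rewrite [leLHS]big_mkcond.
  apply: ler_sum_nat => m /andP[m0 mN].
  have lN := ln_ge0_nat R N.
  case: ifP => [|_]; last by rewrite !mulr_ge0.
  rewrite -leqNgt => Ndm.
  have /andP[v0 vd] := vonMangoldt_bounds d0.
  rewrite mulrACA -rcM -npowM// cabs_rcM cabs_npow ger0_norm; last first.
    by rewrite !mulr_ge0.
  have -> : vonMangoldt d / d%:R / m%:R * expR (ln (d * m)%:R * Re z) =
    expR (ln (d * m)%:R * Re z) * vonMangoldt d * (d%:R^-1 / m%:R) by ring.
  rewrite ler_wpM2r ?mulr_ge0//; apply: ler_pM => //.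
    rewrite /E ler_expR ler_wnM2r// ler_ln ?posrE ?ltr0n ?muln_gt0 ?d0//.
    by rewrite ler_nat.
  apply: le_trans vd _; rewrite ler_ln ?posrE ?ltr0n// ler_nat; exact: ltnW.
rewrite /conv_err.
under eq_bigr do rewrite -mulr_sumr -mulr_sumr.
rewrite -mulr_sumr -mulr_suml -/E -mulrA ler_wpM2l// exprS.
have H := harmonic_sum_le N0; have l0 := ln_ge0_nat R N.
have H0 : 0 <= \sum_(1 <= n < N) n%:R^-1 :> R by rewrite sumr_ge0.
apply: ler_pM => //; first by rewrite mulr_ge0.
  by rewrite lerDr.
by rewrite expr2; apply: ler_pM.
Qed.

End VonMangoldt.

(** * Non-vanishing up to the line Re z = 0 *)

Section NonVanishing.
Variable R : realType.
Local Notation C := (Rcomplex R).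
Local Notation cabs z := (@Num.norm R (complex_Rcomplex__canonical__Num_SemiNormedZmodule R) z).
Local Notation Re := (@complex.Re R).
Local Notation Im := (@complex.Im R).
Implicit Types (z w : C) (x y t B : R) (n N M : nat).

(** 768 = 12 * 64: the constant of the bounds on the increments times that of the telescoped sum of
    [omega]. *)
Definition Dconst B : R := 768 * B ^+ 2.

Lemma sum_omega_le M N : (0 < M)%N -> (M <= N)%N ->
  \sum_(M <= n < N) omega R n <= 64 * (Num.sqrt M%:R)^-1.
Proof.
move=> M0; elim: N => [|N IH]; first by rewrite leqn0 => /eqP Mz; rewrite Mz in M0.
have hS j : 0 <= (Num.sqrt (j%:R : R))^-1 by rewrite invr_ge0 sqrtr_ge0.
rewrite leq_eqVlt => /predU1P[->|MN]; first by rewrite big_geq// mulr_ge0.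
apply: (@le_trans _ _ (64 * ((Num.sqrt M%:R)^-1 - (Num.sqrt N.+1%:R)^-1))); last first.
  by rewrite ler_wpM2l// gerBl.
elim: N MN {IH} => [|N IH]; first by case: M M0.
rewrite ltnS leq_eqVlt => /predU1P[->|MN].
  by rewrite big_nat1 omega_le.
rewrite big_nat_recr//=; last exact: ltnW.
have := IH MN; have := @omega_le R N.+1 (ltn0Sn _); lra.
Qed.

Lemma sum_cnorm_le (f : nat -> C) M N a : (0 < M)%N -> (M <= N)%N -> 0 <= a ->
  (forall n, (0 < n)%N -> cabs (f n) <= 12 * a * omega R n) ->
  cabs (\sum_(M <= n < N) f n) <= 768 * a * (Num.sqrt M%:R)^-1.
Proof.
move=> M0 MN a0 h; apply: le_trans (ler_norm_sum _ _ _) _.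
have -> : 768 * a * (Num.sqrt M%:R)^-1 = 12 * a * (64 * (Num.sqrt M%:R)^-1) by ring.
apply: le_trans (ler_wpM2l _ (sum_omega_le M0 MN)); last by rewrite mulr_ge0.
rewrite mulr_sumr.
by apply: ler_sum_nat => n /andP[Mn _]; apply: h; exact: leq_trans Mn.
Qed.

Section DBounds.
Variables (B : R).
Hypothesis B1 : 1 <= B.

Let BB : 0 <= B ^+ 2. Proof. exact: sqr_ge0. Qed.

(** Uniform up to Re z = 0. It carries a lower bound, proved for N large in terms of z, back to
    every M beyond a threshold that does not depend on z. *)
Lemma Dsum_tail M N z : (0 < M)%N -> (M <= N)%N -> Re z <= 0 -> cabs z <= B ->
  cabs (Dsum N z - Dsum M z) <= Dconst B * (Num.sqrt M%:R)^-1.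
Proof.
move=> M0 MN z0 zB; rewrite !Dsum_sum ?(leq_trans M0 MN)//.
rewrite (big_cat_nat M0 MN)//= opprD addrACA subrr add0r addrAC subrr add0r.
by apply: sum_cnorm_le => // n n0; exact: dterm_le.
Qed.

Lemma Dsum_lip N z w : (0 < N)%N -> Re z <= 0 -> Re w <= 0 -> cabs z <= B -> cabs w <= B ->
  cabs (Dsum N z - Dsum N w) <= Dconst B * cabs (z - w).
Proof.
move=> N0 z0 w0 zB wB; rewrite !Dsum_sum// opprD addrACA subrr add0r -sumrB /Dconst -mulrA.
have := @sum_cnorm_le (fun n => dterm n z - dterm n w) 1 N (B ^+ 2 * cabs (z - w)).
rewrite mulr1n sqrtr1 invr1 mulr1; apply=> //; first by rewrite mulr_ge0.
by move=> n n0; apply: le_trans (dterm_lip B1 n0 z0 w0 zB wB) _; rewrite le_eqVlt; apply/orP; left; apply/eqP; ring.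
Qed.

Lemma Dder_lip N z w : (0 < N)%N -> Re z <= 0 -> Re w <= 0 -> cabs z <= B -> cabs w <= B ->
  cabs (Dder N z - Dder N w) <= Dconst B * cabs (z - w).
Proof.
move=> N0 z0 w0 zB wB; rewrite !Dder_sum// -sumrB /Dconst -mulrA.
have := @sum_cnorm_le (fun n => dterm' n z - dterm' n w) 1 N (B ^+ 2 * cabs (z - w)).
rewrite mulr1n sqrtr1 invr1 mulr1; apply=> //; first by rewrite mulr_ge0.
by move=> n n0; apply: le_trans (dterm'_lip B1 n0 z0 w0 zB wB) _; rewrite le_eqVlt; apply/orP; left; apply/eqP; ring.
Qed.

Lemma Dder_le N z : (0 < N)%N -> Re z <= 0 -> cabs z <= B -> cabs (Dder N z) <= Dconst B.
Proof.
move=> N0 z0 zB; rewrite !Dder_sum//.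
have := @sum_cnorm_le (fun n => dterm' n z) 1 N (B ^+ 2).
rewrite mulr1n sqrtr1 invr1 mulr1; apply=> //.
by move=> n n0; exact: dterm'_le.
Qed.

(** [Dsum N 0] is exactly 1, the trace of the residue 1 of zeta. Near the pole this alone keeps
    [Dsum] away from 0. *)
Lemma Dsum1_le N z : (0 < N)%N -> Re z <= 0 -> cabs z <= B ->
  cabs (Dsum N z - 1) <= Dconst B * cabs z.
Proof.
move=> N0 z0 zB; have := @Dsum_lip N z 0 N0 z0 (lexx _) zB.
rewrite subr0 normr0 => /(_ (le_trans ler01 B1)).
by rewrite {2}/Dsum mul0r subr0 /npow mulr0 cexp0.
Qed.

Lemma Dsum_le N z : (0 < N)%N -> Re z <= 0 -> cabs z <= B -> cabs (Dsum N z) <= 1 + Dconst B.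
Proof.
move=> N0 z0 zB; rewrite Dsum_sum//; apply: le_trans (ler_normD _ _) _.
rewrite cnorm1 lerD2l.
have := @sum_cnorm_le (fun n => dterm n z) 1 N (B ^+ 2).
rewrite mulr1n sqrtr1 invr1 mulr1; apply=> //.
by move=> n n0; exact: dterm_le.
Qed.

Lemma zZsum_le N z : (0 < N)%N -> Re z <= 0 -> cabs z <= B ->
  cabs z * cabs (Zsum N z) <= 2 + Dconst B.
Proof.
move=> N0 z0 zB; rewrite -cnormM.
have -> : z * Zsum N z = npow N z - Dsum N z by rewrite /Dsum; ring.
apply: le_trans (ler_normB _ _) _.
have := Dsum_le N0 z0 zB; have := cabs_npow_le1 N z0; lra.
Qed.

End DBounds.

Lemma Zsum_le N z : (0 < N)%N -> Re z <= 0 -> cabs (Zsum N z) <= 1 + ln N%:R.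
Proof.
move=> N0 z0; apply: le_trans (harmonic_sum_le R N0).
apply: le_trans (ler_norm_sum _ _ _) _; apply: ler_sum => n _.
by rewrite cabs_rcM ger0_norm ?invr_ge0// ler_piMr ?invr_ge0// cabs_npow_le1.
Qed.

Lemma is_derive_Re_Zsum N t x : is_derive x (1 : R)
  (fun x => Re (Zsum N (Complex x t))) (Re (Zlog N (Complex x t))).
Proof.
rewrite /Zlog Re_sum; under eq_fun do rewrite /Zsum Re_sum.
apply: is_derive_bigsum => n; under eq_fun do rewrite Re_rcM /npow /cexp/= !mul0r subr0 addr0.
by apply: is_derive_eq; rewrite Re_rcM /npow /cexp /GRing.scale/= !mul0r subr0 addr0; ring.
Qed.

Lemma is_derive_Im_Zsum N t x : is_derive x (1 : R)
  (fun x => Im (Zsum N (Complex x t))) (Im (Zlog N (Complex x t))).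
Proof.
rewrite /Zlog Im_sum; under eq_fun do rewrite /Zsum Im_sum.
apply: is_derive_bigsum => n; under eq_fun do rewrite Im_rcM /npow /cexp/= !mul0r subr0 addr0.
by apply: is_derive_eq; rewrite Im_rcM /npow /cexp /GRing.scale/= !mul0r subr0 addr0; ring.
Qed.

(** The squared modulus is differentiable along horizontal lines even where [Zsum] vanishes, so the
    3-4-1 argument takes no logarithm. *)
Definition Znorm2 N t x : R := cabs (Zsum N (Complex x t)) ^+ 2.
Definition Znorm2' N t x : R :=
  2 * (Re (Zsum N (Complex x t)) * Re (Zlog N (Complex x t)) +
       Im (Zsum N (Complex x t)) * Im (Zlog N (Complex x t))).

Lemma is_derive_Znorm2 N t x : is_derive x (1 : R) (Znorm2 N t) (Znorm2' N t x).
Proof.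
have -> : Znorm2 N t = (fun x => Re (Zsum N (Complex x t)) ^+ 2 + Im (Zsum N (Complex x t)) ^+ 2).
  by apply/funext => y; rewrite /Znorm2 cnorm_sqr.
have h1 := is_derive_Re_Zsum N t x; have h2 := is_derive_Im_Zsum N t x.
apply: is_derive_eq; rewrite /Znorm2' /GRing.scale/=; ring.
Qed.

(** The derivative of |Z|^2 is 2 Re (conj Z * Zlog), and [Zlog] is [Lsum * Zsum] up to [conv_err];
    the main term is therefore 2 Re (Lsum) |Z|^2. *)
Lemma Znorm2'_ge N t x : (0 < N)%N -> x <= 0 ->
  `|Znorm2' N t x - 2 * Re (Lsum N (Complex x t)) * Znorm2 N t x| <=
  4 * (1 + ln N%:R) * conv_err N x.
Proof.
move=> N0 x0; set z := Complex x t; have z0 : Re z <= 0 by [].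
have := conv_err_le N0 z0; set e := _ - Zlog N z => he.
have hZ := Zsum_le N0 z0.
have -> : Znorm2' N t x - 2 * Re (Lsum N z) * Znorm2 N t x =
   - 2 * (Re (Zsum N z) * Re e + Im (Zsum N z) * Im e).
  rewrite /Znorm2' /Znorm2 cnorm_sqr -/z /e.
  by rewrite cReD cImD cReN cImN cReM cImM; ring.
rewrite normrM normrN [`|2|]ger0_norm//.
have -> : 4 * (1 + ln N%:R) * conv_err N x = 2 * ((1 + ln N%:R) * conv_err N x + (1 + ln N%:R) * conv_err N x) :> R by ring.
rewrite ler_wpM2l//; apply: le_trans (ler_normD _ _) _; rewrite !normrM.
apply: lerD; apply: ler_pM => //.
- exact: le_trans (Re_le_cnorm _) hZ.
- exact: le_trans (Re_le_cnorm _) he.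
- exact: le_trans (Im_le_cnorm _) hZ.
- exact: le_trans (Im_le_cnorm _) he.
Qed.

Lemma three_four_one N t x :
  0 <= 3 * Re (Lsum N (Complex x 0)) + 4 * Re (Lsum N (Complex x t))
       + Re (Lsum N (Complex x (2 * t))).
Proof.
have LE y : Re (Lsum N (Complex x y)) = \sum_(1 <= n < N)
    vonMangoldt R n / n%:R * (expR (ln n%:R * x) * cos (ln n%:R * y)).
  rewrite /Lsum Re_sum; apply: eq_bigr => n _.
  by rewrite Re_rcM /npow /cexp/= !mul0r !subr0 !addr0.
rewrite !LE !mulr_sumr -!big_split/= big_nat_cond sumr_ge0// => n.
move=> /andP[/andP[n0 _] _].
have /andP[v0 _] := vonMangoldt_bounds R n0.
rewrite mulr0 cos0 mulr1.
have -> : ln n%:R * (2 * t) = (ln n%:R * t) *+ 2 by rewrite mulr_natl mulrnAr.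
rewrite cos_mulr2n; set c := cos _; set v := vonMangoldt _ _; set E := expR _.
have -> : 3 * (v / n%:R * E) + 4 * (v / n%:R * (E * c)) + v / n%:R * (E * (c ^+ 2 *+ 2 - 1))
  = v / n%:R * E * (2 * (1 + c) ^+ 2) by ring.
have E0 : 0 <= E by exact: expR_ge0.
by apply: mulr_ge0; apply: mulr_ge0; rewrite ?sqr_ge0// mulr_ge0.
Qed.

(* The logarithmic derivative in x of this product is twice the nonnegative 3-4-1
   combination, so up to a small error Zprod increases from its value at x = -2. *)
Definition Zprod N t x : R := Znorm2 N 0 x ^+ 3 * Znorm2 N t x ^+ 4 * Znorm2 N (2 * t) x.

Lemma Znorm2_bounds N t x : (0 < N)%N -> x <= 0 -> 0 <= Znorm2 N t x <= (1 + ln N%:R) ^+ 2.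
Proof.
move=> N0 x0; rewrite sqr_ge0/= lerXn2r ?nnegrE ?addr_ge0 ?ln_ge0_nat//.
exact: Zsum_le.
Qed.

(** Differentiating the eight factors of [Zprod] gives eight errors 4 (1 + l)^4 N^x, each multiplied
    by seven factors at most (1 + l)^2, where l = ln N: in all 32 (1 + l)^18 N^x. The remaining
    factor 2 is the length of the segment from -2 to 0. *)
Definition Zprod_err N x : R := 64 * (1 + ln N%:R) ^+ 18 * expR (ln N%:R * x).

Lemma Zprod_derive N t x : (0 < N)%N -> x <= 0 ->
  exists2 d, is_derive x (1 : R) (Zprod N t) d & - Zprod_err N x / 2 <= d.
Proof.
move=> N0 x0.
have d0 := is_derive_Znorm2 N 0 x; have d1 := is_derive_Znorm2 N t x.
have d2 := is_derive_Znorm2 N (2 * t) x.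
have e0 := Znorm2'_ge 0 N0 x0; have e1 := Znorm2'_ge t N0 x0.
have e2 := Znorm2'_ge (2 * t) N0 x0.
have /andP[p0 b0] := Znorm2_bounds 0 N0 x0; have /andP[p1 b1] := Znorm2_bounds t N0 x0.
have /andP[p2 b2] := Znorm2_bounds (2 * t) N0 x0.
have := three_four_one N t x.
move: e0 e1 e2 p0 b0 p1 b1 p2 b2 d0 d1 d2; rewrite /conv_err /Zprod_err /Zprod.
set l := ln N%:R; set E := expR _; set L0 := Re _; set L1 := Re _; set L2 := Re _.
move=> e0 e1 e2 p0 b0 p1 b1 p2 b2 d0 d1 d2 L341.
set U0 := Znorm2 N 0 x in e0 p0 b0; set U1 := Znorm2 N t x in e1 p1 b1.
set U2 := Znorm2 N (2 * t) x in e2 p2 b2.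
set V0 := Znorm2' N 0 x in e0 d0; set V1 := Znorm2' N t x in e1 d1.
set V2 := Znorm2' N (2 * t) x in e2 d2.
exists (3 * U0 ^+ 2 * V0 * U1 ^+ 4 * U2 + 4 * U0 ^+ 3 * U1 ^+ 3 * V1 * U2 + U0 ^+ 3 * U1 ^+ 4 * V2).
  by apply: is_derive_eq; rewrite /GRing.scale/= -/U0 -/U1 -/U2; ring.
have l0 : 0 <= l by exact: ln_ge0_nat.
have E0 : 0 <= E by exact: expR_ge0.
have h1l : 0 <= 1 + l by lra.
set r0 := V0 - _ in e0; set r1 := V1 - _ in e1; set r2 := V2 - _ in e2.
have -> : 3 * U0 ^+ 2 * V0 * U1 ^+ 4 * U2 + 4 * U0 ^+ 3 * U1 ^+ 3 * V1 * U2 + U0 ^+ 3 * U1 ^+ 4 * V2 =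
  2 * (3 * L0 + 4 * L1 + L2) * (U0 ^+ 3 * U1 ^+ 4 * U2) +
  (3 * (U0 ^+ 2 * U1 ^+ 4 * U2 * r0) + 4 * (U0 ^+ 3 * U1 ^+ 3 * U2 * r1) + U0 ^+ 3 * U1 ^+ 4 * r2).
  by rewrite /r0 /r1 /r2; ring.
have t1 : 0 <= 2 * (3 * L0 + 4 * L1 + L2) * (U0 ^+ 3 * U1 ^+ 4 * U2).
  by rewrite !mulr_ge0// ?exprn_ge0//; lra.
set W := (1 + l) ^+ 14; set rr := 4 * (1 + l) * (E * (1 + l) ^+ 3) in e0 e1 e2.
have gen (a r : R) : 0 <= a <= W -> `|r| <= rr -> - (W * rr) <= a * r.
  move=> /andP[a0 aW] rrr; have : `|a * r| <= W * rr by rewrite normrM ger0_norm//; apply: ler_pM.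
  by rewrite ler_norml => /andP[].
have W1 : W = ((1 + l) ^+ 2) ^+ 2 * ((1 + l) ^+ 2) ^+ 4 * (1 + l) ^+ 2 by rewrite /W; ring.
have W2 : W = ((1 + l) ^+ 2) ^+ 3 * ((1 + l) ^+ 2) ^+ 3 * (1 + l) ^+ 2 by rewrite /W; ring.
have W3 : W = ((1 + l) ^+ 2) ^+ 3 * ((1 + l) ^+ 2) ^+ 4 by rewrite /W; ring.
have g0 : - (W * rr) <= U0 ^+ 2 * U1 ^+ 4 * U2 * r0.
  apply: gen => //; rewrite !mulr_ge0 ?exprn_ge0//= W1.
  by apply: ler_pM; rewrite ?mulr_ge0 ?exprn_ge0//; apply: ler_pM; rewrite ?exprn_ge0// lerXn2r ?nnegrE ?exprn_ge0.
have g1 : - (W * rr) <= U0 ^+ 3 * U1 ^+ 3 * U2 * r1.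
  apply: gen => //; rewrite !mulr_ge0 ?exprn_ge0//= W2.
  by apply: ler_pM; rewrite ?mulr_ge0 ?exprn_ge0//; apply: ler_pM; rewrite ?exprn_ge0// lerXn2r ?nnegrE ?exprn_ge0.
have g2 : - (W * rr) <= U0 ^+ 3 * U1 ^+ 4 * r2.
  apply: gen => //; rewrite !mulr_ge0 ?exprn_ge0//= W3.
  by apply: ler_pM; rewrite ?exprn_ge0// lerXn2r ?nnegrE ?exprn_ge0.
have -> : - (64 * (1 + l) ^+ 18 * E) / 2 = - 8 * (W * rr) by rewrite /W /rr; field.
by lra.
Qed.

(** The point x = -2 corresponds to zeta on the line of real part 3. The term n = 1 equals 1, and
    the others sum to at most 1/2, since n^-3 <= (1/(n-1) - 1/n) / 2. *)
Lemma Znorm2_ge N t : (1 < N)%N -> 4^-1 <= Znorm2 N t (- 2).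
Proof.
move=> N1; have -> : 4^-1 = (2^-1) ^+ 2 :> R by field.
rewrite lerXn2r ?nnegrE ?invr_ge0//.
rewrite /Zsum big_ltn// /npow ln1 rc0 mul0r cexp0 mulr1 invr1 rc1.
set S := \sum_(_ <= _ < _) _.
have SE : cabs S <= 2^-1.
  apply: le_trans (ler_norm_sum _ _ _) _.
  apply: (@le_trans _ _ (2^-1 * (1 - N.-1%:R^-1))); last first.
    by rewrite ler_piMr// gerBl invr_ge0.
  rewrite big_nat_cond.
  apply: (@le_trans _ _ (\sum_(2 <= n < N | (2 <= n < N)%N && true) 2^-1 * (n.-1%:R^-1 - n%:R^-1))).
    apply: ler_sum => n /andP[/andP[n1 _] _].
    have n0R : 0 < n%:R :> R by rewrite ltr0n (leq_trans _ n1).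
    have n1R : 2 <= n%:R :> R by rewrite (ler_nat R 2).
    rewrite cabs_rcM cnorm_cexp Re_rcM/= ger0_norm ?invr_ge0//.
    have -> : ln n%:R * - 2 = - (ln n%:R + ln n%:R) :> R by ring.
    rewrite expRN expRD lnK ?posrE//.
    have -> : n.-1%:R = n%:R - 1 :> R by rewrite -subn1 natrB// (leq_trans _ n1).
    set v : R := n%:R in n0R n1R *.
    have -> : 2^-1 * ((v - 1)^-1 - v^-1) = (2 * (v - 1) * v)^-1 by field; lra.
    rewrite -invfM lef_pV2 ?posrE ?mulr_gt0//; last by lra.
    by nra.
  rewrite -big_nat_cond -mulr_sumr ler_wpM2l//.
  clear S; elim: N N1 => // -[//|[_ _|N IH _]]; first by rewrite big_geq//= invr1 subrr.
  rewrite big_nat_recr//=; apply: le_trans (lerD (IH isT) (lexx _)) _.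
  by rewrite /= addrA subrK.
have := lerB_normD (1 : C) (S : C); rewrite cnorm1; lra.
Qed.

Lemma Zprod_ge N t x : (1 < N)%N -> - 2 < x -> x <= 0 ->
  4^-1 ^+ 8 - Zprod_err N x <= Zprod N t x.
Proof.
move=> N1 x2 x0; have N0 : (0 < N)%N by exact: ltnW.
(* A derivative is chosen at every real y, with the default 0 for y > 0 where nothing is claimed,
   because [MVT] expects a total function. *)
have h (y : R) : {d | y <= 0 -> is_derive y (1 : R) (Zprod N t) d & y <= 0 -> - Zprod_err N y / 2 <= d}.
  case: (leP y 0) => y0; last by exists 0.
  by have /cid2[d] := Zprod_derive t N0 y0; exists d.
pose dZ y := s2val (h y).
have dP y : y <= 0 -> is_derive y (1 : R) (Zprod N t) (dZ y) by exact: (s2valP (h y)).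
have dB y : y <= 0 -> - Zprod_err N y / 2 <= dZ y by exact: (s2valP' (h y)).
have [c] : exists2 c, c \in `](- 2), x[%R & Zprod N t x - Zprod N t (- 2) = dZ c * (x - - 2).
  apply: (MVT x2) => [y|].
    by rewrite in_itv/= => /andP[_ yx]; apply: dP; exact: ltW (lt_le_trans yx x0).
  apply: derivable_within_continuous => y; rewrite in_itv/= => /andP[_ yx].
  have dPy := dP y (le_trans yx x0); exact: ex_derive.
rewrite in_itv/= => /andP[c2 cx] hc.
have e : Zprod_err N c <= Zprod_err N x.
  rewrite /Zprod_err ler_wpM2l// ?mulr_ge0// ?exprn_ge0 ?addr_ge0 ?ln_ge0_nat//.
  by rewrite ler_expR ler_wpM2l ?ln_ge0_nat// ltW.
have e0 : 0 <= Zprod_err N c.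
  by rewrite /Zprod_err !mulr_ge0 ?expR_ge0// ?exprn_ge0 ?addr_ge0 ?ln_ge0_nat.
have hd : - Zprod_err N c <= dZ c * (x - - 2).
  have := dB c (ltW (lt_le_trans cx x0)).
  have : 0 < x - - 2 by lra.
  have : x - - 2 <= 2 by lra.
  set q := x - - 2 => q2 q0 hq.
  have : - Zprod_err N c / 2 * q <= dZ c * q by rewrite ler_wpM2r// ltW.
  nra.
have hP : 4^-1 ^+ 8 <= Zprod N t (- 2).
  have -> : 4^-1 ^+ 8 = 4^-1 ^+ 3 * 4^-1 ^+ 4 * 4^-1 :> R by ring.
  have q0 : 0 <= 4^-1 :> R by rewrite invr_ge0.
  apply: ler_pM; rewrite ?mulr_ge0 ?exprn_ge0// ?Znorm2_ge//.
  by apply: ler_pM; rewrite ?exprn_ge0// lerXn2r ?nnegrE ?Znorm2_ge// sqr_ge0.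
lra.
Qed.

End NonVanishing.

(** * Uniform lower bound for the truncations *)

Section LowerBound.
Variable R : realType.
Local Notation C := (Rcomplex R).
Local Notation cabs z := (@Num.norm R (complex_Rcomplex__canonical__Num_SemiNormedZmodule R) z).
Local Notation Re := (@complex.Re R).
Local Notation Im := (@complex.Im R).
Implicit Types (z w : C) (x y t B T e a u : R) (n N M k : nat).

Lemma ln_unbounded u : exists2 N0, (0 < N0)%N & forall N, (N0 <= N)%N -> u <= ln N%:R.
Proof.
exists (Num.truncn (expR u)).+1 => // N hN.
rewrite -ler_expR lnK ?posrE; last by rewrite ltr0n (leq_trans _ hN).
apply: (@le_trans _ _ (Num.truncn (expR u)).+1%:R); last by rewrite ler_nat.
exact/ltW/truncnS_gt.
Qed.

Lemma powln_decay a k e : 0 < a -> 0 < e -> exists2 N0, (0 < N0)%N &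
  forall N, (N0 <= N)%N -> (1 + ln N%:R) ^+ k * expR (ln N%:R * - a) <= e.
Proof.
(* The value of [c] ensures c <= 1 and k c <= a / 2. From 1 + v <= e^(c v) / c the power of the
   logarithm then consumes at most half of the exponential decay. *)
move=> a0 e0; pose c : R := a / (2 * k%:R + 2 + a).
have k0 : 0 <= k%:R :> R by rewrite ler0n.
have den : 0 < 2 * k%:R + 2 + a by lra.
have c0 : 0 < c by rewrite divr_gt0.
have cV : 0 <= c^-1 by rewrite invr_ge0 ltW.
have cVk : 0 <= c^-1 ^+ k by rewrite exprn_ge0.
have c1 : c <= 1 by rewrite ler_pdivrMr// mul1r; lra.
have ck : k%:R * c <= a / 2.
  rewrite /c mulrA ler_pdivrMr//.
  have : 0 <= a * a by rewrite mulr_ge0// ltW.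
  by nra.
have [N0 N00 hN0] := ln_unbounded (2 / a * ln (c^-1 ^+ k / e)).
exists N0 => // N NN; have := hN0 N NN; set v := ln N%:R => hv.
have v0 : 0 <= v by exact: ln_ge0_nat.
have h1 : (1 + v) ^+ k <= c^-1 ^+ k * expR (a / 2 * v).
  apply: (@le_trans _ _ ((c^-1 * expR (c * v)) ^+ k)).
    rewrite lerXn2r ?nnegrE; [| by lra | by rewrite mulr_ge0 ?expR_ge0// invr_ge0 ltW | ].
      by [].
    rewrite -ler_pdivrMl ?invr_gt0// invrK; apply: le_trans (expR_ge1Dx _).
    by rewrite mulrDr mulr1 lerD2r.
  rewrite exprMn ler_wpM2l//.
  by rewrite -expRM_natl ler_expR mulrA ler_wpM2r.
apply: (@le_trans _ _ (c^-1 ^+ k * expR (- (a / 2 * v)))).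
  apply: le_trans (ler_wpM2r (expR_ge0 _) h1) _.
  rewrite -[leLHS]mulrA -expRD ler_wpM2l//.
  by rewrite ler_expR; lra.
rewrite expRN ler_pdivrMr ?expR_gt0// [e * _]mulrC -ler_pdivrMr//.
rewrite -[leLHS]lnK ?posrE ?divr_gt0 ?exprn_gt0 ?invr_gt0// ler_expR.
by rewrite -ler_pdivrMl ?divr_gt0// invf_div.
Qed.

Section Bound.
Variables (T : R).
Hypothesis T0 : 0 <= T.

Let B := 2 * T + 2.
Let B1 : 1 <= B. Proof. by rewrite /B; have := T0; lra. Qed.
Let K := Dconst B.
Let K0 : 768 <= K.
Proof. by rewrite /K /Dconst; have := B1; rewrite expr2; nra. Qed.

Lemma cabs_Complex_le x t : - 1 <= x <= 0 -> `|t| <= 2 * T -> cabs (Complex x t) <= B.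
Proof.
move=> /andP[x1 x0] tT; apply: le_trans (cnorm_le _) _ => /=.
by rewrite ler0_norm// /B; have := T0; lra.
Qed.

Let lowc : R := (2 + K)^-1 ^+ 8 * (4^-1 ^+ 8 / 2).

Let lowc_gt0 : 0 < lowc.
Proof. by rewrite /lowc mulr_gt0 ?divr_gt0 ?exprn_gt0 ?invr_gt0//; have := K0; lra. Qed.

(** In the product |Z(x)|^6 |Z(x + it)|^8 |Z(x + 2it)|^2 the outer factors are bounded by |z Z(z)|
    <= 2 + K, which costs x^6 and |z|^2. The remaining |z|^8 turns the middle factor into the eighth
    power of z Z(z), that is of N^z - Dsum. *)
Lemma Dsum_lower_aux N x t : (1 < N)%N -> - 1 <= x -> x < 0 -> `|t| <= T ->
  Zprod_err N x <= 4^-1 ^+ 8 / 2 ->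
  lowc * x ^+ 6 * cabs (Complex x t) ^+ 10 <=
    (cabs (Dsum N (Complex x t)) + expR (ln N%:R * x)) ^+ 8.
Proof.
move=> N1 x1 x0 tT err; have N0 : (0 < N)%N by exact: ltnW.
have hP := Zprod_ge t N1 (_ : - 2 < x) (ltW x0).
have {}hP : 4^-1 ^+ 8 / 2 <= Zprod N t x by have := hP ltac:(lra); lra.
have x10 : - 1 <= x <= 0 by rewrite x1 ltW.
have t0 := normr_ge0 t.
have b0 : cabs (Complex x 0) <= B by apply: cabs_Complex_le; rewrite ?normr0//; have := T0; lra.
have b1 : cabs (Complex x t) <= B by apply: cabs_Complex_le; rewrite ?normr0//; have := T0; lra.
have b2 : cabs (Complex x (2 * t)) <= B.
  by apply: cabs_Complex_le; rewrite ?normr0// normrM ger0_norm//; lra.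
have h0 := zZsum_le B1 N0 (ltW x0 : Re (Complex x 0) <= 0) b0.
have h2 := zZsum_le B1 N0 (ltW x0 : Re (Complex x (2 * t)) <= 0) b2.
have h1 : cabs (Complex x t) * cabs (Zsum N (Complex x t)) <=
    cabs (Dsum N (Complex x t)) + expR (ln N%:R * x).
  rewrite -cnormM.
  have -> : Complex x t * Zsum N (Complex x t) = npow N (Complex x t) - Dsum N (Complex x t).
    by rewrite /Dsum; ring.
  by rewrite [leRHS]addrC; apply: le_trans (ler_normB _ _) _; rewrite cabs_npow.
have n0 : cabs (Complex x 0) = - x by rewrite cabs_rc ltr0_norm.
have n12 : cabs (Complex x t) <= cabs (Complex x (2 * t)).
  rewrite -ler_sqr ?nnegrE// !cnorm_sqr/= lerD2l exprMn.
  by have := sqr_ge0 t; lra.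
rewrite n0 in h0.
move: h0 h1 h2 n12 hP; rewrite /Zprod /Znorm2 -/K.
set z := cabs (Complex x t); set z2 := cabs (Complex x (2 * t)).
set Z0 := cabs (Zsum N (Complex x 0)); set Z1 := cabs (Zsum N (Complex x t)).
set Z2 := cabs (Zsum N (Complex x (2 * t))).
have z0 : 0 <= z by exact: normr_ge0.
have Z00 : 0 <= Z0 by exact: normr_ge0.
have Z10 : 0 <= Z1 by exact: normr_ge0.
have Z20 : 0 <= Z2 by exact: normr_ge0.
move=> h0 h1 h2 n12 hP.
apply: le_trans (_ : (z * Z1) ^+ 8 <= _); last by rewrite lerXn2r ?nnegrE ?mulr_ge0// addr_ge0 ?expR_ge0.
have h2' : z * Z2 <= 2 + K by apply: le_trans h2; rewrite ler_wpM2r.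
have K2 : 0 < 2 + K by have := K0; lra.
have key : (- x * Z0) ^+ 6 * (z * Z2) ^+ 2 <= (2 + K) ^+ 8.
  have nx0 : 0 <= - x by lra.
  have K2' := ltW K2.
  rewrite (exprD _ 6 2); apply: ler_pM; rewrite ?exprn_ge0 ?mulr_ge0//.
    by rewrite lerXn2r ?nnegrE ?mulr_ge0.
  by rewrite lerXn2r ?nnegrE ?mulr_ge0.
have -> : lowc * x ^+ 6 * z ^+ 10 =
    ((2 + K) ^+ 8)^-1 * (4^-1 ^+ 8 / 2 * (x ^+ 6 * z ^+ 10)).
  by rewrite /lowc exprVn; ring.
rewrite ler_pdivrMl ?exprn_gt0//.
have h3 : 0 <= x ^+ 6 * z ^+ 10.
  apply: mulr_ge0; last exact: exprn_ge0.
  have -> : x ^+ 6 = (x ^+ 2) ^+ 3 by ring.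
  by rewrite exprn_ge0 ?sqr_ge0.
apply: (@le_trans _ _ ((Z0 ^+ 2) ^+ 3 * (Z1 ^+ 2) ^+ 4 * Z2 ^+ 2 * (x ^+ 6 * z ^+ 10))).
  by rewrite ler_wpM2r.
have -> : (Z0 ^+ 2) ^+ 3 * (Z1 ^+ 2) ^+ 4 * Z2 ^+ 2 * (x ^+ 6 * z ^+ 10) =
  ((- x * Z0) ^+ 6 * (z * Z2) ^+ 2) * (z * Z1) ^+ 8 by ring.
by rewrite ler_wpM2r ?exprn_ge0 ?mulr_ge0.
Qed.

(** At fixed x < 0 the auxiliary N tends to infinity: the errors N^x disappear and [Dsum_tail]
    returns to M. The parameter y stands for the eighth root of the lower bound. *)
Lemma Dsum_lower M x t y : (0 < M)%N -> - 1 <= x -> x < 0 -> `|t| <= T -> 0 <= y ->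
  y ^+ 8 <= lowc * x ^+ 6 * cabs (Complex x t) ^+ 10 ->
  y <= cabs (Dsum M (Complex x t)) + K * (Num.sqrt M%:R)^-1.
Proof.
move=> M0 x1 x0 tT y0 hy; apply/ler_addgt0Pr => e e0.
have nx : 0 < - x by rewrite oppr_gt0.
have q0 : 0 < 4^-1 ^+ 8 / 2 / 64 :> R by rewrite !divr_gt0// exprn_gt0// invr_gt0.
have [N1 N10 hN1] := @powln_decay (- x) 18 _ nx q0.
have [N2 N20 hN2] := @powln_decay (- x) 0 e nx e0.
pose N := maxn 2 (maxn M (maxn N1 N2)).
have N_ge2 : (1 < N)%N by rewrite leq_max leqnn.
have MN : (M <= N)%N by rewrite !leq_max leqnn !orbT.
have := hN1 N (ltac:(by rewrite !leq_max leqnn !orbT)).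
have := hN2 N (ltac:(by rewrite !leq_max leqnn !orbT)).
rewrite expr0 mul1r opprK => e2 e1.
have b1 : cabs (Complex x t) <= B by apply: cabs_Complex_le; [rewrite x1 ltW|have := T0; have := normr_ge0 t; lra].
have := Dsum_tail B1 M0 MN (ltW x0 : Re (Complex x t) <= 0) b1; rewrite -/K => htail.
have err : Zprod_err N x <= 4^-1 ^+ 8 / 2 by rewrite /Zprod_err; lra.
have := Dsum_lower_aux N_ge2 x1 x0 tT err => /(le_trans hy).
have s0 : 0 <= cabs (Dsum N (Complex x t)) + expR (ln N%:R * x) by rewrite addr_ge0 ?expR_ge0.
rewrite ler_pXn2r ?nnegrE// => h.
have : cabs (Dsum N (Complex x t)) <= cabs (Dsum M (Complex x t)) + cabs (Dsum N (Complex x t) - Dsum M (Complex x t)).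
  by apply: le_trans (ler_normD _ _); rewrite addrC subrK.
lra.
Qed.

(** Within [r] of the pole, closeness to 1 suffices. Elsewhere the bound of order |x|^(6/8) is used
    at Re z <= -ka, and points nearer to the boundary are compared with the point of real part -ka
    at the same height. As 6 < 8, a small ka makes the bound at -ka exceed the Lipschitz loss K
    ka. *)
Lemma Dsum_nonvanishing : exists2 c : R, 0 < c & exists2 M0, (0 < M0)%N &
  forall M z, (M0 <= M)%N -> - 1 <= Re z -> Re z < 0 -> `|Im z| <= T -> c <= cabs (Dsum M z).
Proof.
have Kp : 0 < K by have := K0; lra.
have Kge := ltW Kp; have lge := ltW lowc_gt0.
have K2ge : 0 <= 2 * K by apply: mulr_ge0.
pose r : R := (2 * K)^-1.
have r0 : 0 < r by rewrite invr_gt0 mulr_gt0.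
pose q : R := lowc * r ^+ 10 / (2 * K) ^+ 8.
have q0 : 0 < q.
  apply: divr_gt0; first by apply: mulr_gt0; [exact: lowc_gt0|exact: exprn_gt0].
  by apply: exprn_gt0; exact: mulr_gt0.
(* This gives ka <= 1 and ka^2 <= q, and the latter is the condition (2 K ka)^8 <= lowc ka^6 r^10
   for taking y = 2 K ka in [Dsum_lower]. *)
pose ka : R := q / (1 + q).
have ka0 : 0 < ka by rewrite divr_gt0//; lra.
have kage := ltW ka0; have rge := ltW r0; have qge := ltW q0.
have Kka0 : 0 <= K * ka by apply: mulr_ge0.
have ka1 : ka <= 1 by rewrite ler_pdivrMr; lra.
have kaq : ka ^+ 2 <= q.
  apply: (@le_trans _ _ ka); first by rewrite expr2 ler_piMr// ltW.
  by rewrite ler_pdivrMr; [rewrite ler_peMr; lra|lra].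
pose c := Num.min 2^-1 (K * ka / 2).
have c0 : 0 < c by rewrite lt_min invr_gt0 ltr0n divr_gt0// mulr_gt0.
exists c => //.
(* Limits the tail to K ka / 2. Out of 2 K ka, the tail and a Lipschitz loss of at most K ka leave K
   ka / 2. *)
pose M0 := (Num.truncn ((2 / ka) ^+ 2)).+1.
exists M0 => // M [x t] MM0 /= x1 x0 tT; set z := Complex x t.
have M_gt0 : (0 < M)%N by exact: leq_trans MM0.
have hM : (Num.sqrt M%:R)^-1 <= ka / 2.
  rewrite -[leRHS]invrK lef_pV2 ?posrE; [|by rewrite sqrtr_gt0 ltr0n|by rewrite invr_gt0 divr_gt0].
  rewrite invf_div.
  rewrite -[leLHS]ger0_norm; last by rewrite divr_ge0 ?ltW.
  rewrite -sqrtr_sqr ler_wsqrtr//.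
  apply: (@le_trans _ _ M0%:R); last by rewrite ler_nat.
  exact/ltW/truncnS_gt.
have bz (y : R) : - 1 <= y -> y <= 0 -> cabs (Complex y t) <= B.
  by move=> y1 y0; apply: cabs_Complex_le; rewrite ?y1//; have := T0; have := normr_ge0 t; lra.
have [zr|rz] := leP (cabs z) r.
  have := Dsum1_le B1 M_gt0 (ltW x0 : Re z <= 0) (bz x x1 (ltW x0)); rewrite -/K => h.
  have h' : K * cabs z <= 2^-1.
    apply: le_trans (ler_wpM2l (ltW Kp) zr) _.
    by rewrite /r invfM mulrCA divff ?gt_eqF// mulr1.
  have h3 : cabs 1 <= cabs (Dsum M z) + cabs (Dsum M z - 1).
    have e : (1 : C) = Dsum M z - (Dsum M z - 1) by ring.
    by rewrite {1}e; exact: ler_normB.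
  rewrite cnorm1 in h3.
  have := le_trans h3 (lerD (lexx _) (le_trans h h')).
  rewrite /c ge_min; move: (cabs (Dsum M z)) => d hd.
  by apply/orP; left; lra.
have low (y : R) : - 1 <= y -> y <= - ka -> r <= cabs (Complex y t) ->
    K * ka * (3 / 2) <= cabs (Dsum M (Complex y t)).
  move=> y1 yk ry.
  have y0 : y < 0 by lra.
  have := @Dsum_lower M y t (2 * K * ka) M_gt0 y1 y0 tT.
  have Kka : 0 <= 2 * K * ka by apply: mulr_ge0.
  have Kh : K * (Num.sqrt M%:R)^-1 <= K * (ka / 2) by apply: ler_wpM2l.
  move=> /(_ Kka) hh; suff /hh : (2 * K * ka) ^+ 8 <= lowc * y ^+ 6 * cabs (Complex y t) ^+ 10 by lra.
  apply: (@le_trans _ _ (lowc * ka ^+ 6 * r ^+ 10)); last first.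
    have e6 : y ^+ 6 = (- y) ^+ 6 by ring.
    apply: ler_pM.
    - by apply: mulr_ge0 => //; exact: exprn_ge0.
    - exact: exprn_ge0.
    - by apply: ler_wpM2l => //; rewrite e6; apply: lerXn2r; rewrite ?nnegrE; lra.
    - by apply: lerXn2r; rewrite ?nnegrE.
  have -> : lowc * ka ^+ 6 * r ^+ 10 = (2 * K) ^+ 8 * q * ka ^+ 6.
    rewrite /q [(2 * K) ^+ 8 * _]mulrC divfK; last by rewrite expf_neq0// gt_eqF// mulr_gt0.
    by rewrite mulrAC.
  rewrite exprMn (exprD ka 2 6) mulrA; apply: ler_wpM2r; first exact: exprn_ge0.
  by apply: ler_wpM2l => //; exact: exprn_ge0.
rewrite /c ge_min; apply/orP; right.
have [xk|kx] := leP x (- ka).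
  have := low x x1 xk (ltW rz); rewrite -/z; move: (cabs (Dsum M z)) => d; lra.
have hr : r <= cabs (Complex (- ka) t).
  apply: le_trans (ltW rz) _; rewrite -ler_sqr ?nnegrE// !cnorm_sqr/= lerD2r sqrrN.
  have -> : x ^+ 2 = (- x) ^+ 2 by rewrite sqrrN.
  by rewrite lerXn2r ?nnegrE; lra.
have := low (- ka) ltac:(lra) (lexx _) hr.
have := @Dsum_lip _ B B1 M (Complex (- ka) t) z M_gt0 ltac:(rewrite /=; lra) (ltW x0 : Re z <= 0) (bz (- ka) ltac:(lra) ltac:(lra)) (bz x x1 (ltW x0)).
have -> : Complex (- ka) t - z = rc (- ka - x).
  by apply/eqP; rewrite eq_complex /z/= subrr !eqxx.
rewrite cabs_rc ler0_norm; last by lra.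
rewrite -/K => h1 h2.
have h3 : cabs (Dsum M (Complex (- ka) t)) <= cabs (Dsum M z) + cabs (Dsum M (Complex (- ka) t) - Dsum M z).
  by apply: le_trans (ler_normD _ _); rewrite addrC subrK.
have : K * - (- ka - x) <= K * ka by apply: ler_wpM2l => //; lra.
move: h1 h2 h3; move: (cabs (Dsum M z)) (cabs (Dsum M (Complex (- ka) t))) (cabs _) => d1 d2 d3.
lra.
Qed.

End Bound.
End LowerBound.

(** * The Wiener-Ikehara argument with the Fejer kernel *)

Section IntegralExtra.
Variable R : realType.
Implicit Types (a b c x y M L e : R) (f g F : R -> R).

Lemma intg_shift a b c f : a <= b -> continuous f ->
  intg (a + c) (b + c) f = intg a b (fun x => f (x + c)).
Proof.
move=> ab cf; rewrite /intg /Rintegral.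
pose F x := x + c.
have dF x : is_derive x (1 : R) F 1 by apply: is_derive_eq; rewrite addr0.
have dFE : derive1 F = fun=> 1 by apply/funext => x; rewrite derive1E derive_val.
have cF : continuous F.
  by move=> x; apply/differentiable_continuous/derivable1_diffP; exact: ex_derive.
rewrite (@integration_by_substitution_increasing R F f a b)//.
- by congr fine; apply: eq_integral => x _; rewrite /= fctE dFE mulr1.
- by move=> x y _ _ xy; rewrite /F ltrD2r.
- by rewrite dFE => x _; exact: cvg_cst.
- by rewrite dFE; apply: is_cvg_cst.
- by rewrite dFE; apply: is_cvg_cst.
- by split=> [x _||]; [exact: ex_derive|apply: cvg_at_right_filter; exact: cF
    |apply: cvg_at_left_filter; exact: cF].
- exact: continuous_subspaceT.
Qed.

Lemma intg_tail_le a b c f : 0 < a -> a <= b -> continuous f ->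
  (forall x, a <= x -> f x <= c / x ^+ 2) -> 0 <= c -> intg a b f <= c / a.
Proof.
move=> a0; rewrite le_eqVlt => /predU1P[<-|ab] cf fc c0.
  by rewrite /intg set_itv1 Rintegral_set1 divr_ge0// ltW.
pose g x : R := c / x ^+ 2; pose G x : R := - c / x.
have dG x : x != 0 -> is_derive x (1 : R) G (g x).
  move=> x0; have dV : is_derive x (1 : R) (fun y : R => y^-1) (- x ^- 2).
    by apply: is_derive_eq; [exact: is_deriveV|rewrite /GRing.scale/= mulr1].
  apply: is_derive_eq; rewrite /GRing.scale/= /g; by field.
have cG x : x != 0 -> {for x, continuous G}.
  by move=> x0; apply/differentiable_continuous/derivable1_diffP; have := dG x x0; move=> ?; exact: ex_derive.
have cg : {within `[a, b], continuous g}.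
  apply: derivable_within_continuous => x; rewrite in_itv/= => /andP[ax _].
  have x0 : x ^+ 2 != 0 by rewrite expf_neq0// gt_eqF// (lt_le_trans a0).
  by apply: derivableM; [exact: derivable_cst|apply: derivableV => //; exact: derivableX].
have ab0 x : a <= x -> x != 0 by move=> ax; rewrite gt_eqF// (lt_le_trans a0).
have gi : (@lebesgue_measure R).-integrable `[a, b] (EFin \o g).
  by apply: continuous_compact_integrable => //; exact: segment_compact.
apply: (@le_trans _ _ (intg a b g)).
  apply: le_Rintegral => //; first exact: intg_integrable.
  by move=> x/=; rewrite in_itv/= => /andP[ax _]; exact: fc.
rewrite /intg /Rintegral (@continuous_FTC2 _ g G)//.
- rewrite -EFinB /= /G; have : 0 <= c / b by rewrite divr_ge0// ltW// (lt_trans a0).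
  lra.
- split.
  + by move=> x; rewrite in_itv/= => /andP[ax _]; have := dG x (ab0 x (ltW ax)); move=> ?; exact: ex_derive.
  + by apply: cvg_at_right_filter; apply: cG; exact: ab0.
  + by apply: cvg_at_left_filter; apply: cG; apply: ab0; exact: ltW.
- move=> x; rewrite in_itv/= => /andP[ax _]; rewrite derive1E.
  by have := dG x (ab0 x (ltW ax)); move=> ?; rewrite derive_val.
Qed.

(** Cutting [0, V] into m equal steps bounds the total increment by c V^2 / m for every m. It serves
    to identify two iterated integrals from local estimates alone. *)
Lemma quadratic_increments (D : R -> R) c V : 0 <= c -> 0 <= V ->
  (forall x y, 0 <= x -> x <= y -> y <= V -> `|D y - D x| <= c * (y - x) ^+ 2) -> D V = D 0.
Proof.
move=> c0 V0 h; apply/eqP; rewrite -subr_eq0 -normr_le0; apply/ler_addgt0Pr => e e0.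
rewrite add0r.
pose m := (Num.truncn (c * V ^+ 2 / e)).+1.
have m0 : 0 < m%:R :> R by rewrite ltr0n.
have hk k : (k <= m)%N -> `|D (k%:R * (V / m%:R)) - D 0| <= k%:R * (c * (V / m%:R) ^+ 2).
  elim: k => [_|k IH km]; first by rewrite !mul0r subrr normr0.
  have Vm : 0 <= V / m%:R by rewrite divr_ge0// ltW.
  have s : k.+1%:R * (V / m%:R) - k%:R * (V / m%:R) = V / m%:R.
    by rewrite -mulrBl -natrB// subSnn mul1r.
  have := h (k%:R * (V / m%:R)) (k.+1%:R * (V / m%:R)).
  rewrite s => /(_ (mulr_ge0 (ler0n _ _) Vm)) h1.
  have h2 : k%:R * (V / m%:R) <= k.+1%:R * (V / m%:R) by rewrite ler_wpM2r// ler_nat.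
  have h3 : k.+1%:R * (V / m%:R) <= V.
    by rewrite mulrCA ler_piMr// ler_pdivrMr// mul1r ler_nat.
  have i2 := h1 h2 h3; have i1 := IH (ltnW km).
  have -> : D (k.+1%:R * (V / m%:R)) - D 0 = (D (k.+1%:R * (V / m%:R)) - D (k%:R * (V / m%:R))) +
    (D (k%:R * (V / m%:R)) - D 0) by ring.
  apply: le_trans (ler_normD _ _) _.
  have -> : k.+1%:R * (c * (V / m%:R) ^+ 2) = c * (V / m%:R) ^+ 2 + k%:R * (c * (V / m%:R) ^+ 2).
    by rewrite -natr1 mulrDl mul1r addrC.
  exact: lerD.
have := hk m (leqnn m).
have -> : m%:R * (V / m%:R) = V by rewrite mulrC divfK// gt_eqF.
have -> : m%:R * (c * (V / m%:R) ^+ 2) = c * V ^+ 2 / m%:R by field; rewrite gt_eqF.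
move=> /le_trans; apply; rewrite ler_pdivrMr// [e * _]mulrC -ler_pdivrMr//.
exact/ltW/truncnS_gt.
Qed.

(* Fubini for a kernel that is Lipschitz in the second variable: both iterated
   integrals have the same increments up to a quadratic error. *)
Lemma intg_swap (f F : R -> R -> R) b L V : 0 <= b -> 0 <= L -> 0 <= V ->
  (forall t, continuous (f t)) -> (forall v, continuous (f^~ v)) ->
  (forall v, continuous (F^~ v)) ->
  (forall t v, is_derive v (1 : R) (F t) (f t v)) ->
  continuous (fun v => intg 0 b (f^~ v)) ->
  (forall t v v', t \in `[0, b] -> 0 <= v -> 0 <= v' -> `|f t v - f t v'| <= L * `|v - v'|) ->
  intg 0 b (fun t => F t V - F t 0) = intg 0 V (fun v => intg 0 b (f^~ v)).
Proof.
move=> b0 L0 V0 cf1 cf2 cF dF ci lip.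
pose D v := intg 0 b (fun t => F t v - F t 0) - intg 0 v (fun v => intg 0 b (f^~ v)).
have cB (h k : R -> R) : continuous h -> continuous k -> continuous (fun t => h t - k t).
  by move=> ch ck t; apply: (@continuousB _ R^o); [exact: ch|exact: ck].
have cC (r : R) : continuous (fun _ : R => r) by move=> t; exact: cvg_cst.
have cM (r : R) (h : R -> R) : continuous h -> continuous (fun t => r * h t).
  by move=> ch t; apply: (@continuousM R R^o (cst r) h); [exact: cvg_cst|exact: ch].
have bC : 0 <= 2 * L * b by rewrite !mulr_ge0.
have := @quadratic_increments D (2 * L * b) V bC V0 _.
have D0 : D 0 = 0.
  rewrite /D {2}/intg set_itv1 Rintegral_set1 subr0.
  have -> : intg 0 b (fun t => F t 0 - F t 0) = intg 0 b (fun=> 0).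
    by apply: eq_intg => t _; rewrite subrr.
  by rewrite intg_cst// mul0r.
rewrite D0 => DV; apply/eqP; rewrite -subr_eq0; apply/eqP; apply: DV.
move=> x y x0 xy yV.
have y0 : 0 <= y := le_trans x0 xy.
have yx : 0 <= y - x by rewrite subr_ge0.
have -> : D y - D x = intg 0 b (fun t => F t y - F t x - (y - x) * f t x) -
    intg x y (fun v => intg 0 b (f^~ v) - intg 0 b (f^~ x)).
  have e1 : intg 0 b (fun t => F t y - F t 0) - intg 0 b (fun t => F t x - F t 0) =
    intg 0 b (fun t => F t y - F t x).
    rewrite -intgB; [|exact: cB|exact: cB].
    by apply: eq_intg => t _; ring.
  have e2 := intg_cat x0 xy ci.
  have r1 : intg 0 b (fun t => F t y - F t x - (y - x) * f t x) =
      intg 0 b (fun t => F t y - F t x) - (y - x) * intg 0 b (f^~ x).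
    by rewrite intgB ?intgZ//; [exact: cB|exact: cM].
  have r2 : intg x y (fun v => intg 0 b (f^~ v) - intg 0 b (f^~ x)) =
      intg x y (fun v => intg 0 b (f^~ v)) - intg 0 b (f^~ x) * (y - x).
    by rewrite intgB// intg_cst.
  rewrite /D e2 r1 r2 -e1; ring.
apply: le_trans (ler_normB _ _) _.
have -> : 2 * L * b * (y - x) ^+ 2 = (L * (y - x) ^+ 2) * (b - 0) + (L * b * (y - x)) * (y - x) by ring.
apply: lerD; apply: intg_norm_le => //.
- by apply: (cB); [exact: cB|exact: cM].
- move=> t tb.
  have -> : F t y - F t x - (y - x) * f t x = intg x y (fun v => f t v - f t x).
    by rewrite intgB// intg_cst// (intg_FTC xy (cf1 t) (dF t)); ring.
  have -> : L * (y - x) ^+ 2 = L * (y - x) * (y - x) by ring.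
  apply: intg_norm_le => //; first exact: cB.
  move=> v; rewrite in_itv/= => /andP[xv vy].
  apply: le_trans (lip t v x tb (le_trans x0 xv) x0) _.
  by rewrite ler_wpM2l// ger0_norm ?subr_ge0// lerD2r.
- exact: cB.
- move=> v; rewrite in_itv/= => /andP[xv vy].
  rewrite -intgB//.
  have -> : L * b * (y - x) = L * (y - x) * (b - 0) by ring.
  apply: intg_norm_le => //; first exact: cB.
  move=> t tb; apply: le_trans (lip t v x tb (le_trans x0 xv) x0) _.
  by rewrite ler_wpM2l// ger0_norm ?subr_ge0// lerD2r.
Qed.

(* Riemann-Lebesgue by comparing g with a constant on each full period. *)
Lemma riemann_lebesgue (g phi : R -> R) b p M L e : 0 <= b -> 0 < p -> 0 <= L -> 0 <= e -> 0 <= M ->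
  continuous g -> continuous phi -> (forall t, `|phi t| <= 1) ->
  (forall a, 0 <= a -> intg a (a + p) phi = 0) ->
  {in `[0, b], forall t, `|g t| <= M} ->
  {in `[0, b] &, forall t s, `|g t - g s| <= L * `|t - s| + e} ->
  `|intg 0 b (fun t => g t * phi t)| <= (L * p + e) * b + M * p.
Proof.
move=> b0 p0 L0 e0 M0 cg cphi phi1 per gM glip.
have cP : continuous (fun t => g t * phi t).
  by move=> t; apply: (@continuousM R R^o g phi); [exact: cg|exact: cphi].
have LE : 0 <= L * p + e by rewrite addr_ge0// mulr_ge0// ltW.
have hk k : k%:R * p <= b -> `|intg 0 (k%:R * p) (fun t => g t * phi t)| <= (L * p + e) * (k%:R * p).
  elim: k => [_|k IH kb].
    by rewrite mul0r /intg set_itv1 Rintegral_set1 normr0 mulr0.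
  have kp : 0 <= k%:R * p by rewrite mulr_ge0// ltW.
  have eS : k.+1%:R * p = k%:R * p + p by rewrite -natr1 mulrDl mul1r.
  rewrite eS in kb *.
  rewrite (intg_cat kp _ cP); last by rewrite lerDl ltW.
  apply: le_trans (ler_normD _ _) _; rewrite mulrDr; apply: lerD.
    by apply: IH; apply: le_trans kb; rewrite lerDl ltW.
  set q := k%:R * p in kp kb *.
  have cgq : continuous (fun t => (g t - g q) * phi t).
    move=> t; apply: (@continuousM R R^o (fun t => g t - g q) phi); last exact: cphi.
    by apply: (@continuousB _ R^o); [exact: cg|exact: cvg_cst].
  have -> : intg q (q + p) (fun t => g t * phi t) = intg q (q + p) (fun t => (g t - g q) * phi t).
    rewrite -[LHS]subr0 -(mulr0 (g q)) -(per q kp) -intgZ// -intgB//.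
      by apply: eq_intg => t _; ring.
    by move=> t; apply: (@continuousM R R^o (cst (g q)) phi); [exact: cvg_cst|exact: cphi].
  have -> : (L * p + e) * p = (L * p + e) * (q + p - q) by ring.
  apply: intg_norm_le => //; first by rewrite lerDl ltW.
  move=> t; rewrite in_itv/= => /andP[qt tp]; rewrite normrM.
  have tb : t \in `[0, b] by rewrite in_itv/= (le_trans kp)// (le_trans tp).
  have qb : q \in `[0, b] by rewrite in_itv/= kp (le_trans _ kb)// lerDl ltW.
  have h1 := glip t q tb qb; rewrite (ger0_norm (_ : 0 <= t - q)) ?subr_ge0// in h1.
  have h2 : L * (t - q) <= L * p by rewrite ler_wpM2l//; lra.
  rewrite -[leRHS]mulr1; apply: ler_pM => //; lra.
pose k := Num.truncn (b / p).
have kb : k%:R * p <= b by rewrite -ler_pdivlMr// truncn_le// divr_ge0// ltW.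
have bk : b <= k%:R * p + p.
  by rewrite -{2}(mul1r p) -mulrDl natr1 -ler_pdivrMr//; exact/ltW/truncnS_gt.
have kp : 0 <= k%:R * p by rewrite mulr_ge0// ltW.
rewrite (intg_cat kp kb cP); apply: le_trans (ler_normD _ _) _; apply: lerD.
  by apply: le_trans (hk k kb) _; rewrite ler_wpM2l.
apply: (@le_trans _ _ (M * (b - k%:R * p))); last by rewrite ler_wpM2l//; lra.
apply: intg_norm_le => // t; rewrite in_itv/= => /andP[kt tb].
rewrite normrM -[leRHS]mulr1; apply: ler_pM => //.
by apply: gM; rewrite in_itv/= tb (le_trans kp).
Qed.

End IntegralExtra.

(** * The logarithmic derivative of zeta near the boundary *)

Section LogDerivative.
Variable R : realType.
Local Notation C := (Rcomplex R).
Local Notation cabs z := (@Num.norm R (complex_Rcomplex__canonical__Num_SemiNormedZmodule R) z).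
Local Notation Re := (@complex.Re R).
Local Notation Im := (@complex.Im R).
Implicit Types (z w : C) (x y t s B T e : R) (n N M k : nat).

Lemma Lsum_le N z : (0 < N)%N -> Re z <= 0 -> cabs (Lsum N z) <= (1 + ln N%:R) ^+ 2.
Proof.
move=> N0 z0; have l0 := ln_ge0_nat R N.
apply: le_trans (_ : ln N%:R * \sum_(1 <= n < N) n%:R^-1 <= _); last first.
  rewrite expr2; apply: ler_pM => //; first by rewrite sumr_ge0.
    by rewrite lerDr.
  exact: harmonic_sum_le.
apply: le_trans (ler_norm_sum _ _ _) _.
rewrite mulr_sumr; apply: ler_sum_nat => n /andP[n0 nN].
have /andP[v0 vn] := vonMangoldt_bounds R n0.
rewrite cabs_rcM ger0_norm; last by rewrite mulr_ge0.
apply: le_trans (_ : vonMangoldt R n / n%:R * 1 <= _).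
  by apply: ler_wpM2l; [rewrite mulr_ge0|exact: cabs_npow_le1].
rewrite mulr1 ler_wpM2r//; apply: le_trans vn _.
by rewrite ler_ln ?posrE ?ltr0n// ler_nat ltnW.
Qed.

(** In the limit [Dsum] is -z zeta(1 - z), whose logarithmic derivative is L + 1/z. At finite N two
    defects remain; one carries N^z explicitly, the other through [conv_err], so both vanish as N
    grows with Re z < 0 fixed. *)
Lemma logder_identity N z : z != 0 -> (Lsum N z + z^-1) * Dsum N z - Dder N z =
  (Lsum N z + z^-1 - rc (ln N%:R)) * npow N z - z * (Lsum N z * Zsum N z - Zlog N z).
Proof. by move=> z0; rewrite /Dsum /Dder; field. Qed.

Lemma cabs_sub_le z w : cabs z <= cabs w + cabs (z - w).
Proof. by apply: le_trans (ler_normD _ _); rewrite addrC subrK. Qed.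

(** The order of the quantifiers is the point: [M] depends on [T] only and so is uniform up to the
    boundary, whereas [N0] may depend on [eps] and on the tolerance [e]. *)
Lemma logder_approx T : 0 <= T -> exists2 M : R, 0 <= M &
  forall eps, 0 < eps -> eps <= 1 -> forall e, 0 < e -> exists2 N0, (0 < N0)%N &
  forall N, (N0 <= N)%N ->
  let G t : C := Lsum N (Complex (- eps) t) + (Complex (- eps) t)^-1 in
  (forall t, `|t| <= T -> cabs (G t) <= M + e) /\
  (forall t s, `|t| <= T -> `|s| <= T -> cabs (G t - G s) <= M * `|t - s| + e).
Proof.
move=> T0; have [c c0 [M0 M00 hc]] := Dsum_nonvanishing T0.
pose B := T + 1; have B1 : 1 <= B by rewrite /B; lra.
set K := Dconst B; have K0 : 0 <= K := mulr_ge0 (ler0n _ _) (sqr_ge0 _).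
have cB t eps : 0 < eps -> eps <= 1 -> `|t| <= T -> cabs (Complex (- eps) t) <= B.
  move=> e0 e1 tT; apply: le_trans (cnorm_le _) _; rewrite /= normrN gtr0_norm// /B.
  lra.
have bD N t eps : (0 < N)%N -> 0 < eps -> eps <= 1 -> `|t| <= T ->
    cabs (Dsum N (Complex (- eps) t)) <= 1 + K.
  by move=> N0 e0 e1 tT; apply: (Dsum_le B1) => //=; [lra|exact: cB].
have bD' N t eps : (0 < N)%N -> 0 < eps -> eps <= 1 -> `|t| <= T ->
    cabs (Dder N (Complex (- eps) t)) <= K.
  by move=> N0 e0 e1 tT; apply: (Dder_le B1) => //=; [lra|exact: cB].
have cts t s eps : cabs (Complex (- eps) t - Complex (- eps) s) = `|t - s|.
  by rewrite cnormE/= subrr expr0n add0r sqrtr_sqr.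
have lD N t s eps : (0 < N)%N -> 0 < eps -> eps <= 1 -> `|t| <= T -> `|s| <= T ->
    cabs (Dsum N (Complex (- eps) t) - Dsum N (Complex (- eps) s)) <= K * `|t - s|.
  move=> N0 e0 e1 tT sT; rewrite -(cts t s eps).
  by apply: (Dsum_lip B1) => //=; [lra|lra|exact: cB|exact: cB].
have lD' N t s eps : (0 < N)%N -> 0 < eps -> eps <= 1 -> `|t| <= T -> `|s| <= T ->
    cabs (Dder N (Complex (- eps) t) - Dder N (Complex (- eps) s)) <= K * `|t - s|.
  move=> N0 e0 e1 tT sT; rewrite -(cts t s eps).
  by apply: (Dder_lip B1) => //=; [lra|lra|exact: cB|exact: cB].
clearbody K.
pose M := K / c + (K * (1 + K) + K * K) / c ^+ 2.
have cc0 : 0 < c ^+ 2 by rewrite exprn_gt0.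
have Kc0 : 0 <= K / c by rewrite divr_ge0// ltW.
have M1 : 0 <= K * (1 + K) + K * K by nra.
have M2 : 0 <= (K * (1 + K) + K * K) / c ^+ 2 by rewrite divr_ge0// ltW.
exists M => [|eps e0 e1 e ee0]; first by rewrite /M addr_ge0.
(* Collects the coefficients of the two defects: |L + 1/z - ln N|, where |1/z| <= 1/eps, and |z| <=
   B. *)
pose Q := 1 + eps^-1 + 1 + B.
have eV : 0 < eps^-1 by rewrite invr_gt0.
have Q0 : 0 < Q by rewrite /Q; lra.
have d0 : 0 < e / 2 * c / Q by rewrite divr_gt0// mulr_gt0// divr_gt0.
have [N1 N10 hN1] := @powln_decay R eps 3 _ e0 d0.
exists (maxn M0 N1) => [|N]; first by rewrite leq_max M00.
rewrite geq_max => /andP[MN NN] G.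
have N0 : (0 < N)%N := leq_trans M00 MN.
have hD t : `|t| <= T -> c <= cabs (Dsum N (Complex (- eps) t)).
  by move=> tT; apply: hc => //=; lra.
pose H t : C := Dder N (Complex (- eps) t) / Dsum N (Complex (- eps) t).
have GH t : `|t| <= T -> cabs (G t - H t) <= e / 2.
  move=> tT; set z := Complex (- eps) t.
  have z0 : Re z <= 0 by rewrite /=; lra.
  have eps_z : eps <= cabs z.
    by apply: le_trans (Re_le_cnorm z); rewrite /= normrN gtr0_norm.
  have zn0 : z != 0.
    by rewrite -(@normr_eq0 R (complex_Rcomplex__canonical__Num_SemiNormedZmodule R)) gt_eqF// (lt_le_trans e0).
  have Dz := hD t tT; rewrite -/z in Dz.
  have Dn0 : Dsum N z != 0.
    by rewrite -(@normr_eq0 R (complex_Rcomplex__canonical__Num_SemiNormedZmodule R)) gt_eqF// (lt_le_trans c0).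
  have -> : G t - H t = ((Lsum N z + z^-1) * Dsum N z - Dder N z) / Dsum N z.
    by rewrite /G /H -/z; field; rewrite ?Dn0 ?zn0.
  rewrite logder_identity// cnormM cnormV ler_pdivrMr; last exact: lt_le_trans Dz.
  apply: (@le_trans _ _ (e / 2 * c)); last by rewrite ler_wpM2l// divr_ge0// ltW.
  have l0 := ln_ge0_nat R N.
  have hq : cabs (npow N z) = expR (ln N%:R * - eps) by rewrite cabs_npow.
  have he := conv_err_le N0 z0; rewrite /conv_err in he.
  have hL := Lsum_le N0 z0.
  have hNN := hN1 N NN.
  move: hq he hL hNN => /=; set E := expR _; set l := ln N%:R in l0 *.
  move=> hq he hL hNN; have E0 : 0 <= E by exact: expR_ge0.
  have h3 k : (k <= 3)%N -> (1 + l) ^+ k <= (1 + l) ^+ 3.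
    by move=> k3; apply: ler_weXn2l => //; lra.
  apply: le_trans (ler_normB _ _) _; rewrite !cnormM hq.
  have hz : cabs z <= B := cB t eps e0 e1 tT.
  have hzV : cabs z^-1 <= eps^-1 by rewrite cnormV lef_pV2 ?posrE// (lt_le_trans e0).
  have h4 : cabs (Lsum N z + z^-1 - rc l) <= (1 + eps^-1 + 1) * (1 + l) ^+ 3.
    apply: le_trans (ler_normB _ _) _; rewrite cabs_rc ger0_norm//.
    apply: le_trans (lerD (ler_normD _ _) (lexx _)) _.
    have := h3 2 isT; have := h3 1 isT; have := h3 0 isT; rewrite expr0 expr1.
    have : 0 <= eps^-1 by rewrite invr_ge0 ltW.
    move: hL hzV; move: (cabs (Lsum N z)) (cabs z^-1) (eps^-1) ((1 + l) ^+ 3) ((1 + l) ^+ 2) => a1 a2 a3 a4 a5.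
    by move=> i1 i2 i3 i4 i5 i6; nra.
  apply: (@le_trans _ _ ((1 + eps^-1 + 1) * (1 + l) ^+ 3 * E + B * (E * (1 + l) ^+ 3))).
    by apply: lerD; [apply: ler_wpM2r|apply: ler_pM].
  have -> : (1 + eps^-1 + 1) * (1 + l) ^+ 3 * E + B * (E * (1 + l) ^+ 3) = ((1 + l) ^+ 3 * E) * Q by rewrite /Q; ring.
  by rewrite -ler_pdivlMr.
have Hb t : `|t| <= T -> cabs (H t) <= K / c.
  move=> tT; rewrite cnormM cnormV; apply: ler_pM => //; first exact: bD'.
  by rewrite lef_pV2 ?posrE ?hD// (lt_le_trans c0)// hD.
split=> [t tT|t s tT sT].
  apply: le_trans (cabs_sub_le _ (H t)) _; have := Hb t tT; have := GH t tT.
  rewrite /M; move: (cabs (H t)) (cabs (G t - H t)) => a1 a2; lra.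
have Hlip : cabs (H t - H s) <= M * `|t - s|.
  set Dt := Dsum N (Complex (- eps) t); set Ds := Dsum N (Complex (- eps) s).
  set at_ := Dder N (Complex (- eps) t); set as_ := Dder N (Complex (- eps) s).
  have Dtc : c <= cabs Dt := hD t tT; have Dsc : c <= cabs Ds := hD s sT.
  have nz z : c <= cabs z -> z != 0.
    move=> cz.
    by rewrite -(@normr_eq0 R (complex_Rcomplex__canonical__Num_SemiNormedZmodule R)) gt_eqF// (lt_le_trans c0).
  have -> : H t - H s = ((at_ - as_) * Ds + as_ * (Ds - Dt)) / (Dt * Ds).
    by rewrite /H -/Dt -/Ds -/at_ -/as_; field; rewrite !nz.
  rewrite cnormM cnormV cnormM.
  have h1 : cabs ((at_ - as_) * Ds + as_ * (Ds - Dt)) <= (K * (1 + K) + K * K) * `|t - s|.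
    apply: le_trans (ler_normD _ _) _; rewrite !cnormM mulrDl; apply: lerD.
      have -> : K * (1 + K) * `|t - s| = K * `|t - s| * (1 + K) by ring.
      by apply: ler_pM => //; [exact: lD'|exact: bD].
    rewrite -mulrA; apply: ler_pM => //; first exact: bD'.
    by rewrite (distrC t); exact: lD.
  have h2 : (cabs Dt * cabs Ds)^-1 <= (c ^+ 2)^-1.
    rewrite lef_pV2 ?posrE//; last by rewrite mulr_gt0// (lt_le_trans c0).
    by rewrite expr2; apply: ler_pM => //; exact: ltW.
  apply: (@le_trans _ _ ((K * (1 + K) + K * K) * `|t - s| * (c ^+ 2)^-1)).
    by apply: ler_pM => //; rewrite invr_ge0 mulr_ge0.
  have -> : M * `|t - s| = K / c * `|t - s| + (K * (1 + K) + K * K) * `|t - s| * (c ^+ 2)^-1.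
    by rewrite /M; ring.
  by rewrite lerDr; exact: mulr_ge0.
have -> : G t - G s = (G t - H t) + ((H t - H s) - (G s - H s)) by ring.
apply: le_trans (ler_normD _ _) _; apply: le_trans (lerD (lexx _) (ler_normB _ _)) _.
have := GH t tT; have := GH s sT; move: Hlip.
move: (cabs (G t - H t)) (cabs (G s - H s)) (cabs (H t - H s)) => a1 a2 a3; lra.
Qed.

End LogDerivative.

(** * The Fejer kernel and its comparison integral *)

Section Fejer.
Variable R : realType.
Local Notation cabs z := (@Num.norm R (complex_Rcomplex__canonical__Num_SemiNormedZmodule R) z).
Implicit Types (la u v w t s x eta eps V : R).

Lemma derivable_continuous (f : R -> R) : (forall x, derivable f x 1) -> continuous f.
Proof. by move=> df x; apply/differentiable_continuous/derivable1_diffP. Qed.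

Lemma intg_opp a b (f : R -> R) : a <= b -> continuous f ->
  intg (- b) (- a) f = intg a b (fun x => f (- x)).
Proof.
move=> ab cf; rewrite /intg /Rintegral.
rewrite (@integration_by_substitution_oppr R f a b)//.
exact: continuous_subspaceT.
Qed.

Lemma expcos_lip s t x y : s <= 0 -> x <= 0 ->
  `|expR s * cos t - expR x * cos y| <= `|s - x| + `|t - y|.
Proof.
move=> s0 x0.
have h := @cexp_lip R (Complex s t) (Complex x y) s0 x0.
apply: le_trans (_ : cabs (cexp (Complex s t) - cexp (Complex x y)) <= _).
  have := Re_le_cnorm (cexp (Complex s t) - cexp (Complex x y)).
  by rewrite cReD cReN.
by apply: le_trans h _; apply: le_trans (cnorm_le _) _; rewrite cReD cImD cReN cImN.
Qed.

Lemma lipschitz_continuous (f : R -> R) L : (forall x y, `|f x - f y| <= L * `|x - y|) -> continuous f.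
Proof.
move=> h x; apply/cvgrPdist_le => e e0; near=> y.
apply: le_trans (h x y) _.
apply: (@le_trans _ _ ((`|L| + 1) * `|x - y|)).
  by apply: ler_wpM2r => //; have := ler_norm L; lra.
have L0 : 0 < `|L| + 1 by rewrite ltr_wpDl.
rewrite -ler_pdivlMl//; near: y.
apply: ((@cvgrPdist_le R R^o R (nbhs x) _ id x).1 cvg_id).
by rewrite mulr_gt0// invr_gt0.
Unshelve. all: by end_near. Qed.

(** Half the Fourier transform of the triangle function on [-la, la]. It is nonnegative by [fejerE].
    Its total mass, pi, is never evaluated: the central mass [fejer_mass] appears in the upper and
    in the lower bound and cancels up to the tails. *)
Definition fejer la u : R := intg 0 la (fun t => (1 - t / la) * cos (t * u)).

Lemma fejer_integrand_continuous la u : continuous (fun t => (1 - t / la) * cos (t * u)).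
Proof. by apply: derivable_continuous => t; exact: ex_derive. Qed.

Lemma fejerN la u : fejer la (- u) = fejer la u.
Proof. by apply: eq_intg => t _; rewrite mulrN cosN. Qed.

Section Kernel.
Variable la : R.
Hypothesis la0 : 0 < la.

Lemma taper_le1 t : 0 <= t <= la -> `|1 - t / la| <= 1.
Proof.
move=> /andP[t0 tl]; rewrite ger0_norm; first by rewrite gerBl divr_ge0// ltW.
by rewrite subr_ge0 ler_pdivrMr// mul1r.
Qed.

Lemma fejerE u : u != 0 -> fejer la u = (1 - cos (la * u)) / (la * u ^+ 2).
Proof.
move=> u0; have l0 : la != 0 by rewrite gt_eqF.
pose F t := (1 - t / la) * sin (t * u) / u - cos (t * u) / (la * u ^+ 2).
have dF t : is_derive t (1 : R) F ((1 - t / la) * cos (t * u)).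
  by apply: is_derive_eq; rewrite /GRing.scale/=; field; rewrite u0 l0.
rewrite /fejer (intg_FTC (ltW la0) (@fejer_integrand_continuous la u) dF) /F.
rewrite divff// subrr !mul0r sin0 cos0; field; by rewrite u0 l0.
Qed.

Lemma fejer_ge_lower u : `|u| <= la^-1 -> la / 4 <= fejer la u.
Proof.
move=> hu; have l0 : la != 0 by rewrite gt_eqF.
have -> : la / 4 = intg 0 la (fun t => 2^-1 * (1 - t / la)).
  pose F t := 2^-1 * (t - t ^+ 2 / (2 * la)).
  have dF t : is_derive t (1 : R) F (2^-1 * (1 - t / la)).
    by apply: is_derive_eq; rewrite /GRing.scale/=; field; rewrite l0.
  rewrite (intg_FTC (ltW la0) _ dF) /F; last first.
    by apply: derivable_continuous => t; exact: ex_derive.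
  by field; rewrite l0.
apply: intg_le; first by apply: derivable_continuous => t; exact: ex_derive.
  exact: fejer_integrand_continuous.
move=> t; rewrite in_itv/= => /andP[t0 tl]; rewrite mulrC ler_wpM2l//.
  by rewrite subr_ge0 ler_pdivrMr// mul1r.
have := one_sub_cos_le (t * u).
have h : `|t * u| <= 1.
  rewrite normrM (ger0_norm t0); apply: (@le_trans _ _ (la * la^-1)); last by rewrite divff.
  exact: ler_pM.
have : (t * u) ^+ 2 <= 1 by rewrite -real_normK ?num_real// expr_le1.
lra.
Qed.

Lemma fejer_ge0 u : 0 <= fejer la u.
Proof.
have [->|u0] := eqVneq u 0.
  apply: le_trans (fejer_ge_lower _); first by rewrite divr_ge0// ltW.
  by rewrite normr0 invr_ge0 ltW.
by rewrite fejerE// divr_ge0 ?subr_ge0 ?cos_le1// mulr_ge0 ?sqr_ge0// ltW.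
Qed.

Lemma fejer_tail u : u != 0 -> fejer la u <= 2 / la / u ^+ 2.
Proof.
move=> u0; rewrite fejerE// invfM mulrA.
apply: ler_wpM2r; first by rewrite invr_ge0 sqr_ge0.
apply: ler_wpM2r; first by rewrite invr_ge0 ltW.
by have := cos_geN1 (la * u); lra.
Qed.

Lemma fejer_lip u v : `|fejer la u - fejer la v| <= la ^+ 2 * `|u - v|.
Proof.
rewrite /fejer -intgB; [|exact: fejer_integrand_continuous..].
have -> : la ^+ 2 * `|u - v| = (la * `|u - v|) * (la - 0) by ring.
apply: intg_norm_le; first exact: ltW.
  by apply: derivable_continuous => t; exact: ex_derive.
move=> t; rewrite in_itv/= => /andP[t0 tl]; rewrite -mulrBr normrM.
have := @expcos_lip 0 (t * u) 0 (t * v) (lexx _) (lexx _).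
rewrite expR0 !mul1r subrr normr0 add0r -mulrBr normrM (ger0_norm t0) => h.
have h1 : `|1 - t / la| <= 1 by rewrite taper_le1 ?t0.
rewrite -[leRHS]mul1r; apply: ler_pM => //; apply: le_trans h _.
exact: ler_wpM2r.
Qed.

Lemma fejer_continuous : continuous (fejer la).
Proof. by apply: (@lipschitz_continuous _ (la ^+ 2)); exact: fejer_lip. Qed.

Lemma fejer_shift_continuous w : continuous (fun v => fejer la (v - w)).
Proof.
move=> v; apply: (@continuous_comp _ _ _ (fun v => v - w) (fejer la)); last exact: fejer_continuous.
by apply: derivable_continuous => x; exact: ex_derive.
Qed.

Lemma exp_fejer_continuous eps w : continuous (fun v => expR (- eps * v) * fejer la (v - w)).
Proof.
move=> v; apply: (@continuousM R R^o (fun v => expR (- eps * v)) (fun v => fejer la (v - w))).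
  by apply: derivable_continuous => x; exact: ex_derive.
exact: fejer_shift_continuous.
Qed.

Definition fejer_mass eta : R := intg (- eta) eta (fejer la).

Lemma intg_fejer_sub a b c d : c <= a -> a <= b -> b <= d ->
  intg a b (fejer la) <= intg c d (fejer la).
Proof.
move=> ca ab bd; have cf := fejer_continuous.
rewrite (intg_cat ca (le_trans ab bd) cf) (intg_cat ab bd cf).
have pos x y : 0 <= intg x y (fejer la) by apply: Rintegral_ge0 => z _; exact: fejer_ge0.
by have := pos c a; have := pos b d; lra.
Qed.

(** A lower bound free of [la], so that absolute errors in the kernel integrals are also relative to
    the mass. *)
Lemma fejer_mass_ge eta : la^-1 <= eta -> 2^-1 <= fejer_mass eta.
Proof.
move=> le; have lV : 0 < la^-1 by rewrite invr_gt0.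
apply: le_trans (_ : intg (- la^-1) la^-1 (fejer la) <= _); last first.
  by apply: intg_fejer_sub; lra.
have -> : 2^-1 = intg (- la^-1) la^-1 (fun=> la / 4).
  by rewrite intg_cst; [field; rewrite gt_eqF|lra].
apply: intg_le; [by move=> x; exact: cvg_cst|exact: fejer_continuous|].
by move=> x; rewrite in_itv/= => hx; apply: fejer_ge_lower; rewrite ler_norml.
Qed.

(** Beyond distance [eta] the kernel is at most 2 / (la u^2), and each of the two tails integrates
    to at most 2 / (la eta). *)
Lemma intg_fejer_le eta a b : 0 < eta -> a <= b ->
  intg a b (fejer la) <= fejer_mass eta + 4 / (la * eta).
Proof.
move=> eta0 ab; have cf := fejer_continuous.
pose X := eta + `|a| + `|b|.
have Xe : eta <= X by rewrite /X -addrA lerDl addr_ge0.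
have := ler_norm (- a); have := ler_norm b; rewrite normrN => hb ha.
have nb := normr_ge0 b; have na := normr_ge0 a.
apply: le_trans (_ : intg (- X) X (fejer la) <= _).
  by apply: intg_fejer_sub => //; rewrite /X; lra.
have tail : intg eta X (fejer la) <= 2 / la / eta.
  apply: intg_tail_le => // [x ex|]; last by rewrite divr_ge0// ltW.
  by apply: fejer_tail; rewrite gt_eqF// (lt_le_trans eta0).
rewrite (@intg_cat _ (- X) (- eta) X)//; [|lra|lra].
rewrite (@intg_cat _ (- eta) eta X)//; [|lra].
rewrite intg_opp//.
have -> : intg eta X (fun x => fejer la (- x)) = intg eta X (fejer la).
  by apply: eq_intg => x _; rewrite fejerN.
have -> : 4 / (la * eta) = 2 / la / eta + 2 / la / eta by field; rewrite !gt_eqF.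
rewrite /fejer_mass; lra.
Qed.

Lemma intg_fejer_shift w a b : a <= b ->
  intg a b (fun v => fejer la (v - w)) = intg (a - w) (b - w) (fejer la).
Proof. by move=> ab; rewrite (intg_shift (- w) ab fejer_continuous). Qed.

(* The integral of expR (- eps * v) * fejer la (v - w) over v >= 0, with the order of
   integration exchanged. *)
Definition comparison eps w : R := intg 0 la
  (fun t => (1 - t / la) * ((eps * cos (t * w) + t * sin (t * w)) / (eps ^+ 2 + t ^+ 2))).

Section Comparison.
Variables (eps w : R).
Hypotheses (eps0 : 0 < eps) (w0 : 0 <= w).

Let q0 t : 0 < eps ^+ 2 + t ^+ 2.
Proof. by rewrite ltr_pwDl ?exprn_gt0 ?sqr_ge0. Qed.

Let quot_derivable (f : R -> R) t : derivable f t 1 -> derivable (fun t => f t / (eps ^+ 2 + t ^+ 2)) t 1.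
Proof.
move=> df; apply: derivableM; first exact: df.
apply: derivableV; first by rewrite gt_eqF ?q0.
exact: ex_derive.
Qed.

Let f t v := (1 - t / la) * (expR (- eps * v) * cos (t * (v - w))).
Let F t v := (1 - t / la) * (expR (- eps * v) *
  (- eps * cos (t * (v - w)) + t * sin (t * (v - w)))) / (eps ^+ 2 + t ^+ 2).

(** [F] is the antiderivative in v and tends to 0 at infinity, so [comparison] is the integral of
    [- F t 0], the full half-line integral. After [intg_swap] only the boundary term at V
    remains. *)
Lemma comparison_approx V : 0 <= V ->
  `|comparison eps w - intg 0 V (fun v => expR (- eps * v) * fejer la (v - w))| <=
  expR (- eps * V) * (2 * la ^+ 2 / eps ^+ 2 + 2 * la / eps).
Proof.
move=> V0; have l0 : la != 0 by rewrite gt_eqF.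
have cf1 t : continuous (f t).
  by apply: derivable_continuous => v; exact: ex_derive.
have cf2 v : continuous (f^~ v).
  by apply: derivable_continuous => t; exact: ex_derive.
have cF v : continuous (F^~ v).
  by apply: derivable_continuous => t; apply: quot_derivable; exact: ex_derive.
have dF t v : is_derive v (1 : R) (F t) (f t v).
  apply: is_derive_eq; rewrite /GRing.scale/= /f; field.
  by rewrite l0 gt_eqF ?q0.
have fint v : intg 0 la (f^~ v) = expR (- eps * v) * fejer la (v - w).
  rewrite -intgZ; last exact: fejer_integrand_continuous.
  by apply: eq_intg => t _; rewrite /f; ring.
have ci : continuous (fun v => intg 0 la (f^~ v)).
  by under eq_fun do rewrite fint; exact: exp_fejer_continuous.
have lip t v v' : t \in `[0, la] -> 0 <= v -> 0 <= v' -> `|f t v - f t v'| <= (eps + la) * `|v - v'|.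
  rewrite in_itv/= => /andP[t0 tl] v0 v'0; rewrite /f -mulrBr normrM.
  have h1 : `|1 - t / la| <= 1 by rewrite taper_le1 ?t0.
  have e1 (x : R) : 0 <= x -> - eps * x <= 0 by move=> x0; rewrite mulNr oppr_le0 mulr_ge0// ltW.
  have := @expcos_lip (- eps * v) (t * (v - w)) (- eps * v') (t * (v' - w)) (e1 v v0) (e1 v' v'0).
  rewrite -!mulrBr !normrM normrN (gtr0_norm eps0) (ger0_norm t0).
  have -> : v - w - (v' - w) = v - v' by ring.
  move=> h; rewrite -[leRHS]mul1r; apply: ler_pM => //; apply: le_trans h _.
  by rewrite -mulrDl ler_wpM2r// lerD2l.
have Lge : 0 <= eps + la by rewrite addr_ge0 ?ltW.
have := intg_swap (ltW la0) Lge V0 cf1 cf2 cF dF ci lip.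
under [in X in _ = X -> _]eq_fun do rewrite fint.
move=> <-.
have -> : comparison eps w = intg 0 la (fun t => - F t 0).
  apply: eq_intg => t _; rewrite /F mulr0 expR0 mul1r sub0r mulrN cosN sinN.
  ring.
rewrite -intgB; [|by move=> t; apply: (@cvgN R R^o); exact: cF
  |by move=> t; apply: (@cvgB R R^o); exact: cF].
have -> : expR (- eps * V) * (2 * la ^+ 2 / eps ^+ 2 + 2 * la / eps) =
   expR (- eps * V) * (2 * la / eps ^+ 2 + 2 / eps) * (la - 0) by field; rewrite gt_eqF.
apply: intg_norm_le; first exact: ltW.
  move=> t; apply: (@cvgB R R^o); first by apply: (@cvgN R R^o); exact: cF.
  by apply: (@cvgB R R^o); exact: cF.
move=> t; rewrite in_itv/= => /andP[t0 tl].
have -> : - F t 0 - (F t V - F t 0) = - F t V by ring.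
have -> : F t V = expR (- eps * V) * ((1 - t / la) *
    ((- eps * cos (t * (V - w)) + t * sin (t * (V - w))) * (eps ^+ 2 + t ^+ 2)^-1)).
  by rewrite /F; ring.
rewrite normrN normrM (ger0_norm (expR_ge0 _)).
apply: ler_wpM2l; first exact: expR_ge0.
have h1 : `|1 - t / la| <= 1 by rewrite taper_le1 ?t0.
rewrite normrM -[leRHS]mul1r; apply: ler_pM => //.
rewrite normrM.
have h2 : `|- eps * cos (t * (V - w)) + t * sin (t * (V - w))| <= eps + la.
  apply: le_trans (ler_normD _ _) _; rewrite !normrM normrN (gtr0_norm eps0) (ger0_norm t0).
  by apply: lerD; rewrite -[leRHS]mulr1; apply: ler_pM => //; rewrite ?cos_max ?sin_max// ltW.
have h3 : `|(eps ^+ 2 + t ^+ 2)^-1| <= (eps ^+ 2)^-1.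
  rewrite ger0_norm; last by rewrite invr_ge0 ltW ?q0.
  by rewrite lef_pV2 ?posrE ?exprn_gt0 ?q0// lerDl sqr_ge0.
apply: (@le_trans _ _ ((eps + la) * (eps ^+ 2)^-1)); first exact: ler_pM.
have -> : 2 * la / eps ^+ 2 + 2 / eps = (eps + la) * (eps ^+ 2)^-1 + (eps + la) * (eps ^+ 2)^-1.
  by field; rewrite gt_eqF.
rewrite lerDl mulr_ge0// invr_ge0 sqr_ge0//.
Qed.

(** Besides making the boundary term small, V exceeds 2 w, hence w + eta when eta <= w: the central
    window of the kernel lies inside [0, V]. *)
Let small e : 0 < e -> exists2 V, 2 * w + e <= V & expR (- eps * V) * (2 * la ^+ 2 / eps ^+ 2 + 2 * la / eps) <= e.
Proof.
move=> e0; set Q := 2 * la ^+ 2 / eps ^+ 2 + 2 * la / eps.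
have Q0 : 0 < Q by rewrite /Q addr_gt0// divr_gt0// ?mulr_gt0// exprn_gt0.
pose V0 := eps^-1 * ln (Q / e).
exists (2 * w + e + `|V0|); first by rewrite lerDl.
have : V0 <= 2 * w + e + `|V0| by have := ler_norm V0; have := w0; lra.
move=> h; rewrite -ler_pdivlMr// -[leRHS]lnK ?posrE ?divr_gt0// ler_expR.
rewrite -[e / Q]invf_div lnV ?posrE ?divr_gt0// mulNr lerN2.
by rewrite -(ler_pdivrMl _ _ eps0).
Qed.

Lemma comparison_le eta : 0 < eta -> comparison eps w <= fejer_mass eta + 4 / (la * eta).
Proof.
move=> eta0; apply/ler_addgt0Pr => e e0; have [V wV hV] := small e0.
have V0 : 0 <= V by have := w0; lra.
have := comparison_approx V0; rewrite ler_norml => /andP[_ h].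
have cs := @fejer_shift_continuous w.
have : intg 0 V (fun v => expR (- eps * v) * fejer la (v - w)) <= fejer_mass eta + 4 / (la * eta).
  apply: (@le_trans _ _ (intg 0 V (fun v => fejer la (v - w)))).
    apply: intg_le; [exact: exp_fejer_continuous|exact: cs|].
    move=> v; rewrite in_itv/= => /andP[v0 _]; rewrite ler_piMl ?fejer_ge0//.
    by rewrite expR_le1 mulNr oppr_le0 mulr_ge0// ltW.
  rewrite intg_fejer_shift//; apply: intg_fejer_le => //; lra.
lra.
Qed.

Lemma comparison_ge eta : 0 < eta -> eta <= w ->
  expR (- eps * (w + eta)) * fejer_mass eta <= comparison eps w.
Proof.
move=> eta0 ew; apply/ler_addgt0Pr => e e0; have [V wV hV] := small e0.
have V0 : 0 <= V by have := w0; lra.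
have := comparison_approx V0; rewrite ler_norml => /andP[h _].
have cs := @fejer_shift_continuous w.
have cp := @exp_fejer_continuous eps w.
have : expR (- eps * (w + eta)) * fejer_mass eta <= intg 0 V (fun v => expR (- eps * v) * fejer la (v - w)).
  have c1 : 0 <= w - eta by lra.
  have c2 : w - eta <= w + eta by lra.
  have c3 : w + eta <= V by lra.
  rewrite (intg_cat c1 (le_trans c2 c3) cp) (intg_cat c2 c3 cp).
  have pos x y : 0 <= intg x y (fun v => expR (- eps * v) * fejer la (v - w)).
    by apply: Rintegral_ge0 => z _; rewrite mulr_ge0 ?expR_ge0 ?fejer_ge0.
  have e1 : fejer_mass eta = intg (w - eta) (w + eta) (fun v => fejer la (v - w)).
    have c4 : w - eta <= w + eta by [].
    by rewrite (intg_fejer_shift w c4) /fejer_mass; congr (intg _ _ _); ring.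
  have : expR (- eps * (w + eta)) * fejer_mass eta <=
      intg (w - eta) (w + eta) (fun v => expR (- eps * v) * fejer la (v - w)).
    rewrite e1 -(intgZ _ _ _ cs); apply: intg_le; [|exact: cp|].
      by move=> v; apply: (@continuousM R R^o (cst (expR (- eps * (w + eta)))) (fun v => fejer la (v - w))); [exact: cvg_cst|exact: cs].
    move=> v; rewrite in_itv/= => /andP[_ v2]; rewrite ler_wpM2r ?fejer_ge0// ler_expR.
    by rewrite !mulNr lerN2 ler_wpM2l// ltW.
  by have := pos 0 (w - eta); have := pos (w + eta) V; lra.
lra.
Qed.

End Comparison.
End Kernel.
End Fejer.

(** * Kernel sums of the von Mangoldt weights *)

Section Tauberian.
Variable R : realType.
Local Notation C := (Rcomplex R).
Local Notation Re := (@complex.Re R).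
Local Notation Im := (@complex.Im R).
Local Notation wgt n := (vonMangoldt R n / n%:R).
Implicit Types (la w t s x eta eps e : R) (n N M : nat).

Lemma intg_period (phi Phi : R -> R) w a : 0 < w ->
  continuous phi -> (forall t, is_derive t (1 : R) Phi (w * phi (t * w))) ->
  (forall t, Phi (t + pi *+ 2 / w) = Phi t) ->
  intg a (a + pi *+ 2 / w) (fun t => phi (t * w)) = 0.
Proof.
move=> w0 cphi dPhi per; have w_neq0 : w != 0 by rewrite gt_eqF.
have c1 : continuous (fun t => phi (t * w)).
  move=> t; apply: (@continuous_comp _ _ _ (fun t => t * w) phi); last exact: cphi.
  by apply: derivable_continuous => x; exact: ex_derive.
have dF t : is_derive t (1 : R) (fun t => w^-1 * Phi t) (phi (t * w)).
  have := dPhi t => ?; apply: is_derive_eq; rewrite /GRing.scale/=; field; exact: w_neq0.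
rewrite (@intg_FTC _ _ _ _ (fun t => w^-1 * Phi t))//.
  by rewrite per subrr.
rewrite lerDl; apply: divr_ge0; last exact: ltW.
by apply: mulrn_wge0; exact: pi_ge0.
Qed.

Lemma Re_inv z : Re z^-1 = Re z / (Re z ^+ 2 + Im z ^+ 2). Proof. by case: z. Qed.
Lemma Im_inv z : Im z^-1 = - (Im z / (Re z ^+ 2 + Im z ^+ 2)). Proof. by case: z. Qed.

Lemma Re_Lsum N x t : Re (Lsum N (Complex x t)) =
  \sum_(1 <= n < N) wgt n * expR (ln n%:R * x) * cos (ln n%:R * t).
Proof.
rewrite /Lsum Re_sum; apply: eq_bigr => n _.
by rewrite Re_rcM /npow /cexp/= !mul0r !subr0 !addr0 mulrA.
Qed.

Lemma Im_Lsum N x t : Im (Lsum N (Complex x t)) =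
  \sum_(1 <= n < N) wgt n * expR (ln n%:R * x) * sin (ln n%:R * t).
Proof.
rewrite /Lsum Im_sum; apply: eq_bigr => n _.
by rewrite Im_rcM /npow /cexp/= !mul0r !subr0 !addr0 mulrA.
Qed.

(** The difference is the integral of the triangle weight against Re (G e^(-i t w)), with G = L +
    1/z at z = -eps + i t; the real and imaginary parts of 1/z produce [comparison].
    Riemann-Lebesgue over the period 2 pi / w gives K / w, with K independent of eps because the
    bounds of [logder_approx] are. *)
Lemma fejer_sum_comparison la : 0 < la -> exists2 K : R, 0 <= K &
  forall eps, 0 < eps -> eps <= 1 -> forall e, 0 < e -> exists2 N0, (0 < N0)%N &
  forall N w, (N0 <= N)%N -> 0 < w ->
  `|\sum_(1 <= n < N) wgt n * expR (ln n%:R * - eps) * fejer la (ln n%:R - w)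
    - comparison la eps w| <= K / w + e.
Proof.
move=> la0; have [M M0 hM] := logder_approx (ltW la0).
have l0 : la != 0 by rewrite gt_eqF.
pose L := M + (M + 1) / la.
have L0 : 0 <= L by apply: addr_ge0 => //; apply: divr_ge0; [lra|exact: ltW].
exists (2 * (pi *+ 2) * (L * la + (M + 1))) => [|eps eps0 eps1 e e0].
  have p0 : 0 <= pi *+ 2 :> R by apply: mulrn_wge0; exact: pi_ge0.
  by apply: mulr_ge0; [exact: mulr_ge0|apply: addr_ge0; [apply: mulr_ge0 => //; exact: ltW|lra]].
pose e' := Num.min 1 (e / (2 * la)).
have e'0 : 0 < e' by rewrite lt_min ltr01 divr_gt0// mulr_gt0.
have e'1 : e' <= 1 by rewrite ge_min lexx.
have e'e : 2 * (e' * la) <= e.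
  have : e' <= e / (2 * la) by rewrite ge_min lexx orbT.
  rewrite ler_pdivlMr ?mulr_gt0//; lra.
have [N0 N00 hN] := hM eps eps0 eps1 e' e'0.
exists N0 => // N w NN w0; have [Gb Glip] := hN N NN.
pose G t : C := Lsum N (Complex (- eps) t) + (Complex (- eps) t)^-1.
pose a t : R := \sum_(1 <= n < N) wgt n * expR (ln n%:R * - eps) * cos (ln n%:R * t)
  - eps / (eps ^+ 2 + t ^+ 2).
pose b t : R := \sum_(1 <= n < N) wgt n * expR (ln n%:R * - eps) * sin (ln n%:R * t)
  - t / (eps ^+ 2 + t ^+ 2).
have aG t : a t = Re (G t) by rewrite /G cReD Re_Lsum Re_inv/= sqrrN mulNr.
have bG t : b t = Im (G t) by rewrite /G cImD Im_Lsum Im_inv/= sqrrN.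
have q0 t : 0 < eps ^+ 2 + t ^+ 2 by rewrite ltr_pwDl ?exprn_gt0 ?sqr_ge0.
have quotc (f : R -> R) : continuous f -> continuous (fun t => f t / (eps ^+ 2 + t ^+ 2)).
  move=> cf t; apply: (@continuousM R R^o f (fun t => (eps ^+ 2 + t ^+ 2)^-1)); first exact: cf.
  apply: derivable_continuous => x; apply: derivableV; first by rewrite gt_eqF ?q0.
  exact: ex_derive.
have ca : continuous a.
  move=> t; apply: (@cvgB R R^o); last by apply: quotc => x; exact: cvg_cst.
  by apply: continuous_sum => n; apply: derivable_continuous => x; exact: ex_derive.
have cb : continuous b.
  move=> t; apply: (@cvgB R R^o); last by apply: quotc => x; exact: cvg_id.
  by apply: continuous_sum => n; apply: derivable_continuous => x; exact: ex_derive.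
have cl : continuous (fun t => 1 - t / la).
  by apply: derivable_continuous => x; exact: ex_derive.
have cw (f : R -> R) : continuous f -> continuous (fun t => f (t * w)).
  move=> cf t; apply: (@continuous_comp _ _ _ (fun t => t * w) f); last exact: cf.
  by apply: derivable_continuous => x; exact: ex_derive.
have cg (f : R -> R) : continuous f -> continuous (fun t => (1 - t / la) * f t).
  by move=> cf t; apply: (@continuousM R R^o (fun t => 1 - t / la) f); [exact: cl|exact: cf].
have cg2 (f g : R -> R) : continuous f -> continuous g ->
    continuous (fun t => (1 - t / la) * f t * g (t * w)).
  move=> cf cgg t; apply: (@continuousM R R^o (fun t => (1 - t / la) * f t) (fun t => g (t * w))).
    exact: cg.
  exact: cw.
have -> : \sum_(1 <= n < N) wgt n * expR (ln n%:R * - eps) * fejer la (ln n%:R - w)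
    - comparison la eps w =
  intg 0 la (fun t => (1 - t / la) * a t * cos (t * w)) +
  intg 0 la (fun t => (1 - t / la) * b t * sin (t * w)).
  rewrite -intgD; [|exact: cg2 ca (@continuous_cos R)|exact: cg2 cb (@continuous_sin R)].
  have cfi n : continuous (fun t => wgt n * expR (ln n%:R * - eps) * ((1 - t / la) * cos (t * (ln n%:R - w)))).
    by apply: derivable_continuous => x; exact: ex_derive.
  transitivity (intg 0 la (fun t => \sum_(1 <= n < N) wgt n * expR (ln n%:R * - eps) * ((1 - t / la) * cos (t * (ln n%:R - w)))) - comparison la eps w).
    congr (_ - _); rewrite intg_sum ?ltW//; apply: eq_bigr => n _.
    by rewrite intgZ//; exact: fejer_integrand_continuous.
  rewrite /comparison -intgB; last 2 first.
  - exact: continuous_sum.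
  - apply: cg; apply: quotc.
    by apply: derivable_continuous => x; exact: ex_derive.
  apply: eq_intg => t _.
  have -> : \sum_(1 <= n < N) wgt n * expR (ln n%:R * - eps) * ((1 - t / la) * cos (t * (ln n%:R - w))) =
     (1 - t / la) * (\sum_(1 <= n < N) wgt n * expR (ln n%:R * - eps) * cos (ln n%:R * t)) * cos (t * w) +
     (1 - t / la) * (\sum_(1 <= n < N) wgt n * expR (ln n%:R * - eps) * sin (ln n%:R * t)) * sin (t * w).
    rewrite !mulr_sumr !mulr_suml -big_split/=; apply: eq_bigr => n _.
    by rewrite mulrBr cosB (mulrC t (ln _)); ring.
  by rewrite /a /b; ring.
have p0 : 0 < pi *+ 2 / w by rewrite divr_gt0// mulrn_wgt0// pi_gt0.
have gb (f : R -> R) : (forall t, `|t| <= la -> `|f t| <= M + 1) ->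
    {in `[0, la], forall t, `|(1 - t / la) * f t| <= M + 1}.
  move=> fb t; rewrite in_itv/= => /andP[t0 tl].
  have h1 : `|1 - t / la| <= 1 by rewrite taper_le1 ?t0.
  rewrite normrM -[leRHS]mul1r; apply: ler_pM => //.
  by apply: fb; rewrite ger0_norm.
have glip (f : R -> R) : (forall t, `|t| <= la -> `|f t| <= M + 1) ->
    (forall t s, `|t| <= la -> `|s| <= la -> `|f t - f s| <= M * `|t - s| + e') ->
    {in `[0, la] &, forall t s, `|(1 - t / la) * f t - (1 - s / la) * f s| <= L * `|t - s| + e'}.
  move=> fb fl t s; rewrite !in_itv/= => /andP[t0 tl] /andP[s0 sl].
  have h1 : `|1 - t / la| <= 1 by rewrite taper_le1 ?t0.
  have -> : (1 - t / la) * f t - (1 - s / la) * f s = (1 - t / la) * (f t - f s) - (t - s) * (f s / la) by ring.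
  apply: le_trans (ler_normB _ _) _; rewrite !normrM normfV (gtr0_norm la0).
  have h2 : `|f t - f s| <= M * `|t - s| + e' by apply: fl; rewrite ger0_norm.
  have h3 : `|f s| <= M + 1 by apply: fb; rewrite ger0_norm.
  have h4 : `|1 - t / la| * `|f t - f s| <= 1 * (M * `|t - s| + e') by apply: ler_pM.
  have h5 : `|t - s| * (`|f s| / la) <= `|t - s| * ((M + 1) / la).
    by apply: ler_wpM2l => //; apply: ler_wpM2r => //; rewrite invr_ge0 ltW.
  rewrite /L mulrDl; lra.
have abd t : `|t| <= la -> `|a t| <= M + 1.
  move=> tl; rewrite aG; apply: le_trans (Re_le_cnorm _) _; apply: le_trans (Gb t tl) _; lra.
have bbd t : `|t| <= la -> `|b t| <= M + 1.
  move=> tl; rewrite bG; apply: le_trans (Im_le_cnorm _) _; apply: le_trans (Gb t tl) _; lra.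
have alip t s : `|t| <= la -> `|s| <= la -> `|a t - a s| <= M * `|t - s| + e'.
  move=> tl sl; rewrite !aG -cReN -cReD; apply: le_trans (Re_le_cnorm _) _; exact: Glip.
have blip t s : `|t| <= la -> `|s| <= la -> `|b t - b s| <= M * `|t - s| + e'.
  move=> tl sl; rewrite !bG -cImN -cImD; apply: le_trans (Im_le_cnorm _) _; exact: Glip.
have M1 : 0 <= M + 1 by lra.
have percos c : 0 <= c -> intg c (c + pi *+ 2 / w) (fun t => cos (t * w)) = 0.
  move=> _; apply: (@intg_period cos (fun t => sin (t * w))) => //; first exact: continuous_cos.
    by move=> t; apply: is_derive_eq; rewrite /GRing.scale/=; ring.
  by move=> t; rewrite mulrDl divfK ?gt_eqF// sinD2pi.
have persin c : 0 <= c -> intg c (c + pi *+ 2 / w) (fun t => sin (t * w)) = 0.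
  move=> _; apply: (@intg_period sin (fun t => - cos (t * w))) => //; first exact: continuous_sin.
    by move=> t; apply: is_derive_eq; rewrite /GRing.scale/=; ring.
  by move=> t; rewrite mulrDl divfK ?gt_eqF// cosD2pi.
have h1 := riemann_lebesgue (ltW la0) p0 L0 (ltW e'0) M1 (cg a ca) (cw cos (@continuous_cos R))
  (fun t => cos_max (t * w)) percos (gb a abd) (glip a abd alip).
have h2 := riemann_lebesgue (ltW la0) p0 L0 (ltW e'0) M1 (cg b cb) (cw sin (@continuous_sin R))
  (fun t => sin_max (t * w)) persin (gb b bbd) (glip b bbd blip).
apply: le_trans (ler_normD _ _) _; apply: le_trans (lerD h1 h2) _.
have -> : 2 * (pi *+ 2) * (L * la + (M + 1)) / w = 2 * (L * (pi *+ 2 / w) * la + (M + 1) * (pi *+ 2 / w)) by ring.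
lra.
Qed.

(** For a finite sum the damping can be removed: 1 - n^(-eps) <= eps ln M for n < M, with eps chosen
    after M. Nonnegativity of the terms then allows the sum to be extended up to the N required by
    the comparison. *)
Lemma fejer_sum_le la : 0 < la -> exists2 K : R, 0 <= K &
  forall M w eta, 0 < w -> 0 < eta ->
  \sum_(1 <= n < M) wgt n * fejer la (ln n%:R - w) <= fejer_mass la eta + 4 / (la * eta) + K / w.
Proof.
move=> la0; have [K K0 hK] := fejer_sum_comparison la0.
exists K => // M w eta w0 eta0; apply/ler_addgt0Pr => e e0.
set S := \sum_(_ <= _ < _) _.
have term0 n : (0 < n)%N -> 0 <= wgt n * fejer la (ln n%:R - w).
  by move=> n0; have /andP[v0 _] := vonMangoldt_bounds R n0; rewrite mulr_ge0 ?fejer_ge0// mulr_ge0.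
have S0 : 0 <= S by rewrite /S big_nat_cond sumr_ge0// => n /andP[/andP[n0 _] _]; exact: term0.
have lM : 0 <= ln M%:R :> R by exact: ln_ge0_nat.
pose eps := Num.min 1 (e / 2 / (1 + ln M%:R * S)).
have d0 : 0 < 1 + ln M%:R * S by rewrite ltr_wpDr// mulr_ge0.
have eps0 : 0 < eps by rewrite lt_min ltr01 !divr_gt0.
have eps1 : eps <= 1 by rewrite ge_min lexx.
have epse : eps * (ln M%:R * S) <= e / 2.
  have h : eps <= e / 2 / (1 + ln M%:R * S) by rewrite ge_min lexx orbT.
  have : eps * (1 + ln M%:R * S) <= e / 2 by rewrite -ler_pdivlMr.
  lra.
have e2 : 0 < e / 2 by rewrite divr_gt0.
have [N0 N00 hN] := hK eps eps0 eps1 _ e2.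
pose N := maxn M N0.
have := hN N w (leq_maxr _ _) w0; rewrite ler_norml => /andP[_ h1].
have h2 := comparison_le la0 eps0 (ltW w0) eta0.
have h3 : S - eps * (ln M%:R * S) <=
   \sum_(1 <= n < N) wgt n * expR (ln n%:R * - eps) * fejer la (ln n%:R - w).
  apply: (@le_trans _ _ (\sum_(1 <= n < M) wgt n * expR (ln n%:R * - eps) * fejer la (ln n%:R - w))).
    rewrite mulrA /S mulr_sumr -sumrB.
    apply: ler_sum_nat => n /andP[n0 nM]; have t0 := term0 n n0.
    rewrite [leRHS]mulrAC; move: t0; set q := wgt n * fejer la _ => t0.
    have -> : q - eps * ln M%:R * q = q * (1 - ln M%:R * eps) by ring.
    apply: ler_wpM2l => //; apply: le_trans (expR_ge1Dx _).
    rewrite mulrN lerD2l lerN2; apply: ler_wpM2r; first exact: ltW.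
    by rewrite ler_ln ?posrE ?ltr0n ?(leq_trans n0)// ?ler_nat ltnW.
  case: (posnP M) => [->|M1].
    rewrite big_geq// big_nat_cond sumr_ge0// => n /andP[/andP[n0 _] _].
    by rewrite mulrAC mulr_ge0 ?term0 ?expR_ge0.
  rewrite [leRHS](big_cat_nat M1 (leq_maxl M N0))/= lerDl big_nat_cond sumr_ge0// => n /andP[/andP[n0 _] _].
  by rewrite mulrAC mulr_ge0 ?expR_ge0// term0// (leq_trans M1).
lra.
Qed.

End Tauberian.

(** * Von Mangoldt weights in short logarithmic windows *)

Section Windows.
Variable R : realType.
Local Notation wgt n := (vonMangoldt R n / n%:R).
Implicit Types (la u v w t s x y eta eps e de V G T W : R) (n N M k : nat).

Lemma wgt_ge0 n : (0 < n)%N -> 0 <= wgt n.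
Proof. by move=> n0; have /andP[v0 _] := vonMangoldt_bounds R n0; rewrite mulr_ge0. Qed.

(* The shift by pi makes the zeros of the two kernels disjoint. *)
Lemma fejer_shift_pi_ge u : (1 + u ^+ 2)^-1 <= 16 * (fejer 1 u + fejer 1 (u + pi)).
Proof.
have U0 : 0 < 1 + u ^+ 2 by rewrite ltr_pwDl// sqr_ge0.
have pi4 : (pi : R) <= 4 by have := pihalf_lt2 R; lra.
have pi0 := pi_ge0 R.
have key v : v ^+ 2 <= 32 * (1 + u ^+ 2) -> 1 - cos v <= 32 * (1 + u ^+ 2) * fejer 1 v.
  have [->|v0] := eqVneq v 0.
    by rewrite cos0 subrr => _; rewrite !mulr_ge0 ?fejer_ge0// ltW.
  move=> hv; rewrite fejerE// !mul1r mulrA ler_pdivlMr; last by rewrite exprn_even_gt0.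
  rewrite mulrC ler_wpM2r// subr_ge0 cos_le1//.
have h1 := key u; have h2 := key (u + pi).
have {}h1 : 1 - cos u <= 32 * (1 + u ^+ 2) * fejer 1 u.
  by apply: h1; have := sqr_ge0 u; lra.
have {}h2 : 1 + cos u <= 32 * (1 + u ^+ 2) * fejer 1 (u + pi).
  have -> : 1 + cos u = 1 - cos (u + pi) by rewrite cosDpi opprK.
  apply: h2; have : (pi : R) ^+ 2 <= 16.
    by have -> : 16 = 4 ^+ 2 :> R; [ring|rewrite lerXn2r ?nnegrE].
  move: (pi : R) => p hp; have := sqr_ge0 (u - p); have := sqr_ge0 u.
  have -> : (u - p) ^+ 2 = 2 * u ^+ 2 + 2 * p ^+ 2 - (u + p) ^+ 2 by ring.
  by move: (u ^+ 2) (p ^+ 2) hp ((u + p) ^+ 2) => a b hb c; lra.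
rewrite -[leLHS]div1r ler_pdivrMr//; move: h1 h2.
move: (fejer 1 u) (fejer 1 (u + pi)) (1 + u ^+ 2) (cos u) => A B W c h1 h2.
have -> : 16 * (A + B) * W = (32 * W * A + 32 * W * B) / 2 by field.
by lra.
Qed.

(** Controls the primes far from w when the kernel is sharpened. The bound 5 guarantees w - pi >= 1,
    as pi <= 4, so that K / (w - pi) is at most K. *)
Lemma vonMangoldt_localized : exists2 K : R, 0 <= K & forall M w, 5 <= w ->
  \sum_(1 <= n < M) wgt n * (1 + (ln n%:R - w) ^+ 2)^-1 <= K.
Proof.
have [K K0 hK] := fejer_sum_le (ltr01 : 0 < (1 : R)).
pose U := fejer_mass 1 1 + 4 / (1 * 1) + K.
have U0 : 0 <= U.
  by rewrite /U !addr_ge0//; apply: Rintegral_ge0 => z _; exact: fejer_ge0.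
exists (32 * U) => [|M w w5]; first by rewrite mulr_ge0.
have pi4 : (pi : R) <= 4 by have := pihalf_lt2 R; lra.
have bd v : 1 <= v -> \sum_(1 <= n < M) wgt n * fejer 1 (ln n%:R - v) <= U.
  move=> v1; apply: le_trans (hK M v 1 _ ltr01) _; first lra.
  by rewrite /U lerD2l ler_pdivrMr ?ler_peMr//; lra.
have h1 := bd w ltac:(lra); have h2 := bd (w - pi) ltac:(lra).
apply: (@le_trans _ _ (16 * (\sum_(1 <= n < M) wgt n * fejer 1 (ln n%:R - w) +
  \sum_(1 <= n < M) wgt n * fejer 1 (ln n%:R - (w - pi))))); last lra.
rewrite -big_split mulr_sumr.
apply: ler_sum_nat => n /andP[n0 _] /=.
rewrite -mulrDr mulrCA ler_wpM2l ?wgt_ge0//.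
have -> : ln n%:R - (w - pi) = ln n%:R - w + pi by ring.
exact: fejer_shift_pi_ge.
Qed.

Section Window.
Variables (la eta y de : R).
Hypotheses (la0 : 0 < la) (eta0 : 0 < eta).

Let P n := y <= ln n%:R <= y + de.

Let fejer_w l a b : a <= b ->
  intg a b (fun w => fejer la (l - w)) = intg (a - l) (b - l) (fejer la).
Proof.
move=> ab; rewrite -(intg_fejer_shift la0 l ab); apply: eq_intg => w _.
by rewrite -fejerN opprB.
Qed.

Let cfw (c l : R) : continuous (fun w => c * fejer la (l - w)).
Proof.
move=> w; apply: (@continuousM R R^o (cst c) (fun w => fejer la (l - w))); first exact: cvg_cst.
apply: (@continuous_comp _ _ _ (fun w => l - w) (fejer la)); last exact: fejer_continuous.
by apply: derivable_continuous => x; exact: ex_derive.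
Qed.

Let cfw1 (l : R) : continuous (fun w => fejer la (l - w)).
Proof.
have -> : (fun w => fejer la (l - w)) = (fun w => 1 * fejer la (l - w)).
  by apply/funext => w; rewrite mul1r.
exact: cfw.
Qed.

(** The kernel sum is averaged over centres w in the window enlarged by [eta] on both sides: every n
    of the window then receives at least the whole central mass. *)
Lemma window_upper M Q : 0 <= de -> eta < y ->
  (forall w, y - eta <= w -> \sum_(1 <= n < M) wgt n * fejer la (ln n%:R - w) <= Q) ->
  (\sum_(1 <= n < M | P n) wgt n) * fejer_mass la eta <= Q * (de + 2 * eta).
Proof.
move=> de0 ey hQ; have eta_gt0 := eta0.
have ab : y - eta <= y + de + eta by lra.
have -> : Q * (de + 2 * eta) = intg (y - eta) (y + de + eta) (fun=> Q).
  by rewrite intg_cst//; ring.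
apply: (@le_trans _ _ (intg (y - eta) (y + de + eta)
    (fun w => \sum_(1 <= n < M | P n) wgt n * fejer la (ln n%:R - w)))); last first.
  apply: intg_le; [by apply: continuous_sum => n; exact: cfw|by move=> w; exact: cvg_cst|].
  move=> w; rewrite in_itv/= => /andP[w1 _]; apply: le_trans (hQ w w1).
  rewrite big_mkcond/=.
  apply: ler_sum_nat => n /andP[n0 _]; case: ifP => // _.
  by rewrite mulr_ge0 ?wgt_ge0 ?fejer_ge0.
rewrite intg_sum//.
rewrite mulr_suml big_nat_cond [leRHS]big_nat_cond.
apply: ler_sum => n /andP[/andP[n0 _] /andP[Pn1 Pn2]].
rewrite intgZ; last exact: cfw1.
rewrite fejer_w//; apply: ler_wpM2l; first exact: wgt_ge0.
by apply: intg_fejer_sub => //; lra.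
Qed.

(** Dually, the centres run over the window shrunk by [eta], and each n collects at most the central
    mass plus the two tails. *)
Lemma window_lower N c : 2 * eta <= de ->
  (forall w, y + eta <= w -> w <= y + de - eta ->
     c <= \sum_(1 <= n < N | P n) wgt n * fejer la (ln n%:R - w)) ->
  c * (de - 2 * eta) <= (\sum_(1 <= n < N | P n) wgt n) * (fejer_mass la eta + 4 / (la * eta)).
Proof.
move=> ed hc; have eta_gt0 := eta0; have ab : y + eta <= y + de - eta by lra.
have -> : c * (de - 2 * eta) = intg (y + eta) (y + de - eta) (fun=> c).
  by rewrite intg_cst//; ring.
apply: (@le_trans _ _ (intg (y + eta) (y + de - eta)
    (fun w => \sum_(1 <= n < N | P n) wgt n * fejer la (ln n%:R - w)))).
  apply: intg_le; [by move=> w; exact: cvg_cst|by apply: continuous_sum => n; exact: cfw|].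
  by move=> w; rewrite in_itv/= => /andP[w1 w2]; exact: hc.
rewrite intg_sum//.
rewrite mulr_suml big_nat_cond [leRHS]big_nat_cond.
apply: ler_sum => n /andP[/andP[n0 _] _].
rewrite intgZ; last exact: cfw1.
rewrite fejer_w//; apply: ler_wpM2l; first exact: wgt_ge0.
by apply: intg_fejer_le => //; lra.
Qed.

(** An n outside the window is at distance at least [eta] from w, where 2 / (la u^2) is at most (2 /
    la)(1 + eta^-2) / (1 + u^2); the last weight is the one of [vonMangoldt_localized]. *)
Lemma fejer_outside N w K : y + eta <= w -> w <= y + de - eta ->
  \sum_(1 <= n < N) wgt n * (1 + (ln n%:R - w) ^+ 2)^-1 <= K ->
  \sum_(1 <= n < N | ~~ P n) wgt n * fejer la (ln n%:R - w) <= 2 / la * (1 + eta ^- 2) * K.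
Proof.
move=> w1 w2 hK; have eta_gt0 := eta0; have A0 : 0 <= 2 / la * (1 + eta ^- 2).
  by rewrite mulr_ge0 ?divr_ge0 ?addr_ge0 ?invr_ge0 ?sqr_ge0// ltW.
apply: le_trans (ler_wpM2l A0 hK).
rewrite mulr_sumr big_mkcond/=.
apply: ler_sum_nat => n /andP[n0 _]; set u := ln n%:R - w.
have u1 : 0 < 1 + u ^+ 2 by rewrite ltr_pwDl// sqr_ge0.
case: ifP => [nP|_]; last by rewrite mulr_ge0// mulr_ge0 ?wgt_ge0// invr_ge0 ltW.
rewrite mulrCA; apply: ler_wpM2l; first exact: wgt_ge0.
have hu : eta ^+ 2 <= u ^+ 2.
  have : eta <= `|u|.
    move: nP; rewrite /P negb_and -!ltNge => /orP[h|h].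
      by rewrite ltr0_norm /u; lra.
    by rewrite gtr0_norm /u; lra.
  by move=> h; rewrite -(real_normK (num_real u)) lerXn2r ?nnegrE// ltW.
have e2 : 0 < eta ^+ 2 by rewrite exprn_gt0.
have u2 : 0 < u ^+ 2 by exact: lt_le_trans hu.
have u0 : u != 0 by rewrite -sqrf_eq0 gt_eqF.
apply: le_trans (fejer_tail la0 u0) _.
rewrite -[leRHS]mulrA; apply: ler_wpM2l; first by rewrite divr_ge0// ltW.
rewrite ler_pdivlMr// -[leLHS]mulrC mulrDl mul1r divff ?gt_eqF// addrC lerD2l.
by rewrite lef_pV2 ?posrE.
Qed.

End Window.

Lemma window_arithmetic e de G T W : 0 < de -> 0 < e -> e <= 1 -> 2^-1 <= G ->
  T <= e / 32 -> 0 <= W ->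
  W * G <= (G + e / 16) * (de + e / 8 * de) ->
  (G - e / 8) * (de - e / 8 * de) <= W * (G + T) -> `|W - de| <= e * de.
Proof.
move=> de0 e0 e1 G0 T0 W0 up low.
have G_gt0 : 0 < G by lra.
have de0' := ltW de0; have e0' := ltW e0.
have up2 : W <= (1 + e / 8) * (de + e / 8 * de).
  rewrite -(ler_pM2r G_gt0); apply: le_trans up _.
  have -> : (1 + e / 8) * (de + e / 8 * de) * G = (G + e / 8 * G) * (de + e / 8 * de) by ring.
  apply: ler_wpM2r; first by rewrite addr_ge0 ?mulr_ge0 ?divr_ge0.
  rewrite lerD2l; have : e / 8 * 2^-1 <= e / 8 * G by apply: ler_wpM2l => //; rewrite divr_ge0.
  by lra.
have low2 : (1 - e / 4) * (de - e / 8 * de) <= W * (1 + e / 16).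
  rewrite -(ler_pM2r G_gt0).
  apply: (@le_trans _ _ ((G - e / 8) * (de - e / 8 * de))).
    have -> : (1 - e / 4) * (de - e / 8 * de) * G = (G - e / 4 * G) * (de - e / 8 * de) by ring.
    apply: ler_wpM2r; first by rewrite -{1}(mul1r de) -mulrBl mulr_ge0//; lra.
    rewrite lerD2l lerN2.
    have : e / 4 * 2^-1 <= e / 4 * G by apply: ler_wpM2l => //; rewrite divr_ge0.
    by lra.
  apply: le_trans low _; rewrite -[leRHS]mulrA; apply: ler_wpM2l => //.
  rewrite [leRHS]mulrDl mul1r.
  have : e / 16 * 2^-1 <= e / 16 * G by apply: ler_wpM2l => //; rewrite divr_ge0.
    by lra.
rewrite ler_norml; apply/andP; split.
  have : (1 - e) * (1 + e / 16) * de <= (1 - e / 4) * (de - e / 8 * de).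
    have -> : (1 - e / 4) * (de - e / 8 * de) = (1 - e / 4) * (1 - e / 8) * de by ring.
    by apply: ler_wpM2r => //; have := sqr_ge0 e; nra.
  move=> /le_trans /(_ low2); rewrite mulrAC ler_pM2r; last by lra.
  by rewrite mulrBl mul1r; lra.
have : (1 + e / 8) * (de + e / 8 * de) <= (1 + e) * de.
  have -> : (1 + e / 8) * (de + e / 8 * de) = (1 + e / 8) * (1 + e / 8) * de by ring.
  by apply: ler_wpM2r => //; nra.
by rewrite mulrDl mul1r; lra.
Qed.

(** The parameters are fixed in order: [eta] and [la] from e and de, then the threshold for y that
    absorbs K / w, and last the damping [ep] and [N0], which may depend on y. *)
Lemma window_asymptotic de e : 0 < de -> de <= 1 -> 0 < e -> e <= 1 ->
  exists Y, forall y, Y <= y -> exists N0, forall N, (N0 <= N)%N ->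
  `|\sum_(1 <= n < N | y <= ln n%:R <= y + de) wgt n - de| <= e * de.
Proof.
move=> de0 de1 e0 e1.
have [K1 K10 hK1] := vonMangoldt_localized.
pose eta := e * de / 16.
have eta0 : 0 < eta by rewrite divr_gt0// mulr_gt0.
have e1' : e * de <= 1 by rewrite -[leRHS]mulr1; apply: ler_pM => //; exact: ltW.
have eta1 : eta <= 1 by rewrite /eta; lra.
have D0 : 0 < 128 + 128 * K1 by lra.
(* 1 / la has to be small against eta, for the central mass and its tails, and against eta^2 / K1,
   for the points outside the window. One expression serves both. *)
pose la := (eta ^+ 3 * (e / (128 + 128 * K1)))^-1.
have laV0 : 0 < eta ^+ 3 * (e / (128 + 128 * K1)) by rewrite mulr_gt0 ?divr_gt0 ?exprn_gt0.
have la0 : 0 < la by rewrite invr_gt0.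
have laV : la^-1 = eta ^+ 3 * (e / (128 + 128 * K1)) by rewrite invrK.
have eD : e / (128 + 128 * K1) <= 1 by rewrite ler_pdivrMr// mul1r; lra.
have eD0 : 0 <= e / (128 + 128 * K1) by rewrite divr_ge0// ltW.
have eta0' := ltW eta0.
have la_eta : la^-1 <= eta.
  rewrite laV -[leRHS]mulr1; apply: ler_pM => //; first exact: exprn_ge0.
  by rewrite exprS ler_piMr// exprn_ile1.
have G0 := fejer_mass_ge la0 la_eta.
set G := fejer_mass la eta in G0.
have T0 : 4 / (la * eta) <= e / 32.
  rewrite invfM laV mulrA [leLHS](_ : _ = (eta ^+ 2 * 4) * (e / (128 + 128 * K1))); last first.
    by field; rewrite !gt_eqF.
  apply: (@le_trans _ _ (1 * 4 * (e / 128))); last by lra.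
  apply: ler_pM => //; first by rewrite mulr_ge0// exprn_ge0.
    by rewrite ler_wpM2r// exprn_ile1.
  by rewrite ler_wpM2l ?(ltW e0)// lef_pV2 ?posrE//; lra.
have Out : 2 / la * (1 + eta ^- 2) * K1 <= e / 32.
  rewrite laV [leLHS](_ : _ = 2 * (eta ^+ 3 + eta) * (e * (K1 / (128 + 128 * K1)))); last first.
    by field; rewrite !gt_eqF.
  apply: (@le_trans _ _ (4 * (e * 128^-1))); last by lra.
  have KD : K1 / (128 + 128 * K1) <= 128^-1 by rewrite ler_pdivrMr//; lra.
  have e3 : eta ^+ 3 <= 1 by rewrite exprn_ile1.
  have e3' : 0 <= eta ^+ 3 by rewrite exprn_ge0.
  apply: ler_pM.
  - by rewrite mulr_ge0// addr_ge0.
  - by rewrite mulr_ge0 ?divr_ge0// ltW.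
  - by lra.
  - by rewrite ler_wpM2l// ltW.
have [K K0 hK] := fejer_sum_comparison la0.
have [K2 K20 hK2] := fejer_sum_le la0.
have KK0 : 0 <= 32 * (K + K2) / e by rewrite divr_ge0 ?mulr_ge0 ?addr_ge0// ltW.
exists (6 + 32 * (K + K2) / e) => y hy.
have y6 : 6 <= y by lra.
have Kw (k w : R) : 0 <= k -> k <= K + K2 -> y - eta <= w -> k / w <= e / 32.
  move=> k0 kK yw; have wp : 0 < w by clear -y6 yw eta1; lra.
  rewrite ler_pdivrMr//; apply: (@le_trans _ _ (e / 32 * (32 * (K + K2) / e))).
    have -> : e / 32 * (32 * (K + K2) / e) = K + K2 by field; rewrite gt_eqF.
    by [].
  by rewrite ler_wpM2l ?divr_ge0// ?(ltW e0)//; clear -hy yw eta1; lra.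
have G_gt0 : 0 < G by clear -G0; lra.
(* As w + eta <= y + de, the factor expR (- ep (w + eta)) in [comparison_ge] lowers the mass by at
   most e / 32. *)
pose ep := Num.min 1 (e / 32 / ((y + de) * G)).
have yG : 0 < (y + de) * G by rewrite mulr_gt0// addr_gt0//; clear -y6; lra.
have ep0 : 0 < ep by rewrite lt_min ltr01 !divr_gt0.
have ep1 : ep <= 1 by rewrite ge_min lexx.
have epG : ep * ((y + de) * G) <= e / 32 by rewrite -ler_pdivlMr// ge_min lexx orbT.
have e32 : 0 < e / 32 by rewrite divr_gt0.
have [N0 N00 hN] := hK ep ep0 ep1 _ e32.
exists N0 => N NN.
have up := @window_upper la eta y de la0 eta0 N (G + e / 16) (ltW de0) ltac:(lra) _.
have {}up : (\sum_(1 <= n < N | y <= ln n%:R <= y + de) wgt n) * G <= (G + e / 16) * (de + 2 * eta).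
  apply: up => w yw; apply: le_trans (hK2 N w eta _ eta0) _; first lra.
  have {}hKw : K2 / w <= e / 32 by apply: Kw => //; rewrite lerDr.
  by rewrite -/G; move: hKw T0; clear; lra.
have low := @window_lower la eta y de la0 eta0 N (G - e / 8) _ _.
have {}low : (G - e / 8) * (de - 2 * eta) <= (\sum_(1 <= n < N | y <= ln n%:R <= y + de) wgt n) * (G + 4 / (la * eta)).
  have ed : e * de <= de by rewrite ler_piMl// ltW.
  apply: low; first by rewrite /eta; lra.
  move=> w w1 w2; have w0 : 0 < w by clear -w1 y6 eta0; lra.
  have := hN N w NN w0; rewrite ler_norml => /andP[h1 _].
  have h2 := @comparison_ge R la la0 ep w ep0 (ltW w0) eta eta0 ltac:(clear -w1 y6 eta1; lra); rewrite -/G in h2.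
  have h3 : G - ep * ((y + de) * G) <= expR (- ep * (w + eta)) * G.
    have -> : G - ep * ((y + de) * G) = (1 + - ep * (y + de)) * G by ring.
    rewrite ler_wpM2r ?(ltW G_gt0)//; apply: le_trans (expR_ge1Dx _).
    by rewrite lerD2l !mulNr lerN2 ler_wpM2l ?(ltW ep0)//; clear -w2; lra.
  have h4 : K / w <= e / 32.
    by apply: Kw => //; [rewrite lerDl|clear -w1 eta0; lra].
  have h5 := fejer_outside la0 eta0 w1 w2 (hK1 N w ltac:(clear -w1 y6 eta0; lra)).
  have h6 : \sum_(1 <= n < N) wgt n * expR (ln n%:R * - ep) * fejer la (ln n%:R - w) <=
      \sum_(1 <= n < N) wgt n * fejer la (ln n%:R - w).
    apply: ler_sum_nat => n /andP[n0 _].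
    rewrite ler_wpM2r ?fejer_ge0// ler_piMr ?wgt_ge0// expR_le1 mulrN oppr_le0.
    by rewrite mulr_ge0 ?ln_ge0_nat// ltW.
  rewrite [leRHS](bigID (fun n => y <= ln n%:R <= y + de))/= in h6.
  by clear -h1 h2 h3 h4 h5 h6 Out epG; lra.
apply: (@window_arithmetic e de G (4 / (la * eta))) => //.
- by rewrite big_nat_cond sumr_ge0// => n /andP[/andP[n0 _] _]; exact: wgt_ge0.
- by move: up; rewrite /eta; have -> : 2 * (e * de / 16) = e / 8 * de by field.
- by move: low; rewrite /eta; have -> : 2 * (e * de / 16) = e / 8 * de by field.
Qed.

End Windows.

(** * The prime number theorem for log d_n *)

Section PNT.
Variable R : realType.
Local Notation wgt n := (vonMangoldt R n / n%:R).
Local Notation psi n := (ln (lcm_upto n)%:R : R).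
Implicit Types (x y e de : R) (n N m k : nat).

(** Strict below and weak above: the windows are closed, so an integer x belongs to its window and m
    must stay outside. *)
Lemma nat_below x : 0 < x -> exists2 m, m%:R < x & x <= m.+1%:R.
Proof.
move=> x0; have j1 : (Num.truncn x)%:R <= x by rewrite truncn_le// ltW.
have j2 : x < (Num.truncn x).+1%:R by exact: truncnS_gt.
move: j1; rewrite le_eqVlt => /predU1P[jx|jx]; last by exists (Num.truncn x) => //; exact: ltW.
case: (Num.truncn x) jx => [x00|j jx]; first by rewrite -x00 ltxx in x0.
by exists j; rewrite -jx ?ltr_nat.
Qed.

Lemma psi_window n m x de N : (0 < n)%N -> 0 < de -> x = n%:R * expR (- de) ->
  m%:R < x -> x <= m.+1%:R -> (n < N)%N ->
  \sum_(1 <= k < N | ln n%:R - de <= ln k%:R <= ln n%:R - de + de) wgt k =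
  \sum_(m.+1 <= k < n.+1) wgt k.
Proof.
move=> n0 de0 xE mx xm nN; have n0R : 0 < n%:R :> R by rewrite ltr0n.
have x0 : 0 < x by rewrite xE mulr_gt0 ?expR_gt0.
have lnx : ln x = ln n%:R - de by rewrite xE lnM ?posrE ?expR_gt0// expRK.
have xn : x < n%:R by rewrite xE -[ltRHS]mulr1 ltr_pM2l// expR_lt1 oppr_lt0.
have mn : (m < n)%N by rewrite -(ltr_nat R) (lt_trans mx).
rewrite subrK -lnx.
have z2 : \sum_(n.+1 <= k < N | ln x <= ln k%:R <= (ln n%:R : R)) wgt k = 0.
  rewrite big_nat_cond big1// => k /andP[/andP[nk _] /andP[_]].
  rewrite ler_ln ?posrE ?ltr0n//; last exact: leq_trans nk.
  by rewrite ler_nat leqNgt nk.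
have z1 : \sum_(1 <= k < m.+1 | ln x <= ln k%:R <= (ln n%:R : R)) wgt k = 0.
  rewrite big_nat_cond big1// => k /andP[/andP[k0 km] /andP[xk _]]; move: xk.
  by rewrite ler_ln ?posrE ?ltr0n// leNgt (le_lt_trans _ mx)// ler_nat -ltnS.
rewrite (@big_cat_nat _ _ _ n.+1)//= z2 (@big_cat_nat _ _ _ m.+1)//=; last exact: ltnW.
rewrite z1.
rewrite addr0 add0r big_nat_cond [RHS]big_nat_cond; apply: eq_bigl => k.
case: (boolP (m < k < n.+1)%N) => //= /andP[mk kn].
have k0 : (0 < k)%N by exact: leq_trans mk.
by rewrite !ler_ln ?posrE ?ltr0n// ler_nat -ltnS kn andbT (le_trans xm)// ler_nat.
Qed.

Lemma psi_sub m n : (m <= n)%N ->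
  psi n - psi m = \sum_(m.+1 <= k < n.+1) vonMangoldt R k.
Proof.
move=> mn; rewrite -!sum_vonMangoldt (big_cat_nat (n := m.+1) (p := n.+1))//=.
by rewrite addrAC subrr add0r.
Qed.

(** Every k of the window lies between n e^(-de) and n, so replacing the weights 1/k by a constant
    costs only a factor e^(-de). *)
Lemma psi_step e de : 0 < de -> de <= 1 -> 0 < e -> e <= 1 ->
  exists2 n0, (0 < n0)%N & forall n, (n0 <= n)%N -> exists2 m,
   m%:R < n%:R * expR (- de) /\ n%:R * expR (- de) <= m.+1%:R &
   n%:R * expR (- de) * ((1 - e) * de) <= psi n - psi m /\ psi n - psi m <= n%:R * ((1 + e) * de).
Proof.
move=> de0 de1 e0 e1; have [Y hY] := window_asymptotic de0 de1 e0 e1.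
have [n0 n00 hn0] := ln_unbounded (Y + de).
exists n0 => // n nn; have n1 : (0 < n)%N := leq_trans n00 nn.
have n1R : 0 < n%:R :> R by rewrite ltr0n.
have [|N0 hN0] := hY (ln n%:R - de); first by have := hn0 n nn; lra.
set x := n%:R * expR (- de).
have x0 : 0 < x by rewrite mulr_gt0 ?expR_gt0.
have [m mx xm] := nat_below x0; exists m => //.
have xn : x < n%:R by rewrite -[ltRHS]mulr1 ltr_pM2l// expR_lt1 oppr_lt0.
have mn : (m < n)%N by rewrite -(ltr_nat R) (lt_trans mx).
have := hN0 (maxn N0 n.+1) (leq_maxl _ _).
rewrite (@psi_window n m x) ?leq_maxr// ler_norml => /andP[h1 h2].
rewrite psi_sub; last exact: ltnW.
set W := \sum_(_ <= _ < _) wgt _ in h1 h2.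
have hx : x * W <= \sum_(m.+1 <= k < n.+1) vonMangoldt R k.
  rewrite /W mulr_sumr.
  apply: ler_sum_nat => k /andP[mk kn]; have k0 : (0 < k)%N by exact: leq_trans mk.
  have /andP[v0 _] := vonMangoldt_bounds R k0.
  rewrite mulrCA -[leRHS]mulr1 ler_wpM2l// ler_pdivrMr ?ltr0n// mul1r.
  by rewrite (le_trans xm)// ler_nat.
have hn : \sum_(m.+1 <= k < n.+1) vonMangoldt R k <= n%:R * W.
  rewrite /W mulr_sumr.
  apply: ler_sum_nat => k /andP[mk kn]; have k0 : (0 < k)%N by exact: leq_trans mk.
  have /andP[v0 _] := vonMangoldt_bounds R k0.
  rewrite mulrCA -[leLHS]mulr1 ler_wpM2l// ler_pdivlMr ?ltr0n// mul1r.
  by rewrite ler_nat -ltnS.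
split.
  apply: le_trans hx; apply: ler_wpM2l; first exact: ltW.
  rewrite mulrBl mul1r; lra.
apply: le_trans hn _; apply: ler_wpM2l; first exact: ltW.
rewrite mulrDl mul1r; lra.
Qed.

Lemma psi_mono m n : (m <= n)%N -> psi m <= psi n.
Proof.
move=> mn; rewrite -subr_ge0 psi_sub// big_nat_cond sumr_ge0// => k /andP[/andP[mk _] _].
by have /andP[] := vonMangoldt_bounds R (leq_trans (ltn0Sn m) mk).
Qed.

Lemma psi_ge0 n : 0 <= psi n.
Proof. by rewrite ln_ge0// ler1n lcm_upto_gt0. Qed.

(** Strong induction from m < n e^(-e) to n. The slope B = (1 + e) e^e is stable, since B e^(-e) +
    (1 + e) e = (1 + e)^2 <= B. *)
Lemma psi_le_linear e : 0 < e -> e <= 2^-1 -> exists2 A : R, 0 <= A &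
  forall n, psi n <= (1 + e) * expR e * n%:R + A.
Proof.
move=> e0 e1; have [||||n0 n00 hn] := @psi_step e e; [lra..|].
exists (psi n0) => [|n]; first exact: psi_ge0.
have B0 : 0 <= (1 + e) * expR e by rewrite mulr_ge0 ?expR_ge0//; lra.
elim/ltn_ind: n => n IH.
have [nn|nn] := leqP n n0.
  by apply: le_trans (psi_mono nn) _; rewrite lerDr mulr_ge0.
have [m [m1 m2] [_ h]] := hn n (ltnW nn).
have n1R : 0 < n%:R :> R by rewrite ltr0n (leq_ltn_trans _ nn).
have mn : (m < n)%N.
  by rewrite -(ltr_nat R) (lt_trans m1)// -[ltRHS]mulr1 ltr_pM2l// expR_lt1 oppr_lt0.
have := IH m mn; set B := (1 + e) * expR e in B0 * => hm.
have h1 : B * m%:R <= B * (n%:R * expR (- e)) by rewrite ler_wpM2l// ltW.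
have h2 : B * (n%:R * expR (- e)) = n%:R * (1 + e).
  have -> : B * (n%:R * expR (- e)) = n%:R * (1 + e) * (expR e * expR (- e)) by rewrite /B; ring.
  by rewrite expRxMexpNx_1 mulr1.
have h3 : n%:R * ((1 + e) * e) + n%:R * (1 + e) <= B * n%:R.
  have -> : n%:R * ((1 + e) * e) + n%:R * (1 + e) = (1 + e) * (1 + e) * n%:R by ring.
  by rewrite ler_wpM2r ?ler0n// ler_wpM2l ?expR_ge1Dx//; lra.
lra.
Qed.

(** Here m may fall short of x = n e^(-e) by 1. The slope uses 1 - 2 e where the window gives 1 - e;
    the spare x e^2, at least 1 beyond [n1], pays for this rounding. *)
Lemma psi_ge_linear e : 0 < e -> e <= 2^-1 -> exists2 A : R, 0 <= A &
  forall n, (1 - 2 * e) * expR (- e) * n%:R - A <= psi n.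
Proof.
move=> e0 e1; have [||||n0 n00 hn] := @psi_step e e; [lra..|].
pose n1 := maxn n0 (Num.truncn (expR e / (e * e))).+1.
have b0 : 0 <= (1 - 2 * e) * expR (- e) by rewrite mulr_ge0 ?expR_ge0//; lra.
have b1 : (1 - 2 * e) * expR (- e) <= 1.
  rewrite -[leRHS]mulr1; apply: ler_pM; rewrite ?expR_ge0//; [lra|lra|].
  by rewrite expR_le1; lra.
exists ((1 - 2 * e) * expR (- e) * n1%:R) => [|n]; first by rewrite mulr_ge0.
set b := (1 - 2 * e) * expR (- e) in b0 b1 *.
elim/ltn_ind: n => n IH.
have [nn|nn] := leqP n n1.
  apply: le_trans (psi_ge0 n); rewrite -mulrBr mulr_ge0_le0// subr_le0 ler_nat//.
have [m [m1 m2] [h _]] := hn n (leq_trans (leq_maxl _ _) (ltnW nn)).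
have n1R : 0 < n%:R :> R by rewrite ltr0n (leq_ltn_trans _ nn).
have mn : (m < n)%N.
  by rewrite -(ltr_nat R) (lt_trans m1)// -[ltRHS]mulr1 ltr_pM2l// expR_lt1 oppr_lt0.
have := IH m mn => hm.
set x := n%:R * expR (- e) in m1 m2 h.
have xlarge : 1 <= x * (e * e).
  rewrite /x -ler_pdivrMr ?mulr_gt0// div1r expRN ler_pdivlMr ?expR_gt0// mulrC.
  apply: (@le_trans _ _ n1%:R); last by rewrite ler_nat ltnW.
  apply: (@le_trans _ _ (Num.truncn (expR e / (e * e))).+1%:R); first exact/ltW/truncnS_gt.
  by rewrite ler_nat leq_maxr.
have h1 : b * (x - 1) <= b * m%:R by rewrite ler_wpM2l// lerBlDr natr1.
have h2 : b * n%:R <= b * x + x * ((1 - 2 * e) * e).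
  have -> : b * n%:R = x * (1 - 2 * e) by rewrite /b /x; ring.
  have -> : b * x + x * ((1 - 2 * e) * e) = x * ((1 - 2 * e) * (expR (- e) + e)) by rewrite /b; ring.
  rewrite ler_wpM2l; [by []| |].
    by rewrite mulr_ge0 ?expR_ge0 ?ler0n.
  rewrite -{1}(mulr1 (1 - 2 * e)) ler_wpM2l//; first lra.
  by have := expR_ge1Dx (- e); lra.
have h3 : x * ((1 - e) * e) = x * ((1 - 2 * e) * e) + x * (e * e) by ring.
rewrite mulrBr mulr1 in h1; lra.
Qed.

Theorem prime_number_theorem e : 0 < e ->
  exists n0, forall n, (n0 <= n)%N -> `|psi n - n%:R| <= e * n%:R.
Proof.
move=> e0; pose d : R := Num.min (4^-1) (e / 16).
have d0 : 0 < d by rewrite lt_min invr_gt0 ltr0n divr_gt0.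
have d4 : d <= 4^-1 by rewrite ge_min lexx.
have de : d <= e / 16 by rewrite ge_min lexx orbT.
have [|A A0 hA] := psi_le_linear d0; first lra.
have [|A' A'0 hA'] := psi_ge_linear d0; first lra.
exists (Num.truncn (2 * (A + A') / e)).+1 => n hn.
have n0 : 0 <= n%:R :> R by rewrite ler0n.
have hAn : A + A' <= e / 2 * n%:R.
  have : 2 * (A + A') / e <= n%:R.
    apply: (@le_trans _ _ (Num.truncn (2 * (A + A') / e)).+1%:R); first exact/ltW/truncnS_gt.
    by rewrite ler_nat.
  rewrite ler_pdivrMr//; lra.
have ed : expR d <= 1 + 2 * d.
  have h : expR (- d) >= 1 - d by exact: expR_ge1Dx.
  rewrite expRN in h; have p := expR_gt0 d.
  have : (1 - d) * expR d <= 1 by rewrite -ler_pdivlMr// div1r.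
  have : (1 - d) * (1 + 2 * d) >= 1 by nra.
  have d1 : 0 < 1 - d by lra.
  move=> i1 i2; rewrite -(ler_pM2l d1); exact: le_trans i1.
have ed' : 1 - d <= expR (- d) by exact: expR_ge1Dx.
have h1 : (1 + d) * expR d * n%:R <= (1 + e / 2) * n%:R.
  rewrite ler_wpM2r//; apply: (@le_trans _ _ ((1 + d) * (1 + 2 * d))); last by nra.
  by rewrite ler_wpM2l//; lra.
have h2 : (1 - e / 2) * n%:R <= (1 - 2 * d) * expR (- d) * n%:R.
  rewrite ler_wpM2r//; apply: (@le_trans _ _ ((1 - 2 * d) * (1 - d))); first by nra.
  by rewrite ler_wpM2l//; lra.
have := hA n; have := hA' n; rewrite ler_norml => i1 i2; apply/andP; split; lra.
Qed.

End PNT.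

(** * Linear forms in 1, gamma and logarithms *)

Section PartialFractions.
Variable R : realType.
Implicit Types (x y : R) (n k m N : nat).

Definition harm m : R := \sum_(1 <= j < m.+1) j%:R^-1.

(** [pfA] and [pfB] are the coefficients of the double and of the simple pole of R_n(x)^2 at x =
    -k. *)
Definition pfA n k : R := 'C(n, k)%:R ^+ 2.
Definition pfB n k : R := 2 * pfA n k * (harm k - harm (n - k)).

Lemma harmS m : harm m.+1 = harm m + m.+1%:R^-1.
Proof. by rewrite /harm big_nat_recr. Qed.

Lemma pfB_rev n k : (k <= n)%N -> pfB n (n - k) = - pfB n k.
Proof. by move=> kn; rewrite /pfB /pfA bin_sub// subKn//; ring. Qed.

(** Antisymmetry under k -> n - k. It says that R_n^2 has no 1/x term at infinity, and it cancels
    every logarithm that is common to all k. *)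
Lemma sum_pfB n : \sum_(0 <= k < n.+1) pfB n k = 0.
Proof.
have e : \sum_(0 <= k < n.+1) pfB n k = - \sum_(0 <= k < n.+1) pfB n k.
  rewrite {1}big_nat_rev/= -sumrN.
  by apply: eq_big_nat => k /andP[_ kn]; rewrite add0n subSS pfB_rev.
by move: e; move: (\sum_(_ <= _ < _) _) => s; lra.
Qed.

Lemma pfAS n k : (k <= n)%N ->
  pfA n.+1 k = n.+1%:R ^+ 2 * (pfA n k / (n.+1%:R - k%:R) ^+ 2).
Proof.
move=> kn; have d0 : (n.+1%:R - k%:R : R) != 0.
  by rewrite -natrB ?pnatr_eq0 ?subn_eq0 -?ltnNge// leqW.
have : ((n.+1 - k) * 'C(n.+1, k) = n.+1 * 'C(n, k))%N by rewrite -mul_bin_down.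
move/(congr1 (fun j => j%:R : R)); rewrite !natrM natrB ?leqW// => h.
by rewrite /pfA mulrA -exprMn -h exprMn mulrAC divff ?mul1r// expf_neq0.
Qed.

Lemma pfBS n k : (k <= n)%N ->
  pfB n.+1 k = n.+1%:R ^+ 2 * (pfB n k / (n.+1%:R - k%:R) ^+ 2
     - 2 * pfA n k / (n.+1%:R - k%:R) ^+ 3).
Proof.
move=> kn; have d0 : (n.+1%:R - k%:R : R) != 0.
  by rewrite -natrB ?pnatr_eq0 ?subn_eq0 -?ltnNge// leqW.
have e : (n.+1 - k)%:R = n.+1%:R - k%:R :> R by rewrite natrB// leqW.
rewrite /pfB pfAS// subSn// harmS -subSn// e.
move: d0; set m : R := n.+1%:R; move: m => m d0; field; exact: d0.
Qed.

(** Passing to n + 1 multiplies by (m / (x + m))^2 with m = n + 1. The induction hypothesis at x =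
    -m yields the coefficient 1 of the new double pole, and [sum_pfB] yields that of the new simple
    pole. *)
Lemma partial_fractions n x : (forall k, (k <= n)%N -> x + k%:R != 0) ->
  \sum_(0 <= k < n.+1) (pfA n k / (x + k%:R) ^+ 2 + pfB n k / (x + k%:R)) =
  (n`!%:R / \prod_(0 <= k < n.+1) (x + k%:R)) ^+ 2.
Proof.
elim: n x => [|n IH] x hx.
  by rewrite !big_nat1 /pfB /pfA bin0 subnn subrr mulr0 mul0r addr0 expr_div_n fact0.
set m : R := n.+1%:R; have m0 : m != 0 by rewrite pnatr_eq0.
have xm : x + m != 0 := hx _ (leqnn _).
have hk k : (k <= n)%N -> m - k%:R != 0.
  by move=> kn; rewrite /m -natrB ?pnatr_eq0 ?subn_eq0 -?ltnNge// leqW.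
have hxk k : (k <= n)%N -> x + k%:R != 0 by move=> kn; apply: hx; rewrite leqW.
have eA : \sum_(0 <= k < n.+1) m ^+ 2 * (pfA n k / (m - k%:R) ^+ 2 - pfB n k / (m - k%:R)) = 1.
  rewrite -mulr_sumr.
  have := IH (- m); rewrite (_ : \sum_(0 <= k < n.+1) _ =
      \sum_(0 <= k < n.+1) (pfA n k / (m - k%:R) ^+ 2 - pfB n k / (m - k%:R))); last first.
    apply: eq_big_nat => k /andP[_ kn].
    have -> : - m + k%:R = - (m - k%:R) by ring.
    by move: (hk k kn); generalize m => q hq; field.
  move=> ->; last first.
    by move=> k kn; have -> : - m + k%:R = - (m - k%:R) by [ring]; rewrite oppr_eq0 hk.
  have -> : \prod_(0 <= k < n.+1) (- m + k%:R) = (-1) ^+ n.+1 * (n.+1)`!%:R.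
    have -> : \prod_(0 <= k < n.+1) (- m + k%:R) = \prod_(0 <= k < n.+1) (-1 * (n.+1 - k)%:R).
      apply: eq_big_nat => k /andP[_ kn].
      by rewrite natrB ?(ltnW kn)//; ring.
    rewrite big_split/= big_const_nat subn0 iter_mulr_1 -natr_prod; congr (_ * _%:R).
    rewrite fact_prod big_nat_rev/= big_add1 /=; apply: eq_big_nat => k /andP[_ kn].
    by rewrite add0n subKn.
  rewrite factS natrM; have f0 : n`!%:R != 0 :> R by rewrite pnatr_eq0 -lt0n fact_gt0.
  have s0 : (-1) ^+ n.+1 != 0 :> R by rewrite signr_eq0.
  rewrite -exprMn -/m.
  have -> : m * (n`!%:R / ((-1) ^+ n.+1 * (m * n`!%:R))) = ((-1) ^+ n.+1)^-1.
    by move: m0; generalize m => q q0; field; rewrite f0 s0 q0.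
  by rewrite exprVn sqrr_sign invr1.
have eB : \sum_(0 <= k < n.+1) pfB n.+1 k = - pfB n.+1 n.+1.
  by have := sum_pfB n.+1; rewrite big_nat_recr//= => h; apply/eqP; rewrite -addr_eq0 h.
rewrite big_nat_recr//= [in RHS]big_nat_recr//=.
have -> : (n.+1`!%:R / (\prod_(0 <= i < n.+1) (x + i%:R) * (x + m))) ^+ 2 =
    (m / (x + m)) ^+ 2 * (n`!%:R / \prod_(0 <= k < n.+1) (x + k%:R)) ^+ 2.
  by rewrite -exprMn factS natrM invfM; congr (_ ^+ 2); rewrite -/m; ring.
rewrite -(IH x hxk) mulr_sumr.
have -> : pfA n.+1 n.+1 = 1 by rewrite /pfA binn expr1n.
have -> : pfB n.+1 n.+1 = - \sum_(0 <= k < n.+1) pfB n.+1 k by rewrite eB opprK.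
have -> : 1 / (x + m) ^+ 2 + - (\sum_(0 <= k < n.+1) pfB n.+1 k) / (x + m) =
    \sum_(0 <= k < n.+1) (m ^+ 2 * (pfA n k / (m - k%:R) ^+ 2 - pfB n k / (m - k%:R)) / (x + m) ^+ 2
       - pfB n.+1 k / (x + m)).
  by rewrite sumrB -!mulr_suml eA mulNr.
rewrite -big_split/=.
apply: eq_big_nat => k /andP[_ kn].
rewrite pfAS// pfBS// -/m; move: xm (hxk k kn) (hk k kn).
by generalize m => q h1 h2 h3; field; rewrite h1 h2 h3.
Qed.

End PartialFractions.

(** * Tail integrals of R_n^2 and their size *)

Section LinearForms.
Variable R : realType.
Implicit Types (x y K a : R) (n k m N : nat).
Local Notation pfA n k := (pfA R n k).
Local Notation pfB n k := (pfB R n k).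
Local Notation harm n := (harm R n).

(* Gfun n x is the integral of Rfun n ^+ 2 over the half-line [x, +oo[. *)
Definition Gfun n x : R :=
  \sum_(0 <= k < n.+1) (pfA n k / (x + k%:R) - pfB n k * ln (x + k%:R)).

Definition Rfun n x : R := n`!%:R / \prod_(0 <= k < n.+1) (x + k%:R).

Lemma is_derive_shift_inv k x : 0 < x -> is_derive x (1 : R) (fun y => (y + k%:R)^-1) (- (x + k%:R) ^- 2).
Proof.
move=> x0; have xk : x + k%:R != 0 by rewrite gt_eqF// ltr_wpDr.
have h1 : is_derive (x + k%:R) (1 : R) (fun y : R => y^-1) (- (x + k%:R) ^- 2).
  by apply: is_derive_eq; [exact: is_deriveV|rewrite /GRing.scale/= mulr1].
have h2 : is_derive x (1 : R) (fun y => y + k%:R) 1 by apply: is_derive_eq; rewrite addr0.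
by have := @is_derive1_comp R _ (fun y => y + k%:R) x _ _ h1 h2; rewrite mulr1; apply.
Qed.

Lemma is_derive_shift_ln k x : 0 < x -> is_derive x (1 : R) (fun y => ln (y + k%:R)) (x + k%:R)^-1.
Proof.
move=> x0; have xk : 0 < x + k%:R by rewrite ltr_wpDr.
have h1 := is_derive1_ln xk.
have h2 : is_derive x (1 : R) (fun y => y + k%:R) 1 by apply: is_derive_eq; rewrite addr0.
by have := @is_derive1_comp R _ (fun y => y + k%:R) x _ _ h1 h2; rewrite mulr1; apply.
Qed.

Lemma is_derive_Gfun n x : 0 < x -> is_derive x (1 : R) (Gfun n) (- Rfun n x ^+ 2).
Proof.
move=> x0; rewrite /Rfun -partial_fractions; last first.
  by move=> k _; rewrite gt_eqF// ltr_wpDr.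
rewrite -sumrN; apply: is_derive_bigsum => k.
have h1 := is_derive_shift_inv k x0; have h2 := is_derive_shift_ln k x0.
by apply: is_derive_eq; rewrite /GRing.scale/=; ring.
Qed.

(** Since the [pfB] sum to 0, ln x may be subtracted from each logarithm, and ln (1 + k/x) <=
    k/x. *)
Lemma Gfun_small n : exists2 K, 0 <= K & forall x, 1 <= x -> `|Gfun n x| <= K / x.
Proof.
exists (\sum_(0 <= k < n.+1) (pfA n k + `|pfB n k| * k%:R)) => [|x x1].
  by rewrite sumr_ge0// => k _; rewrite addr_ge0 ?mulr_ge0// sqr_ge0.
have x0 : 0 < x by lra.
have -> : Gfun n x = \sum_(0 <= k < n.+1) (pfA n k / (x + k%:R) - pfB n k * (ln (x + k%:R) - ln x)).
  rewrite /Gfun; under [RHS]eq_bigr do rewrite mulrBr opprB addrCA.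
  by rewrite [RHS]big_split/= -mulr_suml sum_pfB mul0r add0r.
apply: le_trans (ler_norm_sum _ _ _) _; rewrite mulr_suml; apply: ler_sum => k _.
have xk : 0 < x + k%:R by rewrite ltr_wpDr.
apply: le_trans (ler_normB _ _) _; rewrite mulrDl; apply: lerD.
  rewrite ger0_norm ?divr_ge0 ?sqr_ge0//; last exact: ltW.
  by rewrite ler_wpM2l ?sqr_ge0// lef_pV2 ?posrE// lerDl.
rewrite normrM -mulrA ler_wpM2l// -ln_div ?posrE// mulrDl divff ?gt_eqF//.
have k0 : 0 <= k%:R / x by rewrite divr_ge0// ltW.
rewrite ger0_norm; last by rewrite ln_ge0// lerDl.
by apply: le_ln1Dx; lra.
Qed.

(** Comparison of improper integrals through antiderivatives: a nonincreasing F that is at least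
    -K/x at infinity cannot be negative. *)
Lemma ge0_of_derive (F F' : R -> R) a K : 0 < a -> 0 <= K ->
  (forall x, a <= x -> is_derive x (1 : R) F (F' x)) -> (forall x, a <= x -> F' x <= 0) ->
  (forall x, a <= x -> - (K / x) <= F x) -> 0 <= F a.
Proof.
move=> a0 K0 dF F'0 Flow.
have decr x : a < x -> F x <= F a.
  move=> ax; have [c] : exists2 c, c \in `]a, x[%R & F x - F a = F' c * (x - a).
    apply: (MVT ax) => [y|].
      by rewrite in_itv/= => /andP[ay _]; apply: dF; exact: ltW.
    apply: derivable_within_continuous => y; rewrite in_itv/= => /andP[ay _].
    have dFy := dF y ay; exact: ex_derive.
  rewrite in_itv/= => /andP[ac _] h; rewrite -subr_le0 h mulr_le0_ge0//.
    by apply: F'0; exact: ltW.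
  by rewrite subr_ge0 ltW.
rewrite leNgt; apply/negP => Fa.
(* Were F a negative, then at x + 1 the lower bound -K / (x + 1) would already exceed F a. *)
pose x := a + K / - F a.
have Fa' : 0 < - F a by rewrite oppr_gt0.
have d0 : 0 <= K / - F a by rewrite divr_ge0// ltW.
have x0 : 0 < x by rewrite /x; lra.
have ax : a < x + 1 by rewrite /x; lra.
have := le_trans (Flow _ (ltW ax)) (decr _ ax).
apply/negP; rewrite -ltNge ltrNr ltr_pdivrMr; last by lra.
rewrite /x mulrDr mulrDr mulrC [_ * (K / _)]mulrC divfK ?gt_eqF// mulr1.
have : 0 < a * - F a by rewrite mulr_gt0.
lra.
Qed.

Lemma Gfun_ge0 n x : 1 <= x -> 0 <= Gfun n x.
Proof.
move=> x1; have [K K0 hK] := Gfun_small n.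
apply: (@ge0_of_derive (Gfun n) (fun x => - Rfun n x ^+ 2) x K) => //.
- lra.
- by move=> y xy; apply: is_derive_Gfun; lra.
- by move=> y _; rewrite oppr_le0 sqr_ge0.
- move=> y xy; have := hK y (le_trans x1 xy); rewrite ler_norml => /andP[h _].
  by [].
Qed.

Lemma prod_shift_gt0 n x : 0 < x -> 0 < \prod_(0 <= k < n) (x + k%:R) :> R.
Proof. by move=> x0; rewrite prodr_gt0// => k _; rewrite ltr_wpDr. Qed.

Lemma Rfun_gt0 n x : 0 < x -> 0 < Rfun n x.
Proof. by move=> x0; rewrite divr_gt0 ?prod_shift_gt0// ltr0n fact_gt0. Qed.

Lemma Rfun_decr n x y : 0 < x -> x <= y -> Rfun n y <= Rfun n x.
Proof.
move=> x0 xy; have y0 : 0 < y by exact: lt_le_trans xy.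
rewrite /Rfun ler_wpM2l// lef_pV2 ?posrE ?prod_shift_gt0//.
by apply: ler_prod => k _; rewrite addr_ge0 ?(ltW x0)//= lerD2r.
Qed.

Lemma prod_fact n m : (n`! * \prod_(0 <= k < m) (n.+1 + k) = (n + m)`!)%N.
Proof.
elim: m => [|m IH]; first by rewrite big_geq// muln1 addn0.
by rewrite big_nat_recr//= mulnA IH addnS factS mulnC addSn.
Qed.

Lemma Rfun_fact n m : Rfun n m.+1%:R = (n`! * m`!)%:R / (m + n.+1)`!%:R.
Proof.
rewrite /Rfun -prod_fact !natrM natr_prod.
have -> : \prod_(0 <= k < n.+1) (m.+1%:R + k%:R) = \prod_(0 <= k < n.+1) (m.+1 + k)%:R :> R.
  by apply: eq_bigr => k _; rewrite natrD.
have f0 : m`!%:R != 0 :> R by rewrite pnatr_eq0 -lt0n fact_gt0.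
have P0 : \prod_(0 <= k < n.+1) (m.+1 + k)%:R != 0 :> R.
  by rewrite gt_eqF// prodr_gt0.
by move: P0; move: (\prod_(_ <= _ < _) _) => P P0; field; rewrite f0 P0.
Qed.

Lemma Rfun_upper n : Rfun n n.+1%:R <= 4^-1 ^+ n.
Proof.
rewrite Rfun_fact; elim: n => [|n IH]; first by rewrite fact0 expr0 add0n factS fact0 !mul1n divr1.
have f0 k : k`!%:R != 0 :> R by rewrite pnatr_eq0 -lt0n fact_gt0.
rewrite exprS; apply: le_trans (ler_wpM2l _ IH); last by rewrite invr_ge0.
have -> : (n.+1 + n.+2 = (n + n.+1).+2)%N by lia.
set c4 := 4^-1; have c4E : c4 = 4^-1 by [].
clearbody c4; rewrite !factS !natrM -!natr1 natrD -natr1.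
set q := (n + n.+1)`!%:R; have q0 : 0 < q :> R by rewrite ltr0n fact_gt0.
set f := n`!%:R; have n0 : 0 <= n%:R :> R by [].
have f1 : 0 <= f * f by rewrite mulr_ge0.
set v := n%:R in n0 *.
have D1 : 0 < v + (v + 1) + 1 by lra.
have D2 : 0 < v + (v + 1) + 1 + 1 by lra.
have -> : (v + 1) * f * ((v + 1) * f) / ((v + (v + 1) + 1 + 1) * ((v + (v + 1) + 1) * q)) =
  (f * f / q) * ((v + 1) ^+ 2 / ((v + (v + 1) + 1 + 1) * (v + (v + 1) + 1))).
  by field; rewrite !gt_eqF.
rewrite mulrC ler_wpM2r//; first by rewrite divr_ge0// ltW.
by rewrite ler_pdivrMr ?mulr_gt0// c4E; clear -n0; clearbody v; nra.
Qed.

Lemma Rfun_lower n : 4^-1 ^+ n / (2 * (n%:R + 2)) <= Rfun n n.+2%:R.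
Proof.
rewrite Rfun_fact; elim: n => [|n IH].
  by rewrite fact0 expr0 !factS fact0 /= add0r; lra.
have -> : (n.+2 + n.+2)`!%:R = (2 * n%:R + 4) * (2 * n%:R + 3) * (n.+1 + n.+1)`!%:R :> R.
  have -> : (n.+2 + n.+2 = (n.+1 + n.+1).+2)%N by lia.
  by rewrite (factS (_ + _).+1) (factS (_ + _)) mulnA 2!natrM; congr (_ * _ * _); ring.
have -> : (n.+1`! * n.+2`!)%:R = (n%:R + 1) * (n%:R + 2) * (n`! * n.+1`!)%:R :> R.
  by rewrite (factS n.+1) {1}(factS n) !natrM; ring.
have q0 : 0 < (n.+1 + n.+1)`!%:R :> R by rewrite ltr0n fact_gt0.
have f0 : 0 <= (n`! * n.+1`!)%:R :> R by [].
have n0 : 0 <= n%:R :> R by [].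
have -> : n.+1%:R + 2 = n%:R + 3 :> R by ring.
have p0 : 0 <= 4^-1 ^+ n :> R by rewrite exprn_ge0// invr_ge0.
move: IH q0 f0 n0 p0; rewrite exprS.
move: n%:R (_ * _)%:R (_ + _)`!%:R (4^-1 ^+ n) => v f q p IH q0 f0 v0 p0.
have D : 0 < (2 * v + 4) * (2 * v + 3) by rewrite mulr_gt0//; lra.
have -> : (v + 1) * (v + 2) * f / ((2 * v + 4) * (2 * v + 3) * q) =
    (f / q) * ((v + 1) * (v + 2) / ((2 * v + 4) * (2 * v + 3))).
  by field; rewrite !gt_eqF//; lra.
apply: le_trans (ler_wpM2r _ IH); last first.
  by rewrite divr_ge0 ?mulr_ge0//; lra.
have -> : 4^-1 * p / (2 * (v + 3)) = p * (4 * (2 * (v + 3)))^-1 by field; lra.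
rewrite -[p / _ * _]mulrA ler_wpM2l//.
rewrite -[leLHS]div1r ler_pdivrMr; last by rewrite !mulr_gt0//; lra.
have -> : (2 * (v + 2))^-1 * ((v + 1) * (v + 2) / ((2 * v + 4) * (2 * v + 3))) * (4 * (2 * (v + 3))) =
   2 * (v + 1) * (v + 3) / ((v + 2) * (2 * v + 3)).
  by field; rewrite !gt_eqF//; lra.
by rewrite ler_pdivlMr ?mulr_gt0//; nra.
Qed.

End LinearForms.

Section LinearFormBounds.
Variable R : realType.
Implicit Types (x y K a : R) (n k m N : nat).

(** The ratios (n + 1 + k) / (x + k) grow with k, so all are at most r, the one at k = n, and r <=
    1. Two of the n + 1 >= 2 factors are kept: R_n^2 then decays like x^-4 and its tail integrals
    are summable. *)
Lemma Rfun_decay n x : (0 < n)%N -> n.+1%:R <= x ->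
  Rfun n x <= Rfun n n.+1%:R * ((2 * n%:R + 1) / (x + n%:R)) ^+ 2.
Proof.
move=> n0 nx; set r := _ / _.
have n1 : 1 <= n.+1%:R :> R by rewrite ler1n.
have x0 : 0 < x by lra.
have nn : 0 <= n%:R :> R by [].
have xn : 0 < x + n%:R by lra.
have r0 : 0 <= r by rewrite divr_ge0 ?(ltW xn)//; lra.
have r1 : r <= 1 by rewrite ler_pdivrMr// mul1r; move: nx; rewrite -natr1; lra.
have hk k : (k <= n)%N -> n.+1%:R + k%:R <= r * (x + k%:R).
  move=> kn; rewrite mulrAC ler_pdivlMr//.
  have : 0 <= (x - n.+1%:R) * (n%:R - k%:R).
    by rewrite mulr_ge0// subr_ge0// ler_nat.
  by rewrite -natr1; nra.
have hP : \prod_(0 <= k < n.+1) (n.+1%:R + k%:R) <=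
    r ^+ n.+1 * \prod_(0 <= k < n.+1) (x + k%:R).
  have -> : r ^+ n.+1 = \prod_(0 <= k < n.+1) r by rewrite prodr_const_nat subn0.
  rewrite -big_split/= big_nat_cond [leRHS]big_nat_cond.
  apply: ler_prod => k /andP[/andP[_ kn] _].
  by rewrite hk// andbT addr_ge0// ltW// ltr0n.
have P0 : 0 < \prod_(0 <= k < n.+1) (n.+1%:R + k%:R) :> R by apply: prod_shift_gt0; lra.
have Q0 : 0 < \prod_(0 <= k < n.+1) (x + k%:R) :> R by apply: prod_shift_gt0.
have rr : r ^+ n.+1 <= r ^+ 2 by apply: ler_wiXn2l.
rewrite {1 2}/Rfun -mulrA ler_wpM2l//.
rewrite ler_pdivlMl// mulrC ler_pdivrMl// .
apply: le_trans hP _; rewrite mulrC; apply: ler_wpM2l rr; exact: ltW.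
Qed.

(** Integrating the x^-4 bound gives a cube, which is weakened to 1 / (x (x + 1)) because that
    telescopes over integer x. *)
Lemma Gfun_upper n x : (0 < n)%N -> n.+1%:R <= x ->
  Gfun n x <= Rfun n n.+1%:R ^+ 2 * (2 * n%:R + 1) ^+ 4 / (x * (x + 1)).
Proof.
move=> n0 nx; set c := Rfun n _ ^+ 2 * _.
have n1 : 1 <= n.+1%:R :> R by rewrite ler1n.
have nn : 1 <= n%:R :> R by rewrite ler1n.
have c0 : 0 <= c by rewrite mulr_ge0 ?sqr_ge0// exprn_ge0//; lra.
have [K K0 hK] := Gfun_small R n.
have x0 : 0 < x by lra.
pose F y := c / 3 * (y + n%:R)^-1 ^+ 3 - Gfun n y.
have : 0 <= F x.
  apply: (@ge0_of_derive R F (fun y => - (c / (y + n%:R) ^+ 4) + Rfun n y ^+ 2) x K x0 K0).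
  - move=> y xy; have y0 : 0 < y by lra.
    have h1 := is_derive_shift_inv n y0; have h2 := is_derive_Gfun n y0.
    apply: is_derive_eq; rewrite /GRing.scale/=.
    have : y + n%:R != 0 by rewrite gt_eqF//; lra.
    by move: (y + n%:R) => z z0; field.
  - move=> y xy; have y0 : 0 < y + n%:R by lra.
    rewrite addrC subr_le0.
    have := Rfun_decay n0 (le_trans nx xy) => /(lerXn2r 2).
    rewrite !nnegrE => /(_ (ltW (Rfun_gt0 _ _)) _) h.
    apply: le_trans (h _ _) _; first by lra.
      by rewrite mulr_ge0 ?sqr_ge0// ltW// Rfun_gt0// ltr0n.
    by rewrite exprMn -exprM (expr_div_n (2 * n%:R + 1)) mulrA.
  - move=> y xy; have y0 : 0 < y by lra.
    have := hK y; rewrite ler_norml => /(_ ltac:(lra)) /andP[_ h].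
    have : 0 <= c / 3 * (y + n%:R)^-1 ^+ 3.
      by rewrite mulr_ge0 ?divr_ge0// exprn_ge0// invr_ge0; lra.
    rewrite /F; lra.
rewrite /F subr_ge0 => h; apply: le_trans h _.
have hx : x * (x + 1) <= 3 * (x + n%:R) ^+ 3.
  have h1 : x + 1 <= x + n%:R by lra.
  have h2 : x * (x + 1) <= (x + n%:R) * (x + n%:R) by apply: ler_pM; lra.
  have h3 : 1 <= x + n%:R by lra.
  apply: le_trans h2 _; move: h3; move: (x + n%:R) => z z1.
  have zz : 0 <= z * z by rewrite -expr2 sqr_ge0.
  have : z * z <= z * z * z by rewrite ler_peMr.
  by rewrite !exprS expr0 mulr1 mulrA; lra.
rewrite -mulrA ler_wpM2l// exprVn -invfM lef_pV2 ?posrE//.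
  by rewrite mulr_gt0// exprn_gt0//; lra.
by rewrite mulr_gt0//; lra.
Qed.

Lemma Gfun_sum_upper n N : (0 < n)%N ->
  \sum_(n.+1 <= v < N.+1) Gfun n (v%:R : R) <= Rfun n n.+1%:R ^+ 2 * (2 * n%:R + 1) ^+ 4.
Proof.
move=> n0; set c := _ * _.
have c0 : 0 <= c by rewrite mulr_ge0 ?sqr_ge0// exprn_ge0// addr_ge0// mulr_ge0.
have [Nn|nN] := leqP N n; first by rewrite big_geq.
suff h : \sum_(n.+1 <= v < N.+1) Gfun n (v%:R : R) <= c * (n.+1%:R^-1 - N.+1%:R^-1).
  apply: le_trans h _; rewrite ler_piMr//.
  have h1 : n.+1%:R^-1 <= 1 :> R by rewrite invf_le1 ?ltr0n// ler1n.
  have h2 : 0 <= N.+1%:R^-1 :> R by rewrite invr_ge0.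
  by rewrite lerBlDr (le_trans h1)// lerDl.
elim: N nN => // N IH nN; rewrite big_nat_recr/=; last by lia.
have IH' : \sum_(n.+1 <= i < N.+1) Gfun n (i%:R : R) <= c * (n.+1%:R^-1 - N.+1%:R^-1).
  move: nN; rewrite ltnS leq_eqVlt => /orP[/eqP <-|]; last exact: IH.
  by rewrite big_geq// subrr mulr0.
have nx : n.+1%:R <= N.+1%:R :> R by rewrite ler_nat; lia.
apply: le_trans (lerD IH' (Gfun_upper n0 nx)) _.
rewrite -mulrDr ler_wpM2l// natr1.
have : N.+1%:R != 0 :> R by rewrite pnatr_eq0.
have : N.+2%:R != 0 :> R by rewrite pnatr_eq0.
have : N.+2%:R = N.+1%:R + 1 :> R by rewrite natr1.
move: (N.+1%:R) (N.+2%:R) => u w -> w0 u0.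
rewrite -addrA lerD2l le_eqVlt; apply/orP; left; apply/eqP; field.
by rewrite u0 w0.
Qed.

(** All terms but v = n + 1 are dropped, and of that integral only the part over [n + 1, n + 2] is
    kept, where R_n is at least its value at n + 2. *)
Lemma Gfun_sum_lower n N : (n < N)%N ->
  Rfun n (n.+2%:R : R) ^+ 2 <= \sum_(n.+1 <= v < N.+1) Gfun n (v%:R : R).
Proof.
move=> nN; rewrite big_nat_recl// -[leLHS]addr0; apply: lerD; last first.
  by rewrite big_nat_cond sumr_ge0// => i _; rewrite Gfun_ge0// ler1n.
have ax : n.+1%:R < n.+2%:R :> R by rewrite ltr_nat.
have a0 : 0 < n.+1%:R :> R by rewrite ltr0n.
have [c] : exists2 c, c \in `]n.+1%:R, n.+2%:R[%R &
    Gfun n (n.+2%:R : R) - Gfun n (n.+1%:R : R) = - Rfun n c ^+ 2 * (n.+2%:R - n.+1%:R).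
  apply: (MVT ax) => [y|].
    by rewrite in_itv/= => /andP[ay _]; apply: is_derive_Gfun; lra.
  apply: derivable_within_continuous => y; rewrite in_itv/= => /andP[ay _].
  have dFy := is_derive_Gfun n (lt_le_trans a0 ay); exact: ex_derive.
rewrite in_itv/= => /andP[c1 c2].
have -> : n.+2%:R - n.+1%:R = 1 :> R by rewrite -natr1 addrAC subrr add0r.
rewrite mulr1 => h.
have g0 : 0 <= Gfun n (n.+2%:R : R) :> R by rewrite Gfun_ge0// ler1n.
have : Rfun n (n.+2%:R : R) ^+ 2 <= Rfun n c ^+ 2.
  rewrite lerXn2r// ?nnegrE; try by apply: ltW; apply: Rfun_gt0; lra.
  by apply: Rfun_decr; lra.
by lra.
Qed.

End LinearFormBounds.

(** * Euler's constant as the limit in the summed integrals *)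

Section EulerGamma.
Variable R : realType.
Implicit Types (n k m N : nat).

Definition gamma_seq N : R := harm R N - ln N%:R.

(** [euler_gamma] is a [lim], so convergence has to be established before it can be used.
    Monotonicity holds only from index 1: at 0 the convention [ln 0 = 0] gives the value 0, below
    the value 1 at index 1. *)
Lemma gamma_seq_cvg : gamma_seq N @[N --> \oo] --> (euler_gamma : R).
Proof.
have e : gamma_seq = (fun N => series harmonic N - ln N%:R).
  by apply/funext => N; rewrite /gamma_seq /harm /series/= big_add1.
suff : cvgn gamma_seq by rewrite e.
suff /cvg_ex[l hl] : cvgn (fun n => gamma_seq n.+1).
  by apply/cvg_ex; exists l; rewrite -cvg_shiftS.
apply: nonincreasing_is_cvgn.
  apply/nonincreasing_seqP => n; rewrite /gamma_seq harmS -addrA lerD2l.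
  have n0 : 0 < n.+2%:R :> R by rewrite ltr0n.
  have -> : ln n.+1%:R = ln n.+2%:R + ln (1 + - n.+2%:R^-1) :> R.
    have h : 1 + - n.+2%:R^-1 = n.+1%:R / n.+2%:R :> R.
      have e2 : n.+2%:R = n.+1%:R + 1 :> R by rewrite natr1.
      by rewrite e2 in n0 *; field; rewrite gt_eqF.
    by rewrite h ln_div ?posrE// addrC subrK.
  have : ln (1 + - n.+2%:R^-1) <= - n.+2%:R^-1 :> R.
    by apply: le_ln1Dx; rewrite ltrN2 invf_lt1// ltr1n.
  by move: (n.+2%:R^-1) => u; lra.
exists 0 => _ [n _ <-]; rewrite /gamma_seq subr_ge0.
suff h : ln n.+1%:R <= harm R n by rewrite (le_trans h)// harmS lerDl.
elim: n => [|n IH]; first by rewrite ln1 /harm big_geq.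
rewrite harmS lnS_ell// lerD//.
by have [_ h _] := @ell_bounds R n.+1 isT.
Qed.

Lemma ln_shift_cvg k : (ln (N + k)%:R - ln N%:R : R) @[N --> \oo] --> 0.
Proof.
elim: k => [|k IH].
  by under eq_fun do rewrite addn0 subrr; exact: cvg_cst.
have -> : (fun N => ln (N + k.+1)%:R - ln N%:R : R) =
   (fun N => (ln (N + k).+1%:R - ln (N + k)%:R) + (ln (N + k)%:R - ln N%:R)).
  by apply/funext => N; rewrite addnS; lra.
rewrite -[0]addr0; apply: cvgD IH.
rewrite (cvg_shiftn k (fun N => ln N.+1%:R - ln N%:R : R)).
rewrite -cvg_shiftS.
apply: (squeeze_cvgr _ (cvg_cst 0) (@cvg_harmonic R)).
near=> N; rewrite /= lnS_ell// addrAC subrr add0r.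
by have [-> -> _] := @ell_bounds R N.+1 isT.
Unshelve. all: by end_near. Qed.

Definition lnfact m : R := ln m`!%:R.

Lemma lnfactS m : lnfact m.+1 = lnfact m + ln m.+1%:R.
Proof. by rewrite /lnfact factS natrM lnM ?posrE ?ltr0n ?fact_gt0// addrC. Qed.

Lemma lnfactD n k : lnfact (n + k) = lnfact n + \sum_(1 <= m < k.+1) ln (n + m)%:R.
Proof.
elim: k => [|k IH]; first by rewrite addn0 big_geq// addr0.
by rewrite big_nat_recr//= addrA -IH addnS lnfactS.
Qed.

Lemma lnfact_shift_cvg k :
  (lnfact (N + k) - lnfact N - k%:R * ln N%:R) @[N --> \oo] --> 0.
Proof.
elim: k => [|k IH].
  by under eq_fun do rewrite addn0 subrr mul0r subrr; exact: cvg_cst.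
have -> : (fun N => lnfact (N + k.+1) - lnfact N - k.+1%:R * ln N%:R) =
   (fun N => (lnfact (N + k) - lnfact N - k%:R * ln N%:R) + (ln (N + k.+1)%:R - ln N%:R)).
  by apply/funext => N; rewrite addnS lnfactS -natr1; lra.
by rewrite -[0]addr0; apply: cvgD (ln_shift_cvg _).
Qed.

Lemma Gfun_sum n N : (n <= N)%N ->
  \sum_(n.+1 <= v < N.+1) Gfun n (v%:R : R) =
  \sum_(0 <= k < n.+1) (pfA R n k * (harm R (N + k) - harm R (n + k))
     - pfB R n k * (lnfact (N + k) - lnfact (n + k))).
Proof.
elim: N => [|N IH]; rewrite ?leqn0.
  move=> /eqP ->; rewrite big_geq// big1// => k _; ring.
rewrite leq_eqVlt => /orP[/eqP <-|nN].
  by rewrite big_geq// big1// => k _; ring.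
rewrite big_nat_recr//= (IH nN) /Gfun -big_split/=; apply: eq_bigr => k _.
by rewrite addSn harmS lnfactS -natrD addSn; ring.
Qed.

End EulerGamma.

Section LinearForm.
Variable R : realType.
Implicit Types (n k m N : nat).
Local Notation harm := (harm R).
Local Notation pfA := (pfA R).
Local Notation pfB := (pfB R).
Local Notation lnfact := (lnfact R).

Lemma cvg_sum_nat (f : nat -> nat -> R) (l : nat -> R) m :
  (forall k, f k N @[N --> \oo] --> l k) ->
  (\sum_(0 <= k < m) f k N) @[N --> \oo] --> \sum_(0 <= k < m) l k.
Proof.
move=> h; elim: m => [|m IH].
  by rewrite big_geq//; under eq_fun do rewrite big_geq//; exact: cvg_cst.
rewrite big_nat_recr//=; under eq_fun do rewrite big_nat_recr//=.
exact: cvgD.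
Qed.

(** A convergent sequence plus D ln N stays bounded only if D = 0. Boundedness of the sums of [Gfun]
    thus yields the identity sum (pfA - k pfB) = 0 without an algebraic computation. *)
Lemma bounded_log_cvg (T : nat -> R) (l D c C : R) (N0 : nat) :
  T N @[N --> \oo] --> l ->
  (forall N, (N0 <= N)%N -> c <= T N + D * ln N%:R <= C) -> D = 0 /\ c <= l <= C.
Proof.
move=> Tl hT; have D0 : D = 0.
  apply/eqP/negPn/negP => Dn0.
  have := @cvgr_dist_le _ _ _ _ _ _ _ Tl 1 ltr01 => -[N1 _ hN1].
  pose M := `|l| + 1 + `|c| + `|C|.
  have [N2 _ hN2] := ln_unbounded ((M + 1) / `|D|).
  pose N := maxn N0 (maxn N1 N2).
  have hN0 : (N0 <= N)%N by rewrite leq_maxl.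
  have {}hN1 : `|l - T N| <= 1 by apply: hN1; rewrite /= /N !leq_max leqnn !orbT.
  have {hN2} : (M + 1) / `|D| <= ln N%:R by apply: hN2; rewrite /N !leq_max leqnn !orbT.
  rewrite ler_pdivrMr ?normr_gt0// => h1.
  have {}hT := hT _ hN0.
  have : `|D * ln N%:R| <= M.
    rewrite /M; move: hT hN1; move: (ln N%:R) (T N) => L t.
    rewrite ler_norml => /andP[a1 a2] /andP[a3 a4].
    have := ler_norm l; have := ler_norm c; have := ler_norm C.
    have := lerNnormlW (lexx `|l|); have := lerNnormlW (lexx `|c|); have := lerNnormlW (lexx `|C|).
    by rewrite ler_norml => *; apply/andP; split; lra.
  by rewrite normrM (ger0_norm (ln_ge0_nat R _)) mulrC; lra.
split=> //; apply/andP; split.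
  apply: (cvgr_to_ge Tl); exists N0 => // N /= NN.
  by have /andP[] := hT N NN; rewrite D0 mul0r addr0.
apply: (cvgr_to_le Tl); exists N0 => // N /= NN.
by have /andP[] := hT N NN; rewrite D0 mul0r addr0.
Qed.

Definition linform n : R :=
  (\sum_(0 <= k < n.+1) pfA n k) * euler_gamma
  - \sum_(0 <= k < n.+1) pfA n k * harm (n + k)
  + \sum_(0 <= k < n.+1) pfB n k * lnfact (n + k).

Lemma linform_bounds n : (0 < n)%N ->
  Rfun n (n.+2%:R : R) ^+ 2 <= linform n <=
  Rfun n n.+1%:R ^+ 2 * (2 * n%:R + 1) ^+ 4.
Proof.
move=> n0.
(* The sum of [Gfun] up to N is [T N + D * ln N]: all multiples of ln N are set apart in [D], and
   every piece of [T] converges. *)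
pose T N := \sum_(0 <= k < n.+1) (pfA n k * (gamma_seq R (N + k) + (ln (N + k)%:R - ln N%:R))
   - pfB n k * (lnfact (N + k) - lnfact N - k%:R * ln N%:R))
   - \sum_(0 <= k < n.+1) (pfA n k * harm (n + k) - pfB n k * lnfact (n + k)).
have Tl : T N @[N --> \oo] --> linform n.
  have -> : linform n = \sum_(0 <= k < n.+1) (pfA n k * (euler_gamma + 0) - pfB n k * 0)
    - \sum_(0 <= k < n.+1) (pfA n k * harm (n + k) - pfB n k * lnfact (n + k)).
    rewrite /linform mulr_suml -sumrB -big_split -sumrB/=.
    by apply: eq_bigr => k _; ring.
  apply: cvgB; last exact: cvg_cst.
  apply: cvg_sum_nat => k; apply: cvgB; apply: cvgMr.
    apply: cvgD; last exact: ln_shift_cvg.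
    by rewrite (cvg_shiftn k (gamma_seq R)); exact: gamma_seq_cvg.
  exact: lnfact_shift_cvg.
pose D := \sum_(0 <= k < n.+1) (pfA n k - k%:R * pfB n k).
apply: (proj2 (@bounded_log_cvg T _ D _ _ n.+1 Tl _)) => N nN.
have <- : \sum_(n.+1 <= v < N.+1) Gfun n (v%:R : R) = T N + D * ln N%:R.
  rewrite Gfun_sum; last exact: ltnW.
  have -> : T N + D * ln N%:R = T N + D * ln N%:R - \sum_(0 <= k < n.+1) pfB n k * lnfact N.
    by rewrite -mulr_suml sum_pfB mul0r subr0.
  rewrite /T /D mulr_suml -!sumrB -!big_split/= -sumrB.
  by apply: eq_bigr => k _; rewrite /gamma_seq; ring.
by rewrite Gfun_sum_lower// Gfun_sum_upper.
Qed.

End LinearForm.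

(** * Arithmetic of the coefficients and the integer S_n *)

Section Integrality.
Variable R : realType.
Implicit Types (n k m N d : nat).
Local Notation harm := (harm R).
Local Notation pfA := (pfA R).
Local Notation pfB := (pfB R).
Local Notation lnfact := (lnfact R).

Lemma natr_divn d j : (0 < j)%N -> (j %| d)%N -> (d %/ j)%:R = d%:R / j%:R :> R.
Proof.
move=> j0 /divnK {2}<-; rewrite natrM mulfK//.
by rewrite pnatr_eq0 -lt0n.
Qed.

Lemma lcm_harm_nat N m : (m <= N)%N -> exists c, (lcm_upto N)%:R * harm m = c%:R.
Proof.
move=> mN; exists (\sum_(1 <= j < m.+1) lcm_upto N %/ j)%N.
rewrite natr_sum /harm mulr_sumr; apply: eq_big_nat => j /andP[j0 jm].
by rewrite natr_divn// dvdn_lcm_upto// j0/=; lia.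
Qed.

Lemma prodn_nat_gt0 (F : nat -> nat) m N : (forall i, (m <= i < N)%N -> (0 < F i)%N) ->
  (0 < \prod_(m <= i < N) F i)%N.
Proof. by move=> h; rewrite big_nat_cond prodn_cond_gt0// => i; rewrite andbT => /h. Qed.

Lemma ln_prod_nat (F : nat -> nat) m N : (forall i, (m <= i < N)%N -> (0 < F i)%N) ->
  ln (\prod_(m <= i < N) F i)%:R = \sum_(m <= i < N) ln (F i)%:R :> R.
Proof.
elim: N => [|N IH] h; first by rewrite !big_geq// ln1.
have [mN|Nm] := leqP m N; last by rewrite !big_geq// ln1.
have h' i : (m <= i < N)%N -> (0 < F i)%N by move=> hi; apply: h; lia.
rewrite !big_nat_recr//= natrM lnM ?posrE ?ltr0n ?IH//; last by apply: h; lia.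
exact: prodn_nat_gt0.
Qed.

(** Explains the range of k in S_n. As the total vanishes, the tail from m is minus the sum over k <
    m; if m - 1 > n - m, the block n - m < k < m is symmetric under k -> n - k and cancels. *)
Lemma sum_pfB_tail n m : (0 < m <= n)%N ->
  \sum_(0 <= k < n.+1 | (m <= k)%N) pfB n k =
  \sum_(0 <= k < (minn m.-1 (n - m)).+1) - pfB n k.
Proof.
move=> /andP[m0 mn].
have e : \sum_(0 <= k < n.+1 | (m <= k)%N) pfB n k = - \sum_(0 <= k < m) pfB n k.
  have := sum_pfB R n; rewrite (bigID (fun k => (m <= k)%N))/= => /eqP.
  rewrite addr_eq0 => /eqP ->; congr (- _).
  rewrite [RHS](big_nat_widen _ _ n.+1); last exact: leqW.
  by apply: eq_bigl => k; rewrite ltnNge.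
rewrite e sumrN; congr (- _).
have [h|h] := leqP m.-1 (n - m); first by rewrite prednK.
rewrite (@big_cat_nat _ _ _ (n - m).+1)//=; last by lia.
rewrite [X in _ + X](_ : _ = 0) ?addr0//.
set s := \sum_(_ <= _ < _) _; suff : s = - s by lra.
rewrite {1}/s big_nat_rev/= -sumrN; apply: eq_big_nat => k /andP[k1 k2].
by rewrite -pfB_rev; [congr (pfB _ _); lia|lia].
Qed.

(** Summation by parts: ln (n + k)! is ln n! plus the logarithms of n + m for m <= k, and the
    constant part is annihilated by [sum_pfB]. *)
Lemma sum_pfB_lnfact n : \sum_(0 <= k < n.+1) pfB n k * lnfact (n + k) =
  \sum_(1 <= m < n.+1) ln (n + m)%:R * \sum_(0 <= k < (minn m.-1 (n - m)).+1) - pfB n k.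
Proof.
under eq_bigr do rewrite lnfactD mulrDr.
rewrite big_split/= -mulr_suml sum_pfB mul0r add0r.
have -> : \sum_(0 <= k < n.+1) pfB n k * \sum_(1 <= m < k.+1) ln (n + m)%:R =
  \sum_(0 <= k < n.+1) \sum_(1 <= m < n.+1) (if (m <= k)%N then pfB n k * ln (n + m)%:R else 0).
  apply: eq_big_nat => k kn; rewrite mulr_sumr -big_mkcond/=.
  by rewrite (big_nat_widen _ _ n.+1)//; case/andP: kn.
rewrite exchange_big/=; apply: eq_big_nat => m hm.
by rewrite -sum_pfB_tail// -big_mkcond/= mulr_sumr; apply: eq_bigr => k _; rewrite mulrC.
Qed.

Lemma ln_S_prod n :
  ln (S_prod n)%:R = (lcm_upto (2 * n))%:R * \sum_(0 <= k < n.+1) pfB n k * lnfact (n + k).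
Proof.
rewrite sum_pfB_lnfact mulr_sumr /S_prod ln_prod_nat; last first.
  move=> m /andP[m0 _]; apply: prodn_nat_gt0 => k _; apply: prodn_nat_gt0 => j _.
  by rewrite expn_gt0 addn_gt0 m0 orbT.
apply: eq_big_nat => m /andP[m0 mn].
rewrite ln_prod_nat; last first.
  by move=> k _; apply: prodn_nat_gt0 => j _; rewrite expn_gt0 addn_gt0 m0 orbT.
rewrite !mulr_sumr; apply: eq_big_nat => k /andP[_ kn].
rewrite ln_prod_nat; last by move=> j _; rewrite expn_gt0 addn_gt0 m0 orbT.
have -> : - pfB n k = 2 * pfA n k * \sum_(k.+1 <= j < (n - k).+1) j%:R^-1.
  rewrite /pfB {2}/harm (@big_cat_nat _ _ _ k.+1)//=; last by lia.
  by rewrite /harm; ring.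
rewrite !mulr_sumr; apply: eq_big_nat => j /andP[j1 j2].
rewrite natrX lnXn; last by rewrite ltr0n; lia.
rewrite -[X in X = _]mulr_natl natrM natr_divn; [|lia|].
  by rewrite /pfA natrX natrM; ring.
by rewrite dvdn_mull// dvdn_lcm_upto//; lia.
Qed.

(** Equal to the central binomial coefficient C(2n, n), so the bound 4^n of [apery_le] is sharp on
    the exponential scale. *)
Definition apery n : nat := (\sum_(0 <= k < n.+1) 'C(n, k) ^ 2)%N.

Lemma linform_int n : exists P : int, (lcm_upto (2 * n))%:R * linform R n =
  (lcm_upto (2 * n) * apery n)%:R * euler_gamma - P%:~R + ln (S_prod n)%:R.
Proof.
have hc k : exists c, (k <= n)%N -> (lcm_upto (2 * n))%:R * harm (n + k) = c%:R.
  have [kn|_] := leqP k n; last by exists 0%N.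
  by have [|c hc] := @lcm_harm_nat (2 * n) (n + k); [lia|exists c].
have [c {}hc] := choice hc.
exists (\sum_(0 <= k < n.+1) 'C(n, k) ^ 2 * c k)%N.
rewrite /linform mulrDr mulrBr -ln_S_prod -pmulrn natr_sum !mulr_sumr.
congr (_ - _ + _).
  by rewrite mulrA natrM natr_sum; congr (_ * _ * _); apply: eq_bigr => k _; rewrite natrX.
apply: eq_big_nat => k /andP[_ kn]; rewrite mulrCA hc//.
by rewrite natrM natrX.
Qed.

Lemma apery_le n : (apery n <= 4 ^ n)%N.
Proof.
have e : (\sum_(0 <= k < n.+1) 'C(n, k) = 2 ^ n)%N.
  by rewrite -[2%N]/(1 + 1)%N expnDn big_mkord; apply: eq_bigr => i _; rewrite !exp1n !muln1.
rewrite (_ : 4 = 2 ^ 2)%N// -expnM mulnC expnM -e /apery expnS expn1 big_distrl/=.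
apply: leq_sum => k _; rewrite expnS expn1 leq_mul2l.
have [kn|nk] := leqP k n; last by rewrite bin_small.
by rewrite big_mkord (bigD1 (Ordinal (kn : (k < n.+1)%N)))//= leq_addr orbT.
Qed.

End Integrality.

(** * Irrationality exponent from the linear forms *)

Section Measure.
Variable R : realType.
Implicit Types (alpha kappa delta e eps E z : R) (k K n : nat).

Lemma two_form_lower_bound alpha E z (P Q p : int) (n : nat) : (0 < n)%N ->
  `|Q%:~R| <= E -> 0 < z -> z <= `|Q%:~R * alpha - P%:~R| ->
  `|Q%:~R * alpha - P%:~R| <= (2 * n%:R)^-1 ->
  Num.min z (2 * n%:R)^-1 <= E * `|alpha - p%:~R / n%:R|.
Proof.
move=> n0 hQ z0 hz hn; set zeta := Q%:~R * alpha - P%:~R in hz hn *.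
have nR : 0 < n%:R :> R by rewrite ltr0n.
have n1 : n%:R != 0 :> R by rewrite gt_eqF.
apply: le_trans (ler_wpM2r _ hQ); last exact: normr_ge0.
rewrite -normrM.
have e : Q%:~R * (alpha - p%:~R / n%:R) = zeta + (P * n - Q * p)%:~R / n%:R.
  by rewrite rmorphB /= !rmorphM/= -pmulrn /zeta; field.
rewrite e; have [h0|h0] := eqVneq (P * n - Q * p) 0.
  by rewrite h0 mul0r addr0 ge_min hz.
rewrite ge_min; apply/orP; right.
have h1 : n%:R^-1 <= `|(P * n - Q * p)%:~R / n%:R| :> R.
  rewrite normrM normfV (ger0_norm (ltW nR)) ler_peMl ?invr_ge0 ?ler0n//.
  by rewrite -intr_norm ler1z -gtz0_ge1 normr_gt0.
have e2 : n%:R^-1 = (2 * n%:R)^-1 + (2 * n%:R)^-1 :> R by field.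
have := lerB_normD ((P * n - Q * p)%:~R / n%:R) zeta; rewrite [_ / _ + zeta]addrC.
by move: h1 hn; rewrite e2; lra.
Qed.

Lemma approx_exponent_of_forms alpha kappa delta (Q P : nat -> int) :
  0 <= kappa -> 0 < delta ->
  (forall e, 0 < e -> exists K, forall k, (K <= k)%N ->
     [/\ `|(Q k)%:~R| <= expR ((kappa + e) * k%:R),
         expR (- ((delta + e) * k%:R)) <= `|(Q k)%:~R * alpha - (P k)%:~R|
       & `|(Q k)%:~R * alpha - (P k)%:~R| <= expR (- ((delta - e) * k%:R))]) ->
  approx_exponent alpha (1 + kappa / delta).
Proof.
move=> k0 d0 hyp eps eps0.
set M := 1 + kappa / delta; have M1 : 0 <= kappa / delta by rewrite divr_ge0// ltW.
have de : 0 < delta * eps by rewrite mulr_gt0.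
(* With e = delta^2 eps / den the inequality [slope] below is an equality. *)
pose den := 6 * delta + 2 * kappa + delta * eps.
have den0 : 0 < den by rewrite /den; lra.
pose e := delta * (delta * eps) / den.
have e0 : 0 < e by rewrite divr_gt0// mulr_gt0.
have ed : e < delta.
  by rewrite /e ltr_pdivrMr// ltr_pM2l// /den; lra.
have dem : 0 < delta - e by rewrite subr_gt0.
have slope : (delta + kappa + 2 * e) / (delta - e) <= M + eps / 2.
  rewrite ler_pdivrMr// /M.
  have : e * den = delta * (delta * eps) by rewrite /e divfK// gt_eqF.
  have kd : kappa / delta * delta = kappa by rewrite divfK// gt_eqF.
  rewrite /den -(ler_pM2l d0) => h.
  have -> : delta * ((1 + kappa / delta + eps / 2) * (delta - e)) =
    (delta + kappa / delta * delta + delta * eps / 2) * (delta - e) by ring.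
  rewrite kd; nra.
have [K hK] := hyp e e0.
pose c := delta + kappa + 2 * e.
pose B := (M + eps / 2) * ln 2 + c.
have [N0 N00 hN0] := ln_unbounded (Num.max (2 / eps * (B + 1)) ((delta - e) * K%:R)).
exists N0%:Z; split=> [|p [n|//]]; first by rewrite ltz_nat.
rewrite lez_nat => Nn; have n0 : (0 < n)%N by exact: leq_trans Nn.
rewrite -pmulrn; have nR : 0 < n%:R :> R by rewrite ltr0n.
have := hN0 n Nn; rewrite ge_max => /andP[hB hKn].
have ln2 : 0 <= ln 2 :> R by rewrite ln_ge0//; lra.
pose L := ln n%:R + ln 2 : R.
have eL : (2 * n%:R)^-1 = expR (- L) :> R.
  by rewrite /L -lnM ?posrE// expRN lnK ?posrE ?mulr_gt0// mulrC.
have L0 : 0 <= L by rewrite addr_ge0// ln_ge0_nat.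
(* The first index whose upper bound falls below 1 / (2 n) = e^(-L); minimality keeps k at most L /
   (delta - e) + 1. *)
pose k := (Num.truncn (L / (delta - e))).+1.
have Ld0 : 0 <= L / (delta - e) by rewrite divr_ge0// ltW.
have /andP[k1 k2] := truncn_itv Ld0; rewrite -/k in k2.
have Kk : (K <= k)%N.
  rewrite -(ler_nat R) (le_trans _ (ltW k2))// ler_pdivlMr// mulrC /L.
  by rewrite (le_trans hKn)// lerDl.
have {hK}[hQ hlow hup] := hK k Kk.
have k3 : L < (delta - e) * k%:R by rewrite mulrC -ltr_pdivrMr.
have k4 : k%:R <= L / (delta - e) + 1 by rewrite /k -natr1 lerD2r.
have hup' : `|(Q k)%:~R * alpha - (P k)%:~R| <= (2 * n%:R)^-1.
  by rewrite (le_trans hup)// eL ler_expR lerN2 ltW.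
have := two_form_lower_bound p n0 hQ (expR_gt0 _) hlow hup'.
rewrite eL; set m := Num.min _ _ => hm.
have mlow : expR (- ((delta + e) * k%:R)) <= m.
  rewrite /m le_min lexx ler_expR lerN2 (le_trans (ltW k3))// ler_wpM2r//; lra.
have {}hm : expR (- ((delta + e) * k%:R)) <= expR ((kappa + e) * k%:R) * `|alpha - p%:~R / n%:R|.
  exact: le_trans hm.
have h2 : expR (- (c * k%:R)) <= `|alpha - p%:~R / n%:R|.
  rewrite -(ler_pM2l (expR_gt0 ((kappa + e) * k%:R))) -expRD.
  by have -> : (kappa + e) * k%:R + - (c * k%:R) = - ((delta + e) * k%:R) by [rewrite /c; ring].
apply: lt_le_trans h2.
rewrite /powR gt_eqF// div1r -expRN ltr_expR ltrN2.
have c0 : 0 <= c by rewrite /c; lra.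
have h3 : c * k%:R <= c * (L / (delta - e) + 1) by rewrite ler_wpM2l.
apply: le_lt_trans h3 _.
have -> : c * (L / (delta - e) + 1) = c / (delta - e) * L + c by field; rewrite gt_eqF.
have h4 : c / (delta - e) * L <= (M + eps / 2) * L by rewrite ler_wpM2r.
have h5 : B + 1 <= eps / 2 * ln n%:R.
  move: hB; rewrite -(@ler_pM2l _ (eps / 2)); last by rewrite divr_gt0.
  have -> // : eps / 2 * (2 / eps * (B + 1)) = B + 1 by field; rewrite gt_eqF.
move: h4 h5; rewrite /B /L mulrDr; move: (ln n%:R) => l.
by nra.
Qed.

End Measure.

(** * Exponential rates of the forms *)

Section LinearFormRate.
Variable R : realType.
Implicit Types (n N : nat) (e : R).

Lemma ln4_gt1 : 1 < ln 4 :> R.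
Proof.
have h : expR (- 2^-1) > 1 + - 2^-1 :> R by apply: expR_gt1Dx; rewrite oppr_eq0 invr_eq0 pnatr_eq0.
have -> : 4 = 2 * 2 :> R by lra.
rewrite lnM ?posrE//.
suff : 2^-1 < ln 2 :> R by lra.
rewrite -ltr_expR lnK ?posrE//.
move: h; rewrite expRN => h.
have e0 := expR_gt0 (2^-1 : R).
have : (1 + - 2^-1) * expR (2^-1) < 1 :> R by rewrite -ltr_pdivlMr// mul1r.
by lra.
Qed.

Lemma ln_le_linear e : 0 < e -> exists N, forall n, (N <= n)%N -> ln (2 * n%:R + 4) <= e * n%:R.
Proof.
move=> e0; pose A := 4 / e; have A0 : 0 < A by rewrite divr_gt0.
pose N := (Num.truncn ((e + ln A) / (e / 2))).+1.
have hN : (e + ln A) / (e / 2) <= N%:R by exact/ltW/truncnS_gt.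
exists N => n Nn; have n0 : 0 <= n%:R :> R by [].
have x0 : 0 < 2 * n%:R + 4 :> R by lra.
have h : ln ((2 * n%:R + 4) / A) <= (2 * n%:R + 4) / A.
  have u0 : 0 < (2 * n%:R + 4) / A by rewrite divr_gt0.
  move: u0; move: (_ / _) => u u0; have -> : u = 1 + (u - 1) by ring.
  by rewrite (le_trans (le_ln1Dx _))//; lra.
move: h; rewrite ln_div ?posrE// lerBlDr => h; apply: le_trans h _.
have -> : (2 * n%:R + 4) / A = e / 2 * n%:R + e by rewrite /A; field; rewrite gt_eqF.
have : (e + ln A) / (e / 2) <= n%:R by rewrite (le_trans hN)// ler_nat.
by rewrite ler_pdivrMr ?divr_gt0//; lra.
Qed.

Lemma ln_linform n : (0 < n)%N ->
  0 < linform R n /\ `|ln (linform R n) + 2 * n%:R * ln 4| <= 4 * ln (2 * n%:R + 4).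
Proof.
move=> n0; have /andP[lo up] := linform_bounds R n0.
have nn : 0 <= n%:R :> R by [].
have r0 : 0 < Rfun n (n.+2%:R : R) by rewrite Rfun_gt0// ltr0n.
have r1 : 0 < Rfun n (n.+1%:R : R) by rewrite Rfun_gt0// ltr0n.
have l0 : 0 < linform R n by apply: lt_le_trans lo; rewrite exprn_gt0.
split=> //.
have hp : 0 < 4^-1 ^+ n :> R by rewrite exprn_gt0// invr_gt0.
have lp : ln (4^-1 ^+ n) = - (n%:R * ln 4) :> R.
  by rewrite lnXn ?invr_gt0// lnV ?posrE// mulNrn mulr_natl.
have x0 : 0 < 2 * n%:R + 4 :> R by lra.
have lo' : - (n%:R * ln 4) - ln (2 * n%:R + 4) <= ln (Rfun n (n.+2%:R : R)).
  rewrite -lp -ln_div ?posrE// ler_ln ?posrE ?(divr_gt0 hp x0)//.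
  by have -> : 2 * n%:R + 4 = 2 * (n%:R + 2) :> R; [ring|exact: Rfun_lower].
have up' : ln (Rfun n (n.+1%:R : R)) <= - (n%:R * ln 4).
  by rewrite -lp ler_ln ?posrE//; exact: Rfun_upper.
have y0 : 0 < 2 * n%:R + 1 :> R by lra.
have h1 : ln (linform R n) <= 2 * ln (Rfun n (n.+1%:R : R)) + 4 * ln (2 * n%:R + 1).
  apply: (@le_trans _ _ (ln (Rfun n (n.+1%:R : R) ^+ 2 * (2 * n%:R + 1) ^+ 4))).
    by rewrite ler_ln ?posrE// mulr_gt0// exprn_gt0.
  by rewrite lnM ?posrE ?exprn_gt0// !lnXn// !mulr_natl.
have h2 : 2 * ln (Rfun n (n.+2%:R : R)) <= ln (linform R n).
  by rewrite mulr_natl -lnXn// ler_ln ?posrE ?exprn_gt0.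
have h3 : ln (2 * n%:R + 1) <= ln (2 * n%:R + 4) :> R by rewrite ler_ln ?posrE//; lra.
have h4 : 0 <= ln (2 * n%:R + 4) :> R by rewrite ln_ge0//; lra.
by rewrite ler_norml; apply/andP; split; lra.
Qed.

Lemma ln_lcm_linform e : 0 < e -> exists N, forall n, (N <= n)%N -> (0 < n)%N ->
  0 < (lcm_upto (2 * n))%:R * linform R n /\
  `|ln ((lcm_upto (2 * n))%:R * linform R n) + 2 * n%:R * (ln 4 - 1)| <= e * n%:R.
Proof.
move=> e0; have e4 : 0 < e / 4 by lra.
have e8 : 0 < e / 8 by lra.
have [N1 hN1] := prime_number_theorem e4; have [N2 hN2] := ln_le_linear e8.
exists (maxn N1 N2) => n; rewrite geq_max => /andP[h1 h2] n0.
have [l0 hl] := ln_linform n0.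
have d0 : 0 < (lcm_upto (2 * n))%:R :> R by rewrite ltr0n lcm_upto_gt0.
split; first exact: mulr_gt0.
have := hN1 (2 * n)%N (leq_trans h1 (leq_pmull _ _)) => /(_ isT).
have := hN2 n h2; move: hl; rewrite lnM ?posrE// natrM !ler_norml.
move: (ln (lcm_upto _)%:R) (ln (linform R n)) (ln 4) (ln (_ + _)) n%:R => u v w t m.
by move=> /andP[a1 a2] a3 /andP[a4 a5]; apply/andP; split; lra.
Qed.

End LinearFormRate.

Section Rates.
Variable R : realType.
Implicit Types (u v : nat -> R) (k K n : nat) (e rho tau sigma c : R).

(** |u k| = exp (- rho k + o(k)) from both sides; in particular u k is eventually nonzero. *)
Definition has_rate u rho := forall e, 0 < e -> exists K, forall k, (K <= k)%N ->
  expR (- ((rho + e) * k%:R)) <= `|u k| <= expR (- ((rho - e) * k%:R)).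

Lemma ler_large_mul c e : 0 < e -> exists K, forall k, (K <= k)%N -> c <= e * k%:R.
Proof.
move=> e0; exists (Num.truncn (c / e)).+1 => k Kk.
rewrite mulrC -ler_pdivrMr//.
by apply: (le_trans (ltW (truncnS_gt _))); rewrite ler_nat.
Qed.

Lemma has_rate_of_ln u rho :
  (forall e, 0 < e -> exists K, forall k, (K <= k)%N ->
     u k != 0 /\ `|ln `|u k| + rho * k%:R| <= e * k%:R) -> has_rate u rho.
Proof.
move=> h e e0; have [K hK] := h e e0; exists K => k Kk.
have [u0 hl] := hK k Kk; have a0 : 0 < `|u k| by rewrite normr_gt0.
rewrite -(lnK (a0 : `|u k| \is Num.pos)) !ler_expR.
move: hl; rewrite ler_norml => /andP[h1 h2]; apply/andP; split; nra.
Qed.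

Lemma has_rate_of_cvg u rho : 0 < rho ->
  (k%:R^-1 * ln `|u k|) @[k --> \oo] --> - rho -> has_rate u rho.
Proof.
move=> r0 hu; apply: has_rate_of_ln => e e0.
(* Because [ln 0 = 0], an index with u k = 0 would give the quotient 0, at distance rho from the
   limit; the tolerance rho / 2 rules this out. *)
pose e' := Num.min e (rho / 2).
have e'0 : 0 < e' by rewrite lt_min e0 divr_gt0.
have [K _ hK] := @cvgr_dist_le _ _ _ _ _ _ _ hu e' e'0.
exists K.+1 => k Kk; have k0 : 0 < k%:R :> R by rewrite ltr0n (leq_ltn_trans _ Kk).
have {hK} := hK k (ltnW Kk); rewrite le_min => /andP[h1 h2]; split.
  apply/eqP => uk; move: h2; rewrite uk normr0 ln0// mulr0 subr0 normrN gtr0_norm//.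
  by apply/negP; rewrite -ltNge; lra.
have -> : ln `|u k| + rho * k%:R = - (- rho - k%:R^-1 * ln `|u k|) * k%:R.
  by field; rewrite gt_eqF.
by rewrite normrM normrN (ger0_norm (ltW k0)) ler_wpM2r// ltW.
Qed.

Lemma has_rate_sub u v rho rho' c : c != 0 -> rho < rho' ->
  has_rate u rho -> has_rate v rho' -> has_rate (fun k => c * (u k - v k)) rho.
Proof.
move=> c0 rr hu hv e e0.
(* The gap between the rates is at least 4 e1. Hence |v k| is at most half the lower bound of |u k|
   once e^(e1 k) >= 2, and the constants 2, |c| and 1/|c| fit into e / 2 - the other half of the
   tolerance. *)
pose e1 := Num.min (e / 2) ((rho' - rho) / 4).
have e10 : 0 < e1 by rewrite lt_min !divr_gt0// subr_gt0.
have /andP[e1e e1r] : (e1 <= e / 2) && (e1 <= (rho' - rho) / 4) by rewrite -le_min.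
have a0 : 0 < `|c| by rewrite normr_gt0.
have [K1 h1] := hu e1 e10; have [K2 h2] := hv e1 e10.
have [K3 h3] := @ler_large_mul (`|ln (2 * `|c|)| + `|ln (2 / `|c|)| + ln 2) e1 e10.
exists (maxn K1 (maxn K2 K3)) => k; rewrite !geq_max => /and3P[k1 k2 k3].
have {h1} /andP[u1 u2] := h1 k k1; have {h2} /andP[v1 v2] := h2 k k2.
have {h3} h3 := h3 k k3.
have kk : 0 <= k%:R :> R by [].
have ln2 : 0 <= ln 2 :> R by rewrite ln_ge0//; lra.
have b1 : 2 * `|c| <= expR (e1 * k%:R).
  rewrite -[leLHS]lnK ?posrE ?mulr_gt0// ler_expR; apply: le_trans h3.
  by have := ler_norm (ln (2 * `|c|)); have := normr_ge0 (ln (2 / `|c|)); lra.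
have b2 : 2 / `|c| <= expR (e1 * k%:R).
  rewrite -[leLHS]lnK ?posrE ?divr_gt0// ler_expR; apply: le_trans h3.
  by have := ler_norm (ln (2 / `|c|)); have := normr_ge0 (ln (2 * `|c|)); lra.
have b3 : 2 <= expR (e1 * k%:R).
  rewrite -[leLHS]lnK ?posrE// ler_expR; apply: le_trans h3.
  by have := normr_ge0 (ln (2 / `|c|)); have := normr_ge0 (ln (2 * `|c|)); lra.
have E0 := expR_gt0 (e1 * k%:R); set E := expR (e1 * k%:R) in b1 b2 b3 E0.
have vlt : `|v k| <= expR (- ((rho + e1) * k%:R)) / 2.
  rewrite ler_pdivlMr//; apply: (@le_trans _ _ (expR (- ((rho' - e1) * k%:R)) * E)).
    by apply: ler_pM.
  by rewrite /E -expRD ler_expR; nra.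
have vlt2 : `|v k| <= expR (- ((rho - e1) * k%:R)).
  by apply: le_trans v2 _; rewrite ler_expR lerN2 ler_wpM2r//; lra.
rewrite normrM; apply/andP; split.
  have low : expR (- ((rho + e1) * k%:R)) / 2 <= `|u k - v k|.
    by have := lerB_dist (u k) (v k); lra.
  have : expR (- ((rho + e) * k%:R)) <= `|c| * (expR (- ((rho + e1) * k%:R)) / 2).
    rewrite [leRHS]mulrCA -ler_pdivrMr ?divr_gt0// invf_div.
    have := expR_gt0 (- ((rho + e) * k%:R)) => P0.
    apply: (@le_trans _ _ (expR (- ((rho + e) * k%:R)) * E)).
      by apply: ler_wpM2l => //; exact: ltW.
    by rewrite /E -expRD ler_expR; nra.
  by move=> /le_trans; apply; apply: ler_wpM2l => //; exact: ltW.
have up : `|u k - v k| <= 2 * expR (- ((rho - e1) * k%:R)).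
  by apply: le_trans (ler_normB _ _) _; lra.
apply: (@le_trans _ _ (E * expR (- ((rho - e1) * k%:R)))).
  apply: (@le_trans _ _ (`|c| * (2 * expR (- ((rho - e1) * k%:R))))).
    by rewrite ler_wpM2l// ltW.
  by rewrite mulrA [`|c| * 2]mulrC ler_wpM2r// ltW// expR_gt0.
by rewrite /E -expRD ler_expR; nra.
Qed.

Section Subsequence.
Variables (n_ : nat -> nat) (sigma : R).
Hypothesis n_gt0 : forall k : nat, (0 < k)%N -> (0 < n_ k)%N.
Hypothesis sigma_gt0 : 0 < sigma.
Hypothesis n_lim : ((n_ k)%:R / k%:R : R) @[k --> \oo] --> sigma.

Lemma n_near e : 0 < e -> exists K, forall k, (K <= k)%N ->
  `|(n_ k)%:R - sigma * k%:R| <= e * k%:R.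
Proof.
move=> e0; have [K _ hK] := @cvgr_dist_le _ _ _ _ _ _ _ n_lim e e0.
exists K.+1 => k Kk; have k0 : 0 < k%:R :> R by rewrite ltr0n (leq_ltn_trans _ Kk).
have -> : (n_ k)%:R - sigma * k%:R = - (sigma - (n_ k)%:R / k%:R) * k%:R.
  by field; rewrite gt_eqF.
rewrite normrM normrN (ger0_norm (ltW k0)) ler_wpM2r//.
exact: hK (ltnW Kk).
Qed.

Lemma n_large N : exists K, forall k, (K <= k)%N -> (N <= n_ k)%N.
Proof.
have s2 : 0 < sigma / 2 by rewrite divr_gt0.
have [K1 h1] := n_near s2; have [K2 h2] := @ler_large_mul N%:R _ s2.
exists (maxn K1 K2) => k; rewrite geq_max => /andP[k1 k2].
rewrite -(ler_nat R); have := h1 k k1; have := h2 k k2.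
by rewrite ler_norml => ? /andP[? ?]; lra.
Qed.

Lemma linform_rate : has_rate
  (fun k => (lcm_upto (2 * n_ k))%:R * linform R (n_ k)) (2 * sigma * (ln 4 - 1)).
Proof.
have l4 := ln4_gt1 R; have s0 := sigma_gt0.
apply: has_rate_of_ln => e e0; set w := ln 4 - 1 : R.
have w0 : 0 < w by rewrite subr_gt0.
pose e1 := e / (2 * (sigma + 1)); have e10 : 0 < e1 by rewrite divr_gt0//; lra.
have [N hN] := ln_lcm_linform e10; have [K1 h1] := n_large N.
pose e2 := Num.min 1 (e / (4 * w)).
have e20 : 0 < e2 by rewrite lt_min ltr01 divr_gt0//; lra.
have /andP[e21 e2e] : (e2 <= 1) && (e2 <= e / (4 * w)) by rewrite -le_min.
have [K2 h2] := n_near e20.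
exists (maxn 1 (maxn K1 K2)) => k; rewrite !geq_max => /and3P[k0 k1 k2].
have [p0 hl] := hN _ (h1 k k1) (n_gt0 k0).
split; first by rewrite gt_eqF.
rewrite (gtr0_norm p0); have := h2 k k2; move: hl; rewrite !ler_norml -/w.
have kk : 0 <= k%:R :> R by [].
have e2w : e2 * w <= e / 4.
  by rewrite -(ler_pM2r w0) in e2e; apply: le_trans e2e _; rewrite le_eqVlt; apply/orP; left; apply/eqP; field; rewrite gt_eqF.
have e1s : e1 * (sigma + 1) = e / 2 by rewrite /e1; field; rewrite gt_eqF//; lra.
move: (ln _) (n_ k)%:R (k%:R : R) kk => l m t kk /andP[a1 a2] /andP[a3 a4].
have m1 : m <= (sigma + 1) * t by nra.
have m2 : e1 * m <= e / 2 * t by rewrite -e1s -mulrA; apply: ler_wpM2l m1; exact: ltW.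
have b1 : (m - sigma * t) * w <= e / 4 * t.
  apply: (@le_trans _ _ (e2 * t * w)); first by apply: ler_wpM2r => //; exact: ltW.
  by rewrite mulrAC; apply: ler_wpM2r.
have b2 : - (e / 4 * t) <= (m - sigma * t) * w.
  apply: (@le_trans _ _ (- (e2 * t) * w)); last by apply: ler_wpM2r => //; exact: ltW.
  by rewrite mulNr lerN2 mulrAC; apply: ler_wpM2r.
by apply/andP; split; lra.
Qed.

Lemma denominator_bound (b : int) e : 0 < e -> exists K, forall k, (K <= k)%N ->
  `|(b * (lcm_upto (2 * n_ k) * apery (n_ k))%N)%:~R| <=
  expR ((2 * sigma * (ln 2 + 1) + e) * k%:R) :> R.
Proof.
move=> e0; have s0 := sigma_gt0.
have ln2 : 0 <= ln 2 :> R by rewrite ln_ge0//; lra.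
pose c := 2 * (ln 2 + 1) : R; have c0 : 0 < c by rewrite /c; lra.
pose e1 := e / (6 * (sigma + 1)); have e10 : 0 < e1 by rewrite divr_gt0//; lra.
have [N hN] := prime_number_theorem e10; have [K1 h1] := n_large N.
pose e2 := Num.min 1 (e / (3 * c)).
have e20 : 0 < e2 by rewrite lt_min ltr01 divr_gt0//; lra.
have /andP[e21 e2e] : (e2 <= 1) && (e2 <= e / (3 * c)) by rewrite -le_min.
have [K2 h2] := n_near e20.
have e3 : 0 < e / 3 by rewrite divr_gt0.
have [K3 h3] := @ler_large_mul (ln (`|b%:~R| + 1)) _ e3.
exists (maxn K1 (maxn K2 K3)) => k; rewrite !geq_max => /and3P[k1 k2 k3].
have {h3} h3 := h3 k k3.
have b0 : 0 < `|b%:~R| + 1 :> R by rewrite ltr_wpDl.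
rewrite intrM normrM -pmulrn natrM [X in _ * X]ger0_norm ?mulr_ge0//.
have d0 : 0 < (lcm_upto (2 * n_ k))%:R :> R by rewrite ltr0n lcm_upto_gt0.
have q0 : 0 < 4 ^+ n_ k :> R by rewrite exprn_gt0.
apply: (@le_trans _ _ ((`|b%:~R| + 1) * ((lcm_upto (2 * n_ k))%:R * 4 ^+ n_ k))).
  apply: ler_pM; rewrite ?lerDl ?mulr_ge0//.
  by rewrite ler_wpM2l// -natrX ler_nat apery_le.
rewrite -[leLHS]lnK ?posrE ?mulr_gt0// ler_expR.
rewrite !lnM ?posrE ?mulr_gt0// lnXn// -[ln 4 *+ _]mulr_natl.
have -> : 4 = 2 * 2 :> R by lra.
rewrite lnM ?posrE//.
have := hN (2 * n_ k)%N (leq_trans (h1 k k1) (leq_pmull _ _)) => /(_ isT).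
have := h2 k k2; move: h3; rewrite natrM !ler_norml.
have kk : 0 <= k%:R :> R by [].
have e2c : e2 * c <= e / 3.
  by rewrite -(ler_pM2r c0) in e2e; apply: le_trans e2e _; rewrite le_eqVlt; apply/orP; left; apply/eqP; field; rewrite gt_eqF.
have e1s : e1 * (sigma + 1) = e / 6 by rewrite /e1; field; rewrite gt_eqF//; lra.
move: (ln (`|_| + 1)) (ln (lcm_upto _)%:R) (n_ k)%:R (k%:R : R) kk => l d m t kk h /andP[a1 a2] /andP[_ a4].
have m1 : m <= (sigma + 1) * t by nra.
have m2 : e1 * m <= e / 6 * t by rewrite -e1s -mulrA; apply: ler_wpM2l m1; exact: ltW.
have b1 : (m - sigma * t) * c <= e / 3 * t.
  apply: (@le_trans _ _ (e2 * t * c)); first by apply: ler_wpM2r => //; exact: ltW.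
  by rewrite mulrAC; apply: ler_wpM2r.
have -> : (2 * sigma * (ln 2 + 1) + e) * t = sigma * t * c + e * t by rewrite /c; ring.
have : l + (d + m * (ln 2 + ln 2)) <= e / 3 * t + (2 * m + 2 * (e1 * m)) + m * (ln 2 + ln 2).
  by lra.
have -> : e / 3 * t + (2 * m + 2 * (e1 * m)) + m * (ln 2 + ln 2) =
  e / 3 * t + 2 * (e1 * m) + (m - sigma * t) * c + sigma * t * c by rewrite /c; ring.
by lra.
Qed.

End Subsequence.
End Rates.

(** * From the hypothesis on log S_n to the irrationality exponent *)

Section Assembly.
Variable R : realType.
Implicit Types (x y alpha mu tau sigma : R) (a b : int).

Lemma dist_int_attained x : exists m : int, dist_int x = `|x - m%:~R|.
Proof.
have [f1 f2] := (floor_le x, floorD1_gt x); set f := Num.floor x in f1 f2.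
rewrite intrD in f2.
pose m := if x - f%:~R <= 2^-1 then f else f + 1.
have hm (j : int) : `|x - m%:~R| <= `|x - j%:~R|.
  have tm : `|x - m%:~R| <= x - f%:~R /\ `|x - m%:~R| <= f%:~R + 1 - x.
    rewrite /m; case: ifPn => [h|]; first by rewrite ger0_norm; lra.
    by rewrite -ltNge => h; rewrite intrD ler0_norm; lra.
  have [jf|fj] := leP j f.
    have : j%:~R <= f%:~R :> R by rewrite ler_int.
    by have := ler_norm (x - j%:~R); lra.
  have : (f + 1)%:~R <= j%:~R :> R by rewrite ler_int lezD1.
  by rewrite intrD; have := ler_norm (j%:~R - x); rewrite distrC; lra.
exists m; apply/le_anti/andP; split.
  by apply: ge_inf; [exists 0 => _ [j _ <-]|exists m].
by apply: lb_le_inf; [exists `|x - m%:~R|, m|move=> _ [j _ <-]].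
Qed.

Lemma frac_part_form a b x : b != 0 -> exists (M : int) (t : R),
  `|t| = `|frac_part x - a%:~R / b%:~R| /\ b%:~R * x = M%:~R + b%:~R * t.
Proof.
move=> b0; have bR : b%:~R != 0 :> R by rewrite intr_eq0.
exists (b * Num.floor x + a), (frac_part x - a%:~R / b%:~R); split=> //.
by rewrite /frac_part intrD intrM; field.
Qed.

(** If the nearest integer m lies above x, the distance is m - x; passing to x - m changes the sign
    of a/b and of t, and only |t| matters. *)
Lemma dist_int_form a b x : b != 0 -> exists (M : int) (t : R),
  `|t| = `|dist_int x - a%:~R / b%:~R| /\ b%:~R * x = M%:~R + b%:~R * t.
Proof.
move=> b0; have bR : b%:~R != 0 :> R by rewrite intr_eq0.
have [m ->] := dist_int_attained x.
have [h|h] := ger0P (x - m%:~R).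
  exists (b * m + a), (x - m%:~R - a%:~R / b%:~R); split=> //.
  by rewrite intrD intrM; field.
exists (b * m - a), (- (- (x - m%:~R) - a%:~R / b%:~R)); split; first by rewrite normrN.
by rewrite intrB intrM; field.
Qed.

Lemma euler_gamma_approx_exponent (n_ : nat -> nat) b (M : nat -> int) (t : nat -> R)
    sigma tau :
  (forall k : nat, (0 < k)%N -> (0 < n_ k)%N) -> b != 0 -> 0 < sigma -> 0 < tau ->
  tau != 2 * sigma * ln (4 / expR 1) ->
  ((n_ k)%:R / k%:R : R) @[k --> \oo] --> sigma ->
  (k%:R^-1 * ln `|t k|) @[k --> \oo] --> - tau ->
  (forall k, b%:~R * ln (S_prod (n_ k))%:R = (M k)%:~R + b%:~R * t k) ->
  approx_exponent (euler_gamma : R) (mu_bound sigma tau).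
Proof.
move=> n_gt0 b0 sigma0 tau0 tau_neq n_lim t_lim S_form.
have bR : b%:~R != 0 :> R by rewrite intr_eq0.
have [P hP] := choice (linform_int R).
have e1 : 0 < expR 1 :> R := expR_gt0 1.
have ln4e : ln (4 / expR 1) = ln 4 - 1 :> R by rewrite ln_div ?posrE// expRK.
have ln2e : ln (2 * expR 1) = ln 2 + 1 :> R by rewrite lnM ?posrE// expRK.
have l4 := ln4_gt1 R.
have ln2 : 0 <= ln 2 :> R by rewrite ln_ge0//; lra.
pose v k := (lcm_upto (2 * n_ k))%:R * linform R (n_ k).
have tr : has_rate t tau := has_rate_of_cvg tau0 t_lim.
have vr : has_rate v (2 * sigma * (ln 4 - 1)) := linform_rate n_gt0 sigma0 n_lim.
pose Q k := b * (lcm_upto (2 * n_ k) * apery (n_ k))%N.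
pose P' k := b * P (n_ k) - M k.
have zeta k : (Q k)%:~R * euler_gamma - (P' k)%:~R = b%:~R * (v k - t k).
  rewrite mulrBr /v hP /Q /P' intrB !intrM -pmulrn.
  rewrite [b%:~R * (_ - _ + _)]mulrDr S_form; ring.
suff main delta : 0 < delta -> has_rate (fun k => b%:~R * (v k - t k)) delta ->
    approx_exponent (euler_gamma : R) (1 + 2 * sigma * (ln 2 + 1) / delta).
  rewrite /mu_bound ln4e ln2e; move: tau_neq; rewrite ln4e neq_lt => /orP[h|h].
    rewrite h.
    have -> : 1 + 2 * sigma / tau * (ln 2 + 1) = 1 + 2 * sigma * (ln 2 + 1) / tau by ring.
    apply: main => //; have -> : (fun k => b%:~R * (v k - t k)) = (fun k => - b%:~R * (t k - v k)).
      by apply/funext => k; ring.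
    by apply: has_rate_sub vr; rewrite ?oppr_eq0.
  rewrite ltNge (ltW h)/=.
  (* sigma cancels between the growth of the coefficient and the decay of the form, and (ln 4 - 1) +
     (ln 2 + 1) = ln 8. *)
  have -> : ln 8 / (ln 4 - 1) = 1 + 2 * sigma * (ln 2 + 1) / (2 * sigma * (ln 4 - 1)) :> R.
    have -> : 8 = 4 * 2 :> R by lra.
    rewrite lnM ?posrE//; move: (ln 4) (ln 2) l4 => u w u1.
    by field; rewrite !gt_eqF//; lra.
  apply: main; first by rewrite !mulr_gt0// subr_gt0.
  exact: has_rate_sub tr.
move=> d0 hr; apply: (approx_exponent_of_forms (Q := Q) (P := P')) => //.
  by rewrite !mulr_ge0 ?(ltW sigma0)//; lra.
move=> e e0; have [K1 h1] := hr e e0.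
have [K2 h2] := denominator_bound sigma0 n_lim b e0.
exists (maxn K1 K2) => k; rewrite geq_max => /andP[k1 k2].
have := h1 k k1; rewrite -zeta => /andP[u1 u2].
by split=> //; exact: h2.
Qed.

Lemma irrational_of_approx_exponent alpha mu : approx_exponent alpha mu -> irrational alpha.
Proof.
move=> h /rationalP[a [c e]]; have [q0 [q00 hq]] := h 1 ltr01.
suff [p [q [qq {}e]]] : exists p q : int, q0 <= q /\ alpha = p%:~R / q%:~R.
  have := hq p q qq; rewrite -e subrr normr0; apply/negP; rewrite -leNgt.
  by rewrite divr_ge0// powR_ge0.
(* The denominator supplied by [rationalP] may be 0, in which case the quotient is 0 by convention.
   Otherwise the fraction is expanded by [q0] to make its denominator large. *)
case: c e => [|c] e.
  by exists 0, q0; split=> //; rewrite e invr0 mulr0 mul0r.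
exists (a * q0), (c.+1%:Z * q0); split; first by rewrite ler_peMl// ltW.
have q0R : q0%:~R != 0 :> R by rewrite intr_eq0 gt_eqF.
have cR : c.+1%:R != 0 :> R by rewrite pnatr_eq0.
by rewrite !intrM -pmulrn e; field; rewrite q0R nat1r.
Qed.

Lemma irrationality_exponent_le alpha mu : 0 < mu -> approx_exponent alpha mu ->
  (irrationality_exponent alpha <= mu%:E)%E.
Proof. by move=> mu0 h; apply: ereal_inf_lbound; exists mu. Qed.

End Assembly.

Unset Implicit Arguments.
Theorem theorem4 (R : realType) (n_ : nat -> nat) (a b : int) (sigma tau : R)
  (n_gt0 : forall k : nat, (0 < k)%N -> (0 < n_ k)%N)
  (b_neq0 : b != 0)
  (sigma_gt0 : 0 < sigma)
  (tau_gt0 : 0 < tau)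
  (tau_neq : tau != 2 * sigma * ln (4 / expR 1))
  (n_lim : ((n_ k)%:R / k%:R : R) @[k --> \oo] --> sigma)
  (S_lim :
     (k%:R^-1 * ln `|frac_part (ln (S_prod (n_ k))%:R) - a%:~R / b%:~R| : R)
       @[k --> \oo] --> - tau
     \/
     (k%:R^-1 * ln `|dist_int (ln (S_prod (n_ k))%:R) - a%:~R / b%:~R| : R)
       @[k --> \oo] --> - tau) :
  [/\ irrational (euler_gamma : R),
      (irrationality_exponent (euler_gamma : R) <= (mu_bound sigma tau)%:E)%E,
      (forall eps : R, 0 < eps -> exists q0 : int, 0 < q0 /\
         forall p q : int, q0 <= q ->
           `|euler_gamma - p%:~R / q%:~R|
             > 1 / q%:~R `^ (mu_bound sigma tau + eps))
    & ~ liouville (euler_gamma : R)].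
Proof.
(* Both versions of the hypothesis say that b log S_n is an integer plus b t with t of rate tau; the
   rest depends on this decomposition alone. *)
have [M [t [t_lim S_form]]] : exists (M : nat -> int) (t : nat -> R),
    (k%:R^-1 * ln `|t k|) @[k --> \oo] --> - tau /\
    forall k, b%:~R * ln (S_prod (n_ k))%:R = (M k)%:~R + b%:~R * t k.
  case: S_lim => S_lim.
    have [M hM] := choice (fun k => frac_part_form a (ln (S_prod (n_ k))%:R : R) b_neq0).
    have [t ht] := choice hM; exists M, t; split=> [|k]; last by case: (ht k).
    by under eq_fun do rewrite (proj1 (ht _)).
  have [M hM] := choice (fun k => dist_int_form a (ln (S_prod (n_ k))%:R : R) b_neq0).
  have [t ht] := choice hM; exists M, t; split=> [|k]; last by case: (ht k).
  by under eq_fun do rewrite (proj1 (ht _)).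
have h := euler_gamma_approx_exponent n_gt0 b_neq0 sigma_gt0 tau_gt0 tau_neq n_lim t_lim S_form.
have mu0 : 0 < mu_bound sigma tau := lt_le_trans ltr01 (approx_exponent_ge1 h).
have le_mu := irrationality_exponent_le mu0 h.
split=> //; first exact: irrational_of_approx_exponent h.
by move=> [_ e]; move: le_mu; rewrite e.
Qed.
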